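(* For any $f,g\in s\mathbb{BV}$, $$(fg)^{\cdot}=\dot f\,g+f\,\dot g\quad\text{in }\mathcal T',$$ where $(\cdot)^{\cdot}$ denotes the derivative $s\mathbb{BV}\to\mathcal T'$ and $\dot f g$, $f\dot g$ are the products of the distributions $\dot f,\dot g\in\mathcal T'$ by $g,f\in s\mathbb{BV}\subset d\mathbb G$, respectively.
   Context: Let $I=(a,b)\subset\mathbf R$ be a fixed open interval (possibly unbounded; then one-sided limits at $a$ or $b$ are limits at $\mp\infty$) and $J=[-\frac12,\frac12]$. Regulated functions: $\mathbb G(I)$ is the algebra of functions $h:I\to\mathbf R$ having finite one-sided limits $h(\tau\pm)$ for all $\tau\in I$ and $h(a+)$, $h(b-)$; functions with the same one-sided limits are identified, so values at points of discontinuity are ignored. $\mathbb G(J)$ is defined in the same way on $J$ (with limits $h(-\frac12+)$, $h(\frac12-)$ at the end points); sup and absolute-value bounds of its elements are computed via one-sided limits. For $h\in\mathbb G(I)$, $\mathrm{var}_I(h)=\sup\sum_{i=2}^n|h(t_i-)-h(t_{i-1}+)|$ over all finite $t_1<\dots<t_n$ in $I$ (analogously on $J$). $\mathbb{BV}(I)$ is the set of $h\in\mathbb G(I)$ with $\mathrm{var}_I(h)<\infty$, and $\mathbb{CBV}(I)$ is the set of its continuous elements. For $h\in\mathbb{BV}(I)$, its continuous part $h_c\in\mathbb{CBV}(I)$ is $h_c=h-h_h$, where $h_h(t)=\sum_{\tau<t}(h(\tau+)-h(\tau-))$ is the jump part (Jordan decomposition). Dynamic functions: a dynamic function is a map $f$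 assigning to each $t\in I$ a function $f(t)(\cdot)$ on $J$ (its dynamic value at $t$). Sums, products and scalar multiples are defined pointwise in $t$ and $s$. If $f(t)(\cdot)$ is constant, $f$ is said to have an ordinary value at $t$, and this constant is denoted $f(t)\in\mathbf R$. $U(f)$ is the set of $t\in I$ at which $f$ has an ordinary value and $D(f)=I\setminus U(f)$. For $M\subset I$, $\sup_M|f|=\sup_{t\in M}\sup_{s\in J}|f(t)(s)|$. If $f$ is bounded in a right neighbourhood of $\tau$, then $f(\tau+)=c\in\mathbf R$ means: for every $\varepsilon>0$ there is $\eta>0$ with $\sup_{(\tau,\tau+\eta)}|f-c|<\varepsilon$; $f(\tau-)$, $f(a+)$, $f(b-)$ are defined analogously. $f$ is continuous at $\tau$ if it has an ordinary value at $\tau$ and $f(\tau)=f(\tau+)=f(\tau-)$; $T(f)$ is the set of points of $I$ at which $f$ is not continuous. $d\mathbb G$ is the algebra of dynamic functions $f$ with $f(t)(\cdot)\in\mathbb G(J)$ for all $t\in I$ such that $f(a+)$, $f(b-)$, $f(\tau+)$, $f(\tau-)$ exist for all $\tau\in I$, with norm $\|f\|_{d\mathbb G}=\sup_I|f|$. For $f\in d\mathbb G$ the set $D(f)$ is at most countable, and the ordinary part $\hat f=\mathrm{ord}(f)$, defined by $\hat f(t)=f(t)$ for $t\in U(f)$, is an element of $\mathbb G(I)$. $s\mathbb G$ is the subalgebra of those $f\in d\mathbb G$ such that for all $t\in I$: $f(t)(\cdot)$ is absolutely continuous on $J$, $f(t)(-\frac12)=f(t-)$ and $f(t)(\frac12)=f(t+)$.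 $s\mathbb{BV}$ is the subalgebra of those $f\in s\mathbb G$ such that $\mathrm{ord}(f)\in\mathbb{BV}(I)$ and $\sum_{t\in D(f)}\mathrm{var}_{s\in J}f(t)(s)<\infty$. Test functions and distributions: $\operatorname{supp} f$ is the closure in $I$ of $\{t\in I: f(t)(\cdot)\text{ is not ordinary or } f(t)\neq0\}$. $\mathcal T$ is the space of $\varphi\in d\mathbb G$ with compact support in $I$; $\varphi_n\to\varphi$ in $\mathcal T$ means $\varphi_n\to\varphi$ in $d\mathbb G$ and there is a closed interval $[c,d]\subset I$ with $\operatorname{supp}\varphi_n\subset[c,d]$ for all $n$. $\mathcal T'$ is the space of linear functionals $\mathcal T\to\mathbf R$ continuous with respect to this convergence; the value of $f$ on $\varphi$ is written $(f,\varphi)$. Multiplication: for $g\in d\mathbb G$ and $f\in\mathcal T'$, the product $gf=fg\in\mathcal T'$ is defined by $(gf,\varphi)=(f,g\varphi)$ for $\varphi\in\mathcal T$. Derivative: for $g\in s\mathbb{BV}$, $\dot g\in\mathcal T'$ is defined by $$(\dot g,\varphi)=\int_I\hat\varphi(t)\,dg_c(t)+\sum_{\tau\in T(g)}\int_J\varphi(\tau)(s)\,\frac{d}{ds}\bigl(g(\tau)(s)\bigr)\,ds,\qquad\varphi\in\mathcal T,$$ where $\hat\varphi=\mathrm{ord}(\varphi)$, $g_c\in\mathbb{CBV}(I)$ is the continuous part of $\mathrm{ord}(g)\in\mathbb{BV}(I)$, and the first integral is a Stieltjes integral. *)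

(* Defs.v *)
From HB Require Import structures.
From mathcomp Require Import all_boot all_order all_algebra.
From mathcomp Require Import all_classical all_reals all_analysis.
Set Implicit Arguments.
Unset Strict Implicit.
Unset Printing Implicit Defensive.
Import Order.TTheory GRing.Theory Num.Theory.
Import numFieldNormedType.Exports.
Local Open Scope classical_set_scope.
Local Open Scope ring_scope.

(* Elements of G(I), G(J) and dG are represented by plain functions, with
   arbitrary values outside I and J. Functions with the same one-sided limits
   represent the same element; there is no quotient type, but every notion
   below depends on a representative only through its class, except that
   absolute continuity in [sG] singles out the (unique) continuous
   representative of each dynamic value. *)

Section Regulated.
Context {R : realType}.
Implicit Types (a b : \bar R) (h : R -> R).

Definition oitv a b : set R := [set t | (a < t%:E)%E /\ (t%:E < b)%E].

(* The filters of the limits "at a+" and "at b-" for the end points of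
   ]a, b[; the cases a = +oo and b = -oo do not occur when a < b. *)
Definition left_end a : set_system R :=
  match a with r%:E => r^'+ | -oo%E => ninfty_nbhs R | +oo%E => pinfty_nbhs R end.
Definition right_end b : set_system R :=
  match b with r%:E => r^'- | -oo%E => ninfty_nbhs R | +oo%E => pinfty_nbhs R end.

Definition llim h (t : R) : R := lim (h x @[x --> t^'-]).
Definition rlim h (t : R) : R := lim (h x @[x --> t^'+]).

Definition regulated a b h : Prop :=
  [/\ forall t, oitv a b t -> cvg (h x @[x --> t^'-]),
      forall t, oitv a b t -> cvg (h x @[x --> t^'+]),
      cvg (h x @[x --> left_end a]) &
      cvg (h x @[x --> right_end b])].

Definition var (A : set R) h : \bar R :=
  ereal_sup [set (\sum_(i < (size t).-1)
                    `|llim h (nth 0 t i.+1) - rlim h (nth 0 t i)|)%:E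
            | t in [set t : seq R | sorted <%R t /\ {subset t <= A}]].

Definition BV a b h : Prop :=
  regulated a b h /\ (var (oitv a b) h < +oo)%E.

(* Unordered sum of an absolutely summable real family. *)
Definition rsum (A : set R) (u : R -> R) : R :=
  fine (\esum_(x in A) (Num.max (u x) 0)%:E)
  - fine (\esum_(x in A) (Num.max (- u x) 0)%:E).

Definition jump_part a b h (t : R) : R :=
  rsum [set tau | oitv a b tau /\ tau < t] (fun tau => rlim h tau - llim h tau).

(* The continuous function in the class of h - jump_part h: as the jump part
   is left-continuous, the value at t is obtained from h(t-). *)
Definition cont_part a b h (t : R) : R := llim h t - jump_part a b h t.

(* l is the Riemann-Stieltjes integral of h with respect to k on [c, d]:
   the limit of the tagged sums as the mesh of the partition tends to 0. *)
Definition is_RS h (k : R -> R) (c d l : R) : Prop :=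
  forall eps : R, 0 < eps -> exists2 delta : R, 0 < delta &
    forall (p : seq R) (xi : nat -> R), itv_partition c d p ->
      let x i := nth 0 (c :: p) i in
      (forall i, (i < size p)%N ->
         [/\ x i <= xi i, xi i <= x i.+1 & x i.+1 - x i < delta]) ->
      `|\sum_(i < size p) h (xi i) * (k (x i.+1) - k (x i)) - l| < eps.

(* Stieltjes integral over ]a, b[ of a function vanishing outside a closed
   subinterval. *)
Definition is_stieltjes a b h (k : R -> R) (l : R) : Prop :=
  exists c d : R, [/\ c <= d, `[c, d] `<=` oitv a b,
    forall t, oitv a b t -> h t != 0 -> c <= t <= d & is_RS h k c d l].
Definition stieltjes a b h (k : R -> R) : R :=
  xget 0 [set l | is_stieltjes a b h k l].

Definition abs_continuous (c d : R) h : Prop :=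
  forall eps : R, 0 < eps -> exists2 delta : R, 0 < delta &
    forall (n : nat) (x y : 'I_n -> R),
      (forall i, [/\ c <= x i, x i <= y i & y i <= d]) ->
      trivIset setT (fun i => [set` `]x i, y i[]) ->
      \sum_(i < n) (y i - x i) < delta ->
      \sum_(i < n) `|h (y i) - h (x i)| < eps.

End Regulated.

Section Dynamic.
Context {R : realType}.

(* f t s is the value at s in J of the dynamic value f(t). *)
Definition dyn : Type := R -> R -> R.

Implicit Types (a b : \bar R) (f g phi psi : dyn) (t : R).

Definition half : R := 2^-1.
Definition J : set R := `[- half, half].

(* All one-sided limits h(s+), h(s-) of h in G(J). *)
Definition Jvals (h : R -> R) : set R :=
  [set v | (exists2 s, - half <= s < half & h x @[x --> s^'+] --> v) \/
           (exists2 s, - half < s <= half & h x @[x --> s^'-] --> v)].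

Definition dadd f g : dyn := fun t s => f t s + g t s.
Definition dmul f g : dyn := fun t s => f t s * g t s.
Definition dscale (k : R) f : dyn := fun t s => k * f t s.
Definition dsub f g : dyn := fun t s => f t s - g t s.
Definition dcst (c : R) : dyn := fun _ _ => c.

Definition dsup (M : set R) f : \bar R :=
  ereal_sup [set ereal_sup [set `|v|%:E | v in Jvals (f t)] | t in M].

(* f has the ordinary value c at t: f(t) = c as elements of G(J). *)
Definition has_ord_value f t (c : R) : Prop := Jvals (f t) = [set c].

Definition U a b f : set R := [set t | oitv a b t /\ exists c, has_ord_value f t c].
Definition D a b f : set R := oitv a b `\` U a b f.

(* F is the filter of a one-sided limit. *)
Definition dyn_cvg (F : set_system R) f (c : R) : Prop :=
  forall eps : R, 0 < eps ->
    exists2 M, F M & (dsup M (dsub f (dcst c)) < eps%:E)%E.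

Definition dyn_continuous_at f t : Prop :=
  exists c, [/\ has_ord_value f t c, dyn_cvg t^'+ f c & dyn_cvg t^'- f c].

Definition T a b f : set R := [set t | oitv a b t /\ ~ dyn_continuous_at f t].

Definition dG a b f : Prop :=
  [/\ forall t, oitv a b t -> regulated (- half)%:E half%:E (f t),
      forall t, oitv a b t -> exists c, dyn_cvg t^'- f c,
      forall t, oitv a b t -> exists c, dyn_cvg t^'+ f c,
      exists c, dyn_cvg (left_end a) f c &
      exists c, dyn_cvg (right_end b) f c].

(* The first one-sided limit of f(t) is its ordinary value for t in U(f). On
   the countable set D(f), where the value of ord f is immaterial in G(I), it
   gives a choice that keeps ord f regulated. *)
Definition ord f : R -> R := fun t => rlim (f t) (- half).

Definition sG a b f : Prop :=
  dG a b f /\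
  forall t, oitv a b t ->
    [/\ abs_continuous (- half) half (f t),
        dyn_cvg t^'- f (f t (- half)) & dyn_cvg t^'+ f (f t half)].

Definition sBV a b f : Prop :=
  [/\ sG a b f, BV a b (ord f) & (\esum_(t in D a b f) var J (f t) < +oo)%E].

Definition supp a b f : set R :=
  closure [set t | oitv a b t /\ ~ has_ord_value f t 0] `&` oitv a b.

Definition test a b phi : Prop := dG a b phi /\ compact (supp a b phi).

Definition test_cvg a b (phi_ : nat -> dyn) phi : Prop :=
  dsup (oitv a b) (dsub (phi_ n) phi) @[n --> \oo] --> 0%E /\
  exists c d : R, [/\ c <= d, `[c, d] `<=` oitv a b &
                      forall n, supp a b (phi_ n) `<=` `[c, d]].

(* Membership in the dual of the space of test functions. Sequential
   continuity makes F independent of the representatives of test functions;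
   the values of F on other arguments are irrelevant. *)
Definition distribution a b (F : dyn -> R) : Prop :=
  (forall (k : R) phi psi, test a b phi -> test a b psi ->
     F (dadd (dscale k phi) psi) = k * F phi + F psi) /\
  (forall (phi_ : nat -> dyn) phi, (forall n, test a b (phi_ n)) ->
     test a b phi -> test_cvg a b phi_ phi -> F (phi_ n) @[n --> \oo] --> F phi).

Definition distr_eq a b (F G : dyn -> R) : Prop :=
  [/\ distribution a b F, distribution a b G &
      forall phi, test a b phi -> F phi = G phi].

Definition distr_add (F G : dyn -> R) : dyn -> R := fun phi => F phi + G phi.

Definition distr_mul g (F : dyn -> R) : dyn -> R := fun phi => F (dmul g phi).

Definition dyn_deriv a b g : dyn -> R := fun phi =>
  stieltjes a b (ord phi) (cont_part a b (ord g)) +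
  rsum (T a b g) (fun tau =>
    \int[lebesgue_measure]_(s in J) (phi tau s * derive1 (g tau) s)).

End Dynamic.
Arguments dyn : clear implicits.

(* Main.v *)
From HB Require Import structures.
Require Import Defs.
From mathcomp Require Import all_boot all_order all_algebra.
From mathcomp Require Import all_classical all_reals all_analysis.
From mathcomp Require Import measurable_realfun ring lra.
Set Implicit Arguments.
Unset Strict Implicit.
Unset Printing Implicit Defensive.
Import Order.TTheory GRing.Theory Num.Theory.
Import numFieldNormedType.Exports.
Local Open Scope classical_set_scope.
Local Open Scope ring_scope.

(* The sums over T(fg), T(f) and T(g) may all be taken over the whole of I, since
   a dynamic value of g outside T(g) is constant. They then match term by term:
   absolutely continuous functions are differentiable almost everywhere with an
   integrable derivative (Radon-Nikodym applied to the Lebesgue-Stieltjes measure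
   of the variation, then Lebesgue differentiation), so that
   (f(t)g(t))' = f(t)' g(t) + f(t) g(t)' almost everywhere on J.

   There remains d(fg)_c = g df_c + f dg_c for the ordinary parts, which are
   left-continuous. On an interval where f and g oscillate by at most eps, for m
   in that interval both the increment and the jumps of f g - g(m) f - f(m) g are
   at most eps times those of f and g. So the increment of
   (fg)_c - g(m) f_c - f(m) g_c is at most 4 eps times the increment of a
   nondecreasing function W dominating the variations. Regulated functions
   have arbitrarily fine partitions into such intervals, and summing over one of
   them compares the Riemann-Stieltjes sums of the three integrals. *)

(** * Absolutely continuous functions *)

(** [xget], [rsum], [derive1], [lim] and [fine] are total, with default values, so much of the work
    shows that each term of [dyn_deriv] is a genuine one: the Stieltjes integral exists and does not
    depend on the interval enclosing the support, the sum over T(g) is absolutely summable, and each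
    integral over J can be replaced by one of an integrable function. [distr_eq] also asks that both
    sides be distributions. This is deduced from a bound by a constant times the sup norm,
    [bounded_functional], which passes to sums and to products with elements of dG. Left-continuity
    comes from [ord], which picks f(t)(-1/2+): on sG this is f(t-), at points of D(f) too.
    Continuity of the integrators is used twice. It makes regulated integrands, whose jumps are
    unrelated to those of f and g, integrable. It also handles the cells of a partition, at whose
    end points f and g may jump: the comparison is made strictly inside a cell and carried to its
    ends by continuity. The bounded variation of a dynamic value, from which its density is built,
    comes from the sum over D(f) in sBV; on U(f) the value is constant. *)

Section AbsolutelyContinuousMonotone.
Context {R : realType}.
Local Notation mu := (@lebesgue_measure R).

(** A version on the whole line, because a Lebesgue-Stieltjes measure is attached to a function on
    all of R. Functions on [c, d] reach it by clamping their argument. *)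
Definition abs_continuousT (F : R -> R) : Prop :=
  forall eps : R, 0 < eps -> exists2 delta : R, 0 < delta &
    forall (n : nat) (x y : 'I_n -> R),
      (forall i, x i <= y i) ->
      trivIset setT (fun i => [set` `]x i, y i[]) ->
      \sum_(i < n) (y i - x i) < delta ->
      \sum_(i < n) `|F (y i) - F (x i)| < eps.

Lemma abs_continuousT_continuous (F : R -> R) : abs_continuousT F -> continuous F.
Proof.
move=> acF x; apply/cvgrPdist_lt => e e0.
have [d d0 H] := acF _ e0.
near=> y.
have yd : `|x - y| < d by near: y; exact: (@cvgr_dist_lt _ _ _ (nbhs x)).
have K (u v : R) : u <= v -> v - u < d -> `|F v - F u| < e.
  move=> uv vud.
  have := H 1%N (fun=> u) (fun=> v).
  rewrite !big_ord1; apply => //.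
  by move=> i j _ _ _; rewrite (ord1 i) (ord1 j).
have [xy|yx] := leP x y.
  by rewrite distrC K// -(ger0_norm (_ : 0 <= y - x)) ?subr_ge0// distrC.
by rewrite K ?(ltW yx)// -(ger0_norm (_ : 0 <= x - y)) ?subr_ge0 ?(ltW yx).
Unshelve. all: by end_near. Qed.

(** A null set lies in an open set of measure below delta, whose components are disjoint intervals;
    absolute continuity bounds every finite sum of the increments of F over them. *)
Lemma abs_continuous_dominates (F : cumulative R R) : abs_continuousT F ->
  lebesgue_stieltjes_measure F `<< mu.
Proof.
move=> acF; apply/null_content_dominatesP => N mN N0.
apply/eqP; rewrite eq_le measure_ge0 andbT; apply/lee_addgt0Pr => e e0.
rewrite add0e.
have [d d0 H] := acF _ e0.
have [|U [oU NU UNd]] := lebesgue_regularity_outer mN _ d0; first by rewrite N0.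
have mU : measurable U by exact: open_measurable.
have Ud : (mu U < d%:E)%E.
  rewrite -(setDUK NU) measureU//; last 2 first.
    exact: measurableD.
    by rewrite setDIK.
  by rewrite N0 add0e.
pose I := open_disjoint_itv oU.
have mI q : measurable (I q) by apply: open_measurable; exact: open_disjoint_itv_open.
have tI : trivIset setT I by exact: open_disjoint_itv_trivIset.
have UE : U = \bigcup_q I q by exact: open_disjoint_itv_bigcup.
apply: (@le_trans _ _ (lebesgue_stieltjes_measure F U)).
  by apply: le_measure => //; rewrite inE.
rewrite [in leLHS]UE measure_bigcup//; last by move=> ? _; exact: mI.
rewrite -(eq_eseriesl (P := xpredT)); last by move=> q; rewrite in_setT.
apply: lime_le; first by apply: is_cvg_nneseries => q _ _; exact: measure_ge0.
apply: nearW => n.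
(* A non-empty component is bounded because its length is below d; an empty one gets the degenerate
   interval (0, 0). The half-open interval is there because its measure is an increment of F, the
   open one because it inherits disjointness. *)
have itvI q : exists ab : R * R, [/\ ab.1 <= ab.2, I q `<=` `]ab.1, ab.2]%classic,
    (mu (I q) = (ab.2 - ab.1)%:E) & `]ab.1, ab.2[%classic `<=` I q].
  have [->|I0] := eqVneq (I q) set0.
    exists (0, 0); rewrite measure0 subrr /=; split => //.
    by move=> x /=; rewrite in_itv/= => /andP[/lt_trans/[apply]]; rewrite ltxx.
  have intI : is_interval (I q) by exact: open_disjoint_itv_is_interval.
  have oI : open (I q) by exact: open_disjoint_itv_open.
  have Iq : (mu (I q) < d%:E)%E.
    apply: le_lt_trans Ud; apply: le_measure; [exact: mem_set (mI q)|exact: mem_set|].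
    by rewrite UE; exact: bigcup_sup.
  have [x0 Ix0] : exists x, I q x by exact/set0P.
  have Id (u v : R) : I q u -> I q v -> u <= v -> v - u < d.
    move=> Iu Iv uv; rewrite -lte_fin; apply: le_lt_trans Iq.
    have -> : (v - u)%:E = mu `]u, v[%classic.
      rewrite lebesgue_measure_itv/= lte_fin; case: ltgtP uv => // ->.
      by rewrite subrr.
    apply: le_measure; [exact: mem_set (measurable_itv _)|exact: mem_set (mI q)|].
    by move=> z /=; rewrite in_itv/= => /andP[uz zv]; apply: (intI u v Iu Iv); rewrite !ltW.
  have lbI : has_lbound (I q).
    exists (x0 - d) => y Iy; have [yx|xy] := leP y x0; last by lra.
    by have := Id _ _ Iy Ix0 yx; lra.
  have ubI : has_ubound (I q).
    exists (x0 + d) => y Iy; have [xy|yx] := leP x0 y; last by lra.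
    by have := Id _ _ Ix0 Iy xy; lra.
  have IE := interval_bounded_interior intI lbI ubI.
  move: (oI) => /interior_id iE; rewrite iE in IE.
  have IE' : I q = `]inf (I q), sup (I q)[%classic.
    by rewrite {1}IE; apply/seteqP; split => x /=; rewrite in_itv.
  have is_le : inf (I q) <= sup (I q).
    move: (eq_ind _ (fun A : set R => A x0) Ix0 _ IE) => /= /andP[/lt_trans/[apply]/ltW]; exact.
  exists (inf (I q), sup (I q)); split => //=.
  - by rewrite {1}IE' => x /=; rewrite !in_itv/= => /andP[-> /ltW].
  - rewrite {1}IE' lebesgue_measure_itv/= lte_fin; case: ltgtP is_le => // -> _.
    by rewrite subrr.
  - by rewrite -IE'.
have {itvI} /choice[ab abP] := itvI.
pose x (i : 'I_n) := (ab i).1.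
pose y (i : 'I_n) := (ab i).2.
have xy i : x i <= y i by have [] := abP i.
apply: (@le_trans _ _ (\sum_(i < n) `|F (y i) - F (x i)|)%:E).
  rewrite big_mkord -sumEFin; apply: lee_sum => i _.
  have [_ Iab _ _] := abP i.
  apply: (@le_trans _ _ (lebesgue_stieltjes_measure F `](ab i).1, (ab i).2]%classic)).
    by apply: le_measure => //; apply: mem_set; [exact: mI|exact: measurable_itv].
  rewrite /lebesgue_stieltjes_measure/= /measure_extension measurable_mu_extE/=; last first.
    exact: is_ocitv.
  by rewrite (wlength_itv_bnd _ _ _ (xy i)) lee_fin ler_norm.
rewrite lee_fin ltW//; apply: H => //.
  apply/trivIsetP => i j _ _ ij.
  apply: (subsetI_eq0 (B := I i) (D := I j)).
  - by have [] := abP i.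
  - by have [] := abP j.
  - by move/trivIsetP : tI; apply.
rewrite -lte_fin -sumEFin; apply: le_lt_trans Ud.
rewrite UE measure_bigcup//; last by move=> ? _; exact: mI.
rewrite -(eq_eseriesl (P := xpredT)); last by move=> q; rewrite in_setT.
apply: le_trans (nneseries_lim_ge n _) => //.
rewrite big_mkord; apply: lee_sum => i _.
by have [_ _ <- _] := abP i.
Qed.

(** Restricting to ]c, d] makes the measure of F finite. Its density integrates to F x - F c only
    for x in [c, d], so the derivative is claimed only inside. *)
Lemma cumulative_density (F : cumulative R R) (c d : R) : abs_continuousT F -> c < d ->
  exists u : R -> R, [/\ mu.-integrable [set: R] (EFin \o u), (forall x, 0 <= u x),
    (\int[mu]_(x in `]c, d]) (u x)%:E = (F d - F c)%:E)%E &
    {ae mu, forall x, c < x < d -> is_derive x 1 (F : R -> R) (u x)}].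
Proof.
move=> acF cd; pose D : set R := `]c, d]%classic.
have LSE (x : R) : c <= x ->
    lebesgue_stieltjes_measure F `]c, x]%classic = (F x - F c)%:E.
  move=> cx; rewrite /lebesgue_stieltjes_measure/= /measure_extension.
  rewrite measurable_mu_extE/=; last exact: is_ocitv.
  by rewrite (wlength_itv_bnd _ _ _ cx).
have mD : @measurable _ (measurableTypeR R) D by exact: measurable_itv.
have Doo : (lebesgue_stieltjes_measure F D < +oo)%E.
  by rewrite LSE ?ltW// ltry.
have numu : mfrestr mD Doo `<< mu.
  apply/null_content_dominatesP => A mA A0.
  move/null_content_dominatesP : (abs_continuous_dominates acF) => H.
  apply/eqP; rewrite eq_le measure_ge0 andbT.
  rewrite -(H A mA A0) /mfrestr/= /mrestr; apply: le_measure => //; rewrite inE//.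
  exact: measurableI.
pose nu : {finite_measure set (measurableTypeR R) -> \bar R} := mfrestr mD Doo.
have [f [f0 ffin fint fE]] := @radon_nikodym_sigma_finite _ (measurableTypeR R) R mu (mfrestr mD Doo) numu.
pose u : R -> R := fine \o f.
have uE x : (u x)%:E = f x by rewrite /u /= fineK.
have uE' : EFin \o u = f by apply/funext => x /=.
have intu : mu.-integrable [set: R] (EFin \o u) by rewrite uE'.
have uFE (x : R) : c <= x <= d ->
    (\int[mu]_(y in `]c, x]) (u y)%:E = (F x - F c)%:E)%E.
  move=> /andP[cx xd]; under eq_integral do rewrite uE.
  rewrite -LSE// -fE; last exact: measurable_itv.
  rewrite /mfrestr /mrestr; congr (lebesgue_stieltjes_measure F _).
  apply/setIidPl => y /=; rewrite in_itv/= => /andP[cy yx].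
  by rewrite /D/= in_itv/= cy (le_trans yx).
exists u; split => //.
- by move=> x; rewrite /u /= fine_ge0.
- by apply: uFE; rewrite lexx ltW.
have := @FTC1 R u (BRight c).
have iS (y : R) : mu.-integrable `]c, y] (EFin \o u).
  by apply: integrableS intu => //; exact: measurable_itv.
move=> /(_ iS).
have locu : locally_integrable [set: R] u by apply: open_integrable_locally => //; exact: openT.
move=> /(_ locu).
apply: filterS; first exact: (ae_filter_ringOfSetsType mu).
move=> x H /andP[cx xd].
have [dG GE] := H cx.
have FE : \near x, (\int[mu]_(t in `]c, x]) u t) + F c = F x.
  near=> y.
  rewrite /Rintegral uFE/= ?subrK//.
  by apply/andP; split; apply: ltW; near: y; [exact: lt_nbhsr|exact: lt_nbhsl].
have dG' : is_derive x 1 (fun x => (\int[mu]_(t in `]c, x]) u t) + F c) (u x).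
  have : is_derive x 1 (fun x => \int[mu]_(t in `]c, x]) u t) (u x).
    by apply: DeriveDef; [exact: dG|rewrite -derive1E].
  move=> ?; rewrite -[X in is_derive _ _ _ X]addr0; exact: is_deriveD.
exact: (near_eq_is_derive (f := fun x => (\int[mu]_(t in `]c, x]) u t) + F c)).
Unshelve. all: by end_near. Qed.

End AbsolutelyContinuousMonotone.

(** * Variation and densities of absolutely continuous functions *)

Section AbsolutelyContinuousVariation.
Context {R : realType}.
Local Notation mu := (@lebesgue_measure R).
Local Notation TV := (@total_variation R).

(** Refining n intervals by N cells each gives a family indexed by pairs, hence the general finite
    index type. *)
Lemma abs_continuous_finType (c d : R) (h : R -> R) : abs_continuous c d h ->
  forall eps : R, 0 < eps -> exists2 delta : R, 0 < delta &
    forall (I : finType) (x y : I -> R),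
      (forall i, [/\ c <= x i, x i <= y i & y i <= d]) ->
      trivIset setT (fun i => [set` `]x i, y i[]) ->
      \sum_i (y i - x i) < delta ->
      \sum_i `|h (y i) - h (x i)| < eps.
Proof.
move=> ach e e0; have [d0 d00 H] := ach e e0; exists d0 => // I x y xy txy.
rewrite (big_enum_val (A := I) (fun i => y i - x i)).
rewrite (big_enum_val (A := I) (fun i => `|h (y i) - h (x i)|)) => xyd.
apply: (H _ (fun i => x (enum_val i)) (fun i => y (enum_val i))) => //.
apply/trivIsetP => i j _ _ ij; move/trivIsetP : txy; apply => //.
by apply: contra ij => /eqP/enum_val_inj ->.
Qed.

Lemma itv_partition_homo (x y : R) (s : seq R) : itv_partition x y s ->
  {homo nth y (x :: s) : i j / (i <= j)%N >-> i <= j}.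
Proof.
move=> xys; have [/(pathP y) pth _] := xys.
apply: homo_leq => [z|u v w|i]; [exact: lexx|exact: le_trans|].
have [/pth/ltW//|] := ltnP i (size s).
rewrite leq_eqVlt => /predU1P[<-|si]; last by rewrite !nth_default //= ltnW.
by rewrite (itv_partition_nth_size _ xys) nth_default.
Qed.

Lemma variation_extend (x y : R) (h : R -> R) (s : seq R) (N : nat) :
  itv_partition x y s -> (size s <= N)%N ->
  \sum_(j < N) `|h (nth y (x :: s) j.+1) - h (nth y (x :: s) j)| = variation x y h s.
Proof.
move=> xys sN.
rewrite -(big_mkord xpredT (fun j => `|h (nth y (x :: s) j.+1) - h (nth y (x :: s) j)|)).
rewrite (big_cat_nat _ sN)//= -[RHS]addr0 /variation/=; congr (_ + _).
rewrite big_nat_cond big1// => j /andP[/andP[sj _] _].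
rewrite nth_default//; move: sj; rewrite leq_eqVlt => /predU1P[<-|sj].
  by rewrite (itv_partition_nth_size _ xys) subrr normr0.
by rewrite nth_default// subrr normr0.
Qed.

(** Replacing each interval by a partition that almost attains its variation keeps the family
    disjoint and its total length unchanged, so the delta of h for e / 2 still serves. The other e /
    2 pays for the n approximations. *)
Lemma abs_continuous_total_variation (c d : R) (h : R -> R) :
    abs_continuous c d h -> bounded_variation c d h ->
  forall eps : R, 0 < eps -> exists2 delta : R, 0 < delta &
    forall (n : nat) (x y : 'I_n -> R),
      (forall i, [/\ c <= x i, x i <= y i & y i <= d]) ->
      trivIset setT (fun i => [set` `]x i, y i[]) ->
      \sum_(i < n) (y i - x i) < delta ->
      \sum_(i < n) fine (TV (x i) (y i) h) < eps.
Proof.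
move=> ach bvh e e0.
have e20 : 0 < e / 2 by rewrite divr_gt0.
have [d0 d00 H] := abs_continuous_finType ach e20.
exists d0 => // n x y xy txy xyd.
have bv i : bounded_variation (x i) (y i) h.
  have [cx xyi yd] := xy i.
  by apply: (bounded_variationl xyi yd); apply: bounded_variationr bvh => //; apply: le_trans yd.
have tvfin i : TV (x i) (y i) h \is a fin_num.
  by have [_ xyi _] := xy i; exact/bounded_variationP.
have e1 : 0 < e / 2 / n.+1%:R by rewrite divr_gt0.
have /choice[s sP] : forall i, exists s, itv_partition (x i) (y i) s /\
    fine (TV (x i) (y i) h) < variation (x i) (y i) h s + e / 2 / n.+1%:R.
  move=> i.
  have [_ [_ [s xys <-] <-]] := ub_ereal_sup_adherent e1 (tvfin i).
  by rewrite -[X in (X - _ < _)%E](fineK (tvfin i)) -EFinB lte_fin ltrBlDr; exists s.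
(* Reading past the end of s i yields the end point y i, so that all these
   partitions can be padded to the common length N with degenerate intervals. *)
pose N := \max_i size (s i).
pose g (i : 'I_n) (j : nat) := nth (y i) (x i :: s i) j.
have sN i : (size (s i) <= N)%N by exact: leq_bigmax.
have gE i : \sum_(j < N) `|h (g i j.+1) - h (g i j)| = variation (x i) (y i) h (s i).
  by apply: variation_extend => //; have [] := sP i.
have gh i : {homo g i : i j / (i <= j)%N >-> i <= j}.
  by apply: itv_partition_homo; have [] := sP i.
have gN i : g i N = y i.
  have [xys _] := sP i.
  have := sN i; rewrite leq_eqVlt => /predU1P[<-|sNi]; last by rewrite /g nth_default.
  exact: itv_partition_nth_size xys.
have gy i j : g i j <= y i.
  have [jN|/ltnW Nj] := leqP j N; first by rewrite -(gN i) gh.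
  rewrite /g; case: j Nj => [|j Nj]; first by have [_ xyi _] := xy i.
  rewrite leNgt; apply/negP => ylt.
  have [sj|js] := leqP (size (s i)) j; first by move: ylt; rewrite /= nth_default// ltxx.
  have := gh i j.+1 N; rewrite gN /g => /(_ (leq_trans js (sN i))); rewrite leNgt ylt.
  done.
have xg i j : x i <= g i j by rewrite -[x i]/(g i 0%N) gh.
have := H ('I_n * 'I_N)%type (fun p => g p.1 p.2) (fun p => g p.1 p.2.+1).
rewrite -(pair_big xpredT xpredT (fun i j => `|h (g i (nat_of_ord j).+1) - h (g i j)|))/=.
rewrite -(pair_big xpredT xpredT (fun i j => g i (nat_of_ord j).+1 - g i j))/=.
under [X in _ -> _ -> _ -> X < _]eq_bigr do rewrite gE.
move=> K.
apply: (@le_lt_trans _ _ (\sum_(i < n) (variation (x i) (y i) h (s i) + e / 2 / n.+1%:R))).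
  by apply: ler_sum => i _; rewrite ltW//; have [] := sP i.
rewrite big_split/= [ltRHS](splitr e) ltr_leD//; last first.
  rewrite sumr_const card_ord -[X in X <= _]mulr_natr -mulrA ler_piMr//; first exact: ltW.
  by rewrite [X in X <= _]mulrC ler_pdivrMr// mul1r ler_nat.
apply: K.
- move=> -[i j]/=; have [cx xyi yd] := xy i; split.
  + exact: le_trans (xg i j).
  + exact: gh.
  + exact: le_trans (gy _ _) yd.
- apply/trivIsetP => -[i j] [i' j'] _ _ ij.
  have [ii'|ii'] := eqVneq i i'; last first.
    move/trivIsetP : txy => /(_ i i' I I ii'); apply: subsetI_eq0 => z /=;
      rewrite !in_itv/= => /andP[z1 z2]; apply/andP;
      (split; [exact: le_lt_trans (xg _ _) z1|exact: lt_le_trans z2 (gy _ _)]).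
  subst i'; have jj' : (j : nat) != j' by apply: contra ij => /eqP/val_inj ->.
  apply/seteqP; split => z //=; rewrite !in_itv/= => -[/andP[z1 z2] /andP[z3 z4]].
  move: jj'; rewrite neq_ltn => /orP[] /(gh i) gg.
    by have := lt_trans z3 z2; rewrite ltNge gg.
  by have := lt_trans z1 z4; rewrite ltNge gg.
- apply: le_lt_trans xyd; apply: ler_sum => i _.
  rewrite -(big_mkord xpredT (fun j => g i j.+1 - g i j)) telescope_sumr//.
  by rewrite lerB.
Qed.

Lemma nondecreasing_density (F : R -> R) (c d : R) :
  nondecreasing F -> abs_continuousT F -> c < d ->
  exists u : R -> R, [/\ mu.-integrable [set: R] (EFin \o u), (forall x, 0 <= u x),
    (\int[mu]_(x in `]c, d]) (u x)%:E = (F d - F c)%:E)%E &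
    {ae mu, forall x, c < x < d -> is_derive x 1 (F : R -> R) (u x)}].
Proof.
move=> ndF acF cd.
have rcF : right_continuous F by apply: right_continuousW; exact: abs_continuousT_continuous.
pose G : cumulative R R := HB.pack F (isCumulative.Build R _ R F ndF rcF).
exact: (@cumulative_density R G c d acF cd).
Qed.

(** h is the difference of its variation function F1 and of F1 - h, both nondecreasing because the
    variation dominates the increments of h. Their densities integrate to the total variation and to
    at most twice it, which gives the factor 3. *)
Lemma abs_continuous_derivable (c d : R) (h : R -> R) : c < d ->
    abs_continuous c d h -> bounded_variation c d h ->
  exists u : R -> R, [/\ mu.-integrable [set: R] (EFin \o u),
    (\int[mu]_(x in `]c, d]) `|u x|%:E <= 3%:E * TV c d h)%E &
    {ae mu, forall x, c < x < d -> is_derive x 1 h (u x)}].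
Proof.
move=> cd ach bvh.
(* Clamping extends everything by constants outside [c, d]; it neither lengthens intervals nor makes
   disjoint ones overlap. *)
pose cl (x : R) := Num.max c (Num.min x d).
have ccl x : c <= cl x by rewrite le_max lexx.
have cld x : cl x <= d by rewrite ge_max (ltW cd)/= ge_min lexx orbT.
have clE x : c <= x <= d -> cl x = x.
  by move=> /andP[cx xd]; rewrite /cl min_l// max_r.
have clD x y : x <= y -> cl x <= cl y /\ cl y - cl x <= y - x.
  rewrite /cl /Num.max /Num.min => xy; split; do ! case: ifPn; rewrite -?leNgt; lra.
have clS x y : `]cl x, cl y[ `<=` `]x, y[.
  move=> z /=; rewrite !in_itv/= /cl gt_max lt_max !lt_min ?gt_min.
  move=> /andP[/andP[cz /orP xz] /orP zy].
  by case: xz => xz; case: zy => [|/andP[]]; lra.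
pose F1 x := fine (TV c (cl x) h).
have bv (x y : R) : c <= x -> x <= y -> y <= d -> bounded_variation x y h.
  move=> cx xy yd.
  by apply: (bounded_variationl xy yd); apply: bounded_variationr bvh => //; apply: le_trans yd.
have tvfin x y : c <= x -> x <= y -> y <= d -> TV x y h \is a fin_num.
  by move=> cx xy yd; exact/bounded_variationP/bv.
have F1D x y : x <= y -> F1 y - F1 x = fine (TV (cl x) (cl y) h).
  move=> xy; have [clxy _] := clD _ _ xy.
  rewrite /F1 (total_variationD h (ccl x) clxy) fineD; last 2 first.
  - exact: tvfin.
  - exact: tvfin.
  by rewrite addrAC subrr add0r.
(* The factor 2 is for F2, whose increments combine a variation and an increment of h. *)
have acF (F : R -> R) : (forall x y, x <= y -> `|F y - F x| <= 2 * fine (TV (cl x) (cl y) h)) ->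
    abs_continuousT F.
  move=> FTV e e0; have e20 : 0 < e / 2 by rewrite divr_gt0.
  have [d0 d00 H] := abs_continuous_total_variation ach bvh e20.
  exists d0 => // n x y xy txy xyd.
  rewrite [ltRHS](_ : e = 2 * (e / 2)); last by field.
  apply: (@le_lt_trans _ _ (2 * \sum_(i < n) fine (TV (cl (x i)) (cl (y i)) h))).
    by rewrite mulr_sumr; apply: ler_sum => i _; exact: FTV.
  rewrite ltr_pM2l//; apply: H.
  - by move=> i; have [clxy _] := clD _ _ (xy i).
  - apply/trivIsetP => i j _ _ ij; move/trivIsetP : txy => /(_ i j I I ij).
    by apply: subsetI_eq0; exact: clS.
  - by apply: le_lt_trans xyd; apply: ler_sum => i _; have [] := clD _ _ (xy i).
have tvge x y : x <= y -> `|h (cl y) - h (cl x)| <= fine (TV (cl x) (cl y) h).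
  move=> xy; have [clxy _] := clD _ _ xy.
  by rewrite -lee_fin fineK ?tvfin//; exact: total_variation_ge.
have tv0 x y : x <= y -> 0 <= fine (TV (cl x) (cl y) h).
  by move=> xy; apply: le_trans (tvge _ _ xy).
pose F2 x := F1 x - h (cl x).
have ndF1 : nondecreasing F1.
  by move=> x y xy; rewrite -subr_ge0 F1D// tv0.
have F2D x y : x <= y -> F2 y - F2 x = fine (TV (cl x) (cl y) h) - (h (cl y) - h (cl x)).
  by move=> xy; rewrite -F1D// /F2; ring.
have ndF2 : nondecreasing F2.
  by move=> x y xy; rewrite -subr_ge0 F2D// subr_ge0; apply: le_trans (tvge _ _ xy); exact: ler_norm.
have acF1 : abs_continuousT F1.
  apply: acF => x y xy; rewrite F1D// ger0_norm ?tv0//.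
  by have := tv0 _ _ xy; lra.
have acF2 : abs_continuousT F2.
  apply: acF => x y xy; rewrite F2D//.
  by apply: (le_trans (ler_normB _ _)); rewrite ger0_norm ?tv0//; have := tvge _ _ xy; lra.
have [u1 [iu1 u10 Iu1 du1]] := nondecreasing_density ndF1 acF1 cd.
have [u2 [iu2 u20 Iu2 du2]] := nondecreasing_density ndF2 acF2 cd.
have mI : measurable (`]c, d] : set R) by exact: measurable_itv.
have mu1 : measurable_fun setT u1 by apply/measurable_EFinP; exact: measurable_int iu1.
have mu2 : measurable_fun setT u2 by apply/measurable_EFinP; exact: measurable_int iu2.
exists (u1 \- u2); split.
- exact: (integrableB measurableT iu1 iu2).
- apply: (@le_trans _ _ (\int[mu]_(x in `]c, d]) ((u1 x)%:E + (u2 x)%:E))%E).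
    apply: ge0_le_integral => //.
    + apply/measurable_EFinP; apply: measurableT_comp => //.
      by apply: measurable_funB; exact: measurable_funTS.
    + by apply: emeasurable_funD; apply/measurable_EFinP; exact: measurable_funTS.
    + move=> x _; rewrite -EFinD lee_fin (le_trans (ler_normB _ _))//.
      by rewrite !ger0_norm.
  rewrite ge0_integralD//; last 4 first.
  + by move=> x _; rewrite lee_fin.
  + by apply/measurable_EFinP; exact: measurable_funTS.
  + by move=> x _; rewrite lee_fin.
  + by apply/measurable_EFinP; exact: measurable_funTS.
  have cd' := ltW cd.
  have clc : cl c = c by rewrite clE// lexx.
  have cld1 : cl d = d by rewrite clE// lexx cd'.
  have tvE : TV c d h = (fine (TV c d h))%:E by rewrite fineK// tvfin.
  rewrite Iu1 Iu2 -EFinD F1D// F2D//.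
  rewrite clc cld1 tvE -EFinM lee_fin/=.
  have := tvge c d cd'; rewrite clc cld1.
  by rewrite ler_norml => /andP[]; lra.
- apply: filterS2 du1 du2; first exact: (ae_filter_ringOfSetsType mu).
  move=> x d1 d2 /andP[cx xd].
  have {d1 d2} d1 : is_derive x 1 (F1 - F2) (u1 x - u2 x).
    by apply: is_deriveB; [apply: d1|apply: d2]; rewrite cx.
  apply: near_eq_is_derive d1; near=> y.
  rewrite !fctE /F2 opprB addrC subrK clE//.
  by apply/andP; split; apply: ltW; near: y; [exact: lt_nbhsr|exact: lt_nbhsl].
Unshelve. all: by end_near. Qed.

End AbsolutelyContinuousVariation.

(** * Tagged partitions and Riemann-Stieltjes sums *)

Section Partitions.
Context {R : realType}.
Implicit Types (c d : R).

(** Stands in for compactness of [c, d]: the supremum of the points reached is itself reached, and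
    is passed unless it equals d. *)
Lemma real_induction c d (P : R -> Prop) : c <= d -> P c ->
  (forall t, c <= t <= d -> exists2 eta : R, 0 < eta &
     forall x y, c <= x <= t -> t <= y <= d -> t - eta < x -> y < t + eta -> P x -> P y) ->
  P d.
Proof.
move=> cd Pc H.
pose S := [set x | c <= x <= d /\ P x].
have Sc : S c by split => //; rewrite lexx.
have ubS : has_ubound S by exists d => x [/andP[]].
have supS : has_sup S by split => //; exists c.
have csup : c <= sup S by exact: ub_le_sup.
have supd : sup S <= d by apply: ge_sup; [exists c|move=> x [/andP[]]].
have [|eta eta0 K] := H (sup S); first by rewrite csup.
have [x Sx xs] := sup_adherent eta0 supS.
have xsup : x <= sup S by exact: ub_le_sup.
have [/andP[cx _] Px] := Sx.
pose y := Num.min d (sup S + eta / 2).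
have syd : sup S <= y <= d.
  by rewrite le_min supd/= ge_min lexx andbT; lra.
have ye : y < sup S + eta by rewrite gt_min; apply/orP; right; lra.
have Py : P y by apply: (K x y) => //; rewrite cx.
have /andP[sy yd] := syd.
have Sy : S y by split => //; rewrite yd (le_trans csup).
have ys : y <= sup S by exact: ub_le_sup.
suff <- : y = d by [].
move: ys; rewrite /y ge_min => /orP[ds|]; last by lra.
by apply/eqP; rewrite eq_le yd/= (le_trans ds).
Qed.

Fixpoint chain (Q : R -> R -> Prop) c (p : seq R) d : Prop :=
  if p is x :: p' then [/\ c < x, Q c x & chain Q x p' d] else c = d.

Lemma chain_rcons Q c p d e : chain Q c p d -> d < e -> Q d e -> chain Q c (rcons p e) e.
Proof.
elim: p c => [c /= -> de Qde//|x p ih c /= [cx Qcx xpd] de Qde].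
by split => //; exact: ih.
Qed.

Lemma sub_chain (Q Q' : R -> R -> Prop) c p d : (forall x y, Q x y -> Q' x y) ->
  chain Q c p d -> chain Q' c p d.
Proof. by move=> QQ'; elim: p c => [//|x p ih c /= [cx /QQ' ? /ih]]. Qed.

(** A Cousin-type lemma in which t becomes a partition point: the cells ending at t and those
    starting at t are controlled separately, which suits functions known only through one-sided
    limits. *)
Lemma chain_exists (Q : R -> R -> Prop) c d : c <= d ->
  (forall t, c <= t <= d -> exists2 eta : R, 0 < eta &
    (forall x, c <= x -> t - eta < x -> x < t -> Q x t) /\
    (forall y, y <= d -> t < y -> y < t + eta -> Q t y)) ->
  exists p, chain Q c p d.
Proof.
move=> cd H; apply: (real_induction (P := fun x => exists p, chain Q c p x) cd).
  by exists [::].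
move=> t ctd; have [eta eta0 [Ql Qr]] := H t ctd; exists eta => // x y.
move=> /andP[cx xt] /andP[ty yd] tx yt [p cp].
have [q cq] : exists q, chain Q c q t.
  move: xt; rewrite le_eqVlt => /predU1P[<-|xt]; first by exists p.
  by exists (rcons p t); exact: (chain_rcons cp xt (Ql x cx tx xt)).
move: ty; rewrite le_eqVlt => /predU1P[<-|ty]; first by exists q.
by exists (rcons q y); exact: (chain_rcons cq ty (Qr y yd ty yt)).
Qed.

(** Each cell is stored as its tag and its right end point. Unlike the indexed form in [is_RS], such
    lists can be concatenated and treated by induction; [is_RSP] relates the two. *)
Fixpoint tagged (del : R) c (tp : seq (R * R)) d : Prop :=
  if tp is (xi, x) :: tp' then
    [/\ c < x, c <= xi <= x, x - c < del & tagged del x tp' d]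
  else c = d.

Lemma tagged_le del c tp d : tagged del c tp d -> c <= d.
Proof.
elim: tp c => [c /= ->//|[xi x] tp ih c /= [cx _ _ /ih]].
by apply: le_trans; exact: ltW.
Qed.

Lemma tagged_cat del c tp1 d tp2 e : tagged del c tp1 d -> tagged del d tp2 e ->
  tagged del c (tp1 ++ tp2) e.
Proof.
elim: tp1 c => [c /= ->//|[xi x] tp ih c /= [cx cxi xc xd] de].
by split => //; exact: ih.
Qed.

Lemma tagged_sub del del' c tp d : del <= del' -> tagged del c tp d -> tagged del' c tp d.
Proof.
move=> dd; elim: tp c => [c //|[xi x] tp ih c /= [cx cxi xc xd]].
by split => //; [exact: lt_le_trans dd|exact: ih].
Qed.

Fixpoint tag_chain (tag : R -> R -> R) c (p : seq R) : seq (R * R) :=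
  if p is x :: p' then (tag c x, x) :: tag_chain tag x p' else [::].

Lemma tagged_chain tag del c p d : (forall x y, x <= y -> x <= tag x y <= y) ->
  chain (fun x y => y - x < del) c p d -> tagged del c (tag_chain tag c p) d.
Proof.
move=> tagP; elim: p c => [c //|x p ih c /= [cx xc /ih xpd]]; split => //.
by apply: tagP; exact: ltW.
Qed.

Lemma tagged_left del c p d : chain (fun x y => y - x < del) c p d ->
  tagged del c (tag_chain (fun x _ => x) c p) d.
Proof. by apply: tagged_chain => x y; rewrite lexx. Qed.

Lemma tagged_right del c p d : chain (fun x y => y - x < del) c p d ->
  tagged del c (tag_chain (fun _ y => y) c p) d.
Proof. by apply: tagged_chain => x y ->; rewrite lexx. Qed.

Lemma fine_chain del c d : c <= d -> 0 < del ->
  exists p, chain (fun x y => y - x < del) c p d.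
Proof.
move=> cd del0; apply: chain_exists => // t _; exists del => //.
by split => x; lra.
Qed.

Fixpoint RS_sum (h k : R -> R) c (tp : seq (R * R)) : R :=
  if tp is (xi, x) :: tp' then h xi * (k x - k c) + RS_sum h k x tp' else 0.

Lemma RS_sum_cat h k del c tp1 d tp2 : tagged del c tp1 d ->
  RS_sum h k c (tp1 ++ tp2) = RS_sum h k c tp1 + RS_sum h k d tp2.
Proof.
elim: tp1 c => [c /= ->|[xi x] tp ih c /= [_ _ _ /ih ->]]; first by rewrite add0r.
by rewrite addrA.
Qed.

Fixpoint tag_seq (xi : nat -> R) (p : seq R) : seq (R * R) :=
  if p is x :: p' then (xi 0%N, x) :: tag_seq (xi \o S) p' else [::].

Lemma RS_sum_tag_seq h k c xi p :
  RS_sum h k c (tag_seq xi p) =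
  \sum_(i < size p) h (xi i) * (k (nth 0 (c :: p) i.+1) - k (nth 0 (c :: p) i)).
Proof.
elim: p c xi => [c xi|x p ih c xi] /=; first by rewrite big_ord0.
by rewrite big_ord_recl ih.
Qed.

Lemma is_RSP h k c d l : is_RS h k c d l <->
  forall eps : R, 0 < eps -> exists2 del : R, 0 < del &
    forall tp, tagged del c tp d -> `|RS_sum h k c tp - l| < eps.
Proof.
split => H eps eps0; have [del del0 {}H] := H eps eps0; exists del => //.
  move=> tp tptag.
  pose p := [seq i.2 | i <- tp]; pose xi i := (nth (0, 0) tp i).1.
  have -> : tp = tag_seq xi p.
    rewrite /p /xi; elim: tp {tptag p xi} => //= -[a b] tp {1}->.
    by congr (_ :: _).
  rewrite RS_sum_tag_seq; apply: H.
    split.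
      rewrite /p; elim: tp c tptag {p xi} => //= -[a b] tp ih c [-> _ _ /ih ->//].
    rewrite /p; elim: tp c tptag {p xi} => [c ->//|[a b] tp ih c /= [_ _ _ /ih//]].
  move=> i; rewrite /p size_map /xi.
  elim: tp c i tptag {p xi} => //= -[a b] tp ih c [|i] [cb /andP[ca ab] bc td] it /=.
    by split.
  exact: (ih b i td it).
move=> p xi [pth /eqP lst] x; rewrite {}/x => Hp.
rewrite -(RS_sum_tag_seq h k c xi p); apply: H.
elim: p c xi pth lst Hp => //= x p ih c xi /andP[cx xp] lst Hp; split => //.
- by have [] := Hp 0%N isT => -> ->.
- by have [] := Hp 0%N isT.
- by apply: ih => // i ip; exact: (Hp i.+1).
Qed.

End Partitions.

(** * Riemann-Stieltjes integrals of regulated functions *)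

Section RiemannStieltjes.
Context {R : realType}.
Variables (k W : R -> R) (c d : R).
Hypothesis cd : c <= d.
Hypothesis kW : forall x y, c <= x -> x <= y -> y <= d -> `|k y - k x| <= W y - W x.
Implicit Types (h : R -> R).

Lemma RS_sum_le h M c' del tp : c <= c' -> tagged del c' tp d ->
  (forall x, c' <= x <= d -> `|h x| <= M) -> `|RS_sum h k c' tp| <= M * (W d - W c').
Proof.
elim: tp c' => [c' _ /= -> _|[xi x] tp ih c' cc' /= [cx /andP[cxi xix] _ xd] hM].
  by rewrite normr0 subrr mulr0.
have xd' := tagged_le xd.
have -> : M * (W d - W c') = M * (W x - W c') + M * (W d - W x) by ring.
apply: (le_trans (ler_normD _ _)); apply: lerD.
  rewrite normrM; apply: ler_pM => //; last by apply: kW => //; exact: ltW.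
  by apply: hM; rewrite cxi (le_trans xix).
apply: ih => //; first by rewrite (le_trans cc')// ltW.
by move=> y /andP[xy yd]; apply: hM; rewrite yd (le_trans (ltW cx)).
Qed.

Lemma RS_sum_lin a h1 h2 c' tp :
  RS_sum (fun x => a * h1 x + h2 x) k c' tp = a * RS_sum h1 k c' tp + RS_sum h2 k c' tp.
Proof.
elim: tp c' => [c' /=|[xi x] tp ih c' /=]; first by rewrite mulr0 addr0.
by rewrite ih; ring.
Qed.

Lemma is_RS_lin a h1 h2 l1 l2 : is_RS h1 k c d l1 -> is_RS h2 k c d l2 ->
  is_RS (fun x => a * h1 x + h2 x) k c d (a * l1 + l2).
Proof.
move=> /is_RSP H1 /is_RSP H2; apply/is_RSP => e e0.
have e1 : 0 < e / 2 / (`|a| + 1) by rewrite !divr_gt0// ltr_wpDl.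
have e2 : 0 < e / 2 by rewrite divr_gt0.
have [d1 d10 {}H1] := H1 _ e1; have [d2 d20 {}H2] := H2 _ e2.
exists (Num.min d1 d2); first by rewrite lt_min d10.
move=> tp tptag.
have /H1 K1 : tagged d1 c tp d by apply: tagged_sub tptag; rewrite ge_min lexx.
have /H2 K2 : tagged d2 c tp d by apply: tagged_sub tptag; rewrite ge_min lexx orbT.
rewrite RS_sum_lin opprD addrACA -mulrBr (le_lt_trans (ler_normD _ _))//.
rewrite [ltRHS](splitr e) ler_ltD// normrM.
rewrite (le_trans (ler_wpM2l _ (ltW K1)))//.
rewrite mulrCA ler_piMr ?(ltW e2)// ler_pdivrMr ?ltr_wpDl// mul1r.
by rewrite lerDl.
Qed.

Lemma eq_is_RS h1 h2 l : (forall x, c <= x <= d -> h1 x = h2 x) ->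
  is_RS h1 k c d l -> is_RS h2 k c d l.
Proof.
move=> h12 /is_RSP H; apply/is_RSP => e e0; have [del del0 {}H] := H e e0.
exists del => // tp tptag.
suff <- : RS_sum h1 k c tp = RS_sum h2 k c tp by exact: H.
elim: {H} tp c cd h12 tptag => [//|[xi x] tp ih c' c'd h12 /= [cx /andP[cxi xix] _ xd]].
have xd' := tagged_le xd.
congr (_ * _ + _); first by apply: h12; rewrite cxi (le_trans xix).
apply: ih => // y /andP[xy yd]; apply: h12; rewrite yd andbT.
by rewrite (le_trans (ltW cx)).
Qed.

Lemma is_RS0 : is_RS (fun=> 0) k c d 0.
Proof.
apply/is_RSP => e e0; exists 1 => // tp _; rewrite subr0.
suff -> : RS_sum (fun=> 0) k c tp = 0 by rewrite normr0.
by elim: tp (c) => //= -[xi x] tp ih c' ; rewrite mul0r add0r.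
Qed.

Lemma is_RSZ a h l : is_RS h k c d l -> is_RS (fun x => a * h x) k c d (a * l).
Proof.
move=> Hl; have := is_RS_lin a Hl is_RS0; rewrite addr0.
by apply: eq_is_RS => x _; rewrite addr0.
Qed.

Lemma is_RSD h1 h2 l1 l2 : is_RS h1 k c d l1 -> is_RS h2 k c d l2 ->
  is_RS (fun x => h1 x + h2 x) k c d (l1 + l2).
Proof.
move=> H1 H2; have := is_RS_lin 1 H1 H2; rewrite mul1r.
by apply: eq_is_RS => x _; rewrite mul1r.
Qed.

Lemma is_RSB h1 h2 l1 l2 : is_RS h1 k c d l1 -> is_RS h2 k c d l2 ->
  is_RS (fun x => h1 x - h2 x) k c d (l1 - l2).
Proof.
move=> H1 H2; have := is_RS_lin (-1) H2 H1; rewrite mulN1r addrC.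
by apply: eq_is_RS => x _; rewrite mulN1r addrC.
Qed.

Lemma is_RS_le h M l : (forall x, c <= x <= d -> `|h x| <= M) ->
  is_RS h k c d l -> `|l| <= M * (W d - W c).
Proof.
move=> hM /is_RSP H; apply/ler_addgt0Pr => e e0.
have [del del0 {}H] := H e e0.
have [p /tagged_left pt] := fine_chain cd del0.
have := H _ pt; have := RS_sum_le (lexx c) pt hM.
set s := RS_sum _ _ _ _ => s1 s2.
have -> : l = s - (s - l) by ring.
by rewrite (le_trans (ler_normB _ _))// lerD// ltW.
Qed.

(** The difference l1 - l2 is an integral of h - h, which is bounded by M = 0. *)
Lemma is_RS_unique h l1 l2 : is_RS h k c d l1 -> is_RS h k c d l2 -> l1 = l2.
Proof.
move=> H1 H2; have := is_RSB H1 H2.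
move=> /(@is_RS_le _ 0); rewrite mul0r normr_le0 subr_eq0 => H.
by apply/eqP/H => x _; rewrite subrr normr0.
Qed.

(** The Riemann-Stieltjes sum telescopes to k z - k c with z within the mesh of u, and k is
    continuous at u. The value of chi at u is left open so that both [x < u] and [x <= u] are
    covered. *)
Lemma is_RS_step (chi : R -> bool) u : c <= u <= d -> {for u, continuous k} ->
  (forall y, y < u -> chi y) -> (forall y, u < y -> ~~ chi y) ->
  is_RS (fun x => (chi x)%:R) k c d (k u - k c).
Proof.
move=> cud ku chi1 chi0.
have anti x y : x <= y -> chi y -> chi x.
  rewrite le_eqVlt => /predU1P[->//|xy chiy]; apply: chi1.
  by rewrite (lt_le_trans xy)// leNgt; apply: contraL chiy; exact: chi0.
have zero c' del tp : tagged del c' tp d -> (forall x, c' <= x -> ~~ chi x) ->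
    RS_sum (fun x => (chi x)%:R) k c' tp = 0.
  elim: tp c' => [//|[xi x] tp ih c' /= [cx /andP[cxi xix] _ xd] H].
  rewrite (negbTE (H _ cxi)) mul0r add0r; apply: ih => // y xy; apply: H.
  by rewrite (le_trans (ltW cx)).
(* Here z is the right end of the last cell whose tag satisfies chi, or c' if there is none. *)
have main c' del tp : 0 < del -> c' <= u <= d -> tagged del c' tp d ->
    exists2 z, `|z - u| < del & RS_sum (fun x => (chi x)%:R) k c' tp = k z - k c'.
  move=> del0; elim: tp c' => [c' /andP[cu ud] /= c'd|
      [xi x] tp ih c' /= /andP[cu ud] [cx /andP[cxi xix] xcdel xd]].
    exists d; last by rewrite c'd subrr.
    by rewrite (_ : d - u = 0) ?normr0//; lra.
  have [chixi|chixi] := boolP (chi xi).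
    have xiu : xi <= u by rewrite leNgt; apply: contraL chixi; exact: chi0.
    have [xu|ux] := leP x u.
      have [|z zu ->] := ih x _ xd; first by rewrite xu.
      by exists z => //; rewrite mul1r; ring.
    exists x; first by rewrite ger0_norm; lra.
    rewrite mul1r (zero _ _ _ xd) ?addr0// => y xy; apply: chi0.
    exact: lt_le_trans xy.
  have uxi : u <= xi by rewrite leNgt; apply: contra chixi; exact: chi1.
  exists c'; first by rewrite ler0_norm; lra.
  rewrite mul0r add0r subrr; apply: zero xd _ => y xy.
  by apply: contra chixi; apply: anti; exact: le_trans xy.
apply/is_RSP => e e0.
move/cvgrPdist_lt : ku => /(_ e e0) [del /= del0 kdel].
exists del => // tp tptag.
have [z zu ->] := main c _ _ del0 cud tptag.
rewrite (_ : _ - _ = k z - k u); last by ring.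
by rewrite distrC; apply: kdel; rewrite /= distrC.
Qed.

(** By [AA] every lower estimate l - e V lies below every upper estimate l' + e' V, so the supremum
    of the former is the candidate and no sequence of approximants has to be chosen. *)
Lemma is_RS_uniform h :
  (forall e, 0 < e -> exists psi l, is_RS psi k c d l /\
     forall x, c <= x <= d -> `|h x - psi x| <= e) ->
  exists l, is_RS h k c d l.
Proof.
move=> H; pose V := W d - W c.
have V0 : 0 <= V by rewrite (le_trans _ (kW (lexx c) cd (lexx d))).
pose A e l := exists2 psi, is_RS psi k c d l & forall x, c <= x <= d -> `|h x - psi x| <= e.
pose S := [set s | exists e l, A e l /\ s = l - e * V].
have AA e l e' l' : A e l -> A e' l' -> l - e * V <= l' + e' * V.
  move=> [psi Hpsi psie] [psi' Hpsi' psie'].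
  have := is_RSB Hpsi Hpsi' => /(@is_RS_le _ (e + e')).
  rewrite ler_norml -/V => K.
  have /andP[_] : - ((e + e') * V) <= l - l' <= (e + e') * V.
    apply: K => x xcd; have := psie x xcd; have := psie' x xcd.
    have -> : psi x - psi' x = (h x - psi' x) - (h x - psi x) by ring.
    by move=> K1 K2; rewrite (le_trans (ler_normB _ _))// addrC lerD.
  by rewrite mulrDl; lra.
have AL e l : A e l -> `|sup S - l| <= e * V.
  move=> Ael; rewrite ler_distl; apply/andP; split.
    apply: ub_le_sup; last by exists e, l.
    by exists (l + e * V) => _ [e' [l' [Ae'l' ->]]]; exact: AA.
  apply: ge_sup; first by exists (l - e * V), e, l.
  by move=> _ [e' [l' [Ae'l' ->]]]; exact: AA.
(* sup S lies within e * V of the integral of every e-approximant psi. *)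
exists (sup S); apply/is_RSP => e e0.
pose e1 := e / (4 * (V + 1)).
have e10 : 0 < e1 by rewrite divr_gt0// mulr_gt0// ltr_wpDl.
have e1V : e1 * V <= e / 4.
  have -> : e1 * V = e / 4 * (V / (V + 1)) by rewrite /e1; field; rewrite gt_eqF// ltr_wpDl.
  by rewrite ler_piMr ?divr_ge0 ?(ltW e0)// ler_pdivrMr ?ltr_wpDl// mul1r lerDl.
have [psi [l [Hpsi psie]]] := H _ e10.
have Ll : `|sup S - l| <= e / 4 by apply: (le_trans _ e1V); apply: AL; exists psi.
have e4 : 0 < e / 4 by rewrite divr_gt0.
move/is_RSP : Hpsi => /(_ _ e4)[del del0 Hdel]; exists del => // tp tptag.
have := RS_sum_le (lexx c) tptag psie.
have -> : RS_sum (fun x => h x - psi x) k c tp = RS_sum h k c tp - RS_sum psi k c tp.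
  have -> : (fun x => h x - psi x) = (fun x => -1 * psi x + h x).
    by apply/funext => x; ring.
  by rewrite RS_sum_lin; ring.
have := Hdel _ tptag; rewrite -/V.
set s := RS_sum h _ _ _; set s' := RS_sum psi _ _ _ => K1 K2.
have K3 := le_trans K2 e1V.
have -> : s - sup S = (s - s') + (s' - l) - (sup S - l) by ring.
rewrite (le_lt_trans (ler_normB _ _))//.
have := ler_normD (s - s') (s' - l); lra.
Qed.

(** Real induction on the right end x of an e-close step function. Requiring it to vanish beyond x
    lets further steps simply be added. Strict and large indicators both occur because h t is
    unrelated to the one-sided limits at t. *)
Lemma regulated_is_RS h : (forall t, c <= t <= d -> {for t, continuous k}) ->
  (forall t, c <= t <= d -> cvg (h x @[x --> t^'-]) /\ cvg (h x @[x --> t^'+])) ->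
  exists l, is_RS h k c d l.
Proof.
move=> kc hreg; apply: is_RS_uniform => e e0.
pose P x := exists psi l, [/\ is_RS psi k c d l,
  forall y, c <= y <= x -> `|h y - psi y| <= e & forall y, x < y -> psi y = 0].
suff [psi [l [? ? _]]] : P d by exists psi, l.
have le_step u : c <= u <= d -> is_RS (fun x => (x <= u)%R%:R) k c d (k u - k c).
  move=> cud; apply: (is_RS_step cud (kc _ cud)) => y; first exact: ltW.
  by rewrite ltNge.
have lt_step u : c <= u <= d -> is_RS (fun x => (x < u)%R%:R) k c d (k u - k c).
  move=> cud; apply: (is_RS_step cud (kc _ cud)) => y //.
  by rewrite -leNgt; exact: ltW.
apply: (real_induction (P := P) cd).
  exists (fun x => h c * (x <= c)%R%:R), (h c * (k c - k c)); split.
  - by apply: is_RSZ; apply: le_step; rewrite lexx.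
  - move=> y /andP[cy yc]; have -> : y = c by apply/eqP; rewrite eq_le yc.
    by rewrite lexx mulr1 subrr normr0 ltW.
  - by move=> y cy; rewrite leNgt cy mulr0.
move=> t ctd; have [hl hr] := hreg t ctd.
move/cvgrPdist_le : hl => /(_ e e0) [e1 /= e10 hl].
move/cvgrPdist_le : hr => /(_ e e0) [e2 /= e20 hr].
have /andP[ct td] := ctd.
exists (Num.min e1 e2); first by rewrite lt_min e10.
move=> x y /andP[cx xt] /andP[ty yd] tx yt Px.
have {tx}tx : `|t - x| < e1 by rewrite ger0_norm ?subr_ge0//; move: tx; rewrite /Num.min; case: ifP; lra.
have {yt}yt : `|t - y| < e2 by rewrite ler0_norm ?subr_le0//; move: yt; rewrite /Num.min; case: ifPn; rewrite -?leNgt; lra.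
have [psi [l [Hpsi psie psi0]]] : P t.
  move: xt; rewrite le_eqVlt => /predU1P[<-//|xt].
  have [psi [l [Hpsi psie psi0]]] := Px.
  set L := lim _ in hl.
  (* The new steps take the value h(t-) on ]x, t[ and the value h t at t itself. *)
  exists (fun z => psi z + (L * ((z < t)%R%:R - (z <= x)%R%:R) + h t * ((z <= t)%R%:R - (z < t)%R%:R))).
  exists (l + (L * ((k t - k c) - (k x - k c)) + h t * ((k t - k c) - (k t - k c)))); split.
  - apply: is_RSD => //; apply: is_RSD; apply: is_RSZ; apply: is_RSB;
      do [exact: lt_step|apply: le_step => //].
    by rewrite cx (le_trans (ltW xt)).
  - move=> z /andP[cz zt].
    have [zx|xz] := leP z x.
      rewrite (le_lt_trans zx xt) zt !subrr !mulr0 !addr0.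
      by apply: psie; rewrite cz.
    rewrite psi0// add0r subr0 zt; move: zt; rewrite le_eqVlt => /predU1P[->|zt].
      by rewrite ltxx mulr0 add0r subr0 mulr1 subrr normr0 ltW.
    rewrite zt subrr mulr0 addr0 mulr1 distrC; apply: hl => //=.
    rewrite ger0_norm ?subr_ge0 ?(ltW zt)//; apply: le_lt_trans tx.
    by rewrite ger0_norm ?subr_ge0 ?(ltW xt)// lerB// ltW.
  - move=> z tz; rewrite psi0 ?(lt_trans xt)//.
    rewrite (ltNge z t) (ltW tz) (leNgt z t) tz (leNgt z x) (lt_trans xt tz)/=.
    by rewrite !subrr !mulr0 !addr0.
move: ty; rewrite le_eqVlt => /predU1P[<-|ty]; first by exists psi, l.
set L := lim _ in hr.
(* The new step takes the value h(t+) on ]t, y]. *)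
exists (fun z => psi z + L * ((z <= y)%R%:R - (z <= t)%R%:R)).
exists (l + L * ((k y - k c) - (k t - k c))); split.
- apply: is_RSD => //; apply: is_RSZ; apply: is_RSB; apply: le_step => //.
  by rewrite yd (le_trans ct)// ltW.
- move=> z /andP[cz zy]; rewrite zy.
  have [zt|tz] := leP z t; first by rewrite subrr mulr0 addr0; apply: psie; rewrite cz.
  rewrite psi0// add0r subr0 mulr1 distrC; apply: hr => //=.
  rewrite ler0_norm ?subr_le0 ?(ltW tz)//; apply: le_lt_trans yt.
  by rewrite ler0_norm ?subr_le0 ?(ltW ty)// !opprB lerB.
- move=> z yz; have tz := lt_trans ty yz.
  by rewrite psi0// !leNgt yz tz/= subrr mulr0 addr0.
Qed.

End RiemannStieltjes.

(** A tagged partition of [c, d] is prolonged by fine ones on both sides. Their tags are the outer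
    ends of the cells, so none of them is c or d, where h may be nonzero, and the added sums
    vanish. *)
Lemma is_RS_restrict {R : realType} (h k : R -> R) c' c d d' l :
  c' <= c -> c <= d -> d <= d' ->
  (forall x, c' <= x <= d' -> ~~ (c <= x <= d) -> h x = 0) ->
  is_RS h k c' d' l -> is_RS h k c d l.
Proof.
move=> c'c cd dd' h0 /is_RSP H; apply/is_RSP => e e0.
have [del del0 {}H] := H e e0; exists del => // tp tptag.
have [p1 p1P] := fine_chain c'c del0; have [p2 p2P] := fine_chain dd' del0.
have t1 := tagged_left p1P; have t2 := tagged_right p2P.
have := H _ (tagged_cat t1 (tagged_cat tptag t2)).
rewrite (RS_sum_cat _ _ _ t1) (RS_sum_cat _ _ _ tptag).
have -> : RS_sum h k c' (tag_chain (fun x _ => x) c' p1) = 0.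
  elim: p1 (c') h0 p1P {t1 c'c H} => //= x p ih c'' h0 [cx _ xp].
  have xc := tagged_le (tagged_left xp).
  rewrite ih//; last first.
    by move=> y /andP[xy yd]; apply: h0; rewrite yd (le_trans (ltW cx)).
  rewrite h0 ?mul0r ?addr0//.
    by rewrite lexx (le_trans (ltW cx))// (le_trans xc)// (le_trans cd).
  by rewrite negb_and -ltNge (lt_le_trans cx).
have zero p d0 : d <= d0 -> chain (fun x y => y - x < del) d0 p d' ->
    RS_sum h k d0 (tag_chain (fun _ y => y) d0 p) = 0.
  elim: p d0 => //= x p ih d0 dd0 [dx _ xp].
  have xd := tagged_le (tagged_left xp).
  rewrite ih//; last by rewrite (le_trans dd0)// ltW.
  rewrite h0 ?mul0r ?addr0//.
    by rewrite xd andbT (le_trans c'c)// (le_trans cd)// (le_trans dd0)// ltW.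
  by rewrite negb_and -ltNge -ltNge (le_lt_trans dd0)// orbT.
by rewrite (zero _ _ (lexx d) p2P) add0r addr0.
Qed.

(** * Unordered sums *)

Section RealSums.
Context {R : realType}.
Implicit Types (A D : set R) (u v : R -> R).

Definition abs_summable A u : Prop := (\esum_(x in A) `|u x|%:E < +oo)%E.

Lemma esum_ge0_fin A (p : R -> R) : (forall x, A x -> 0 <= p x) ->
  abs_summable A p -> (\esum_(x in A) (p x)%:E)%E \is a fin_num.
Proof.
move=> p0 pA; rewrite ge0_fin_numE; last by apply: esum_ge0 => x Ax; rewrite lee_fin p0.
by apply: le_lt_trans pA; apply: le_esum => x _; rewrite lee_fin ler_norm.
Qed.

Lemma abs_summable_le A u v : (forall x, A x -> `|u x| <= `|v x|) ->
  abs_summable A v -> abs_summable A u.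
Proof. by move=> uv; apply: le_lt_trans; apply: le_esum => x Ax; rewrite lee_fin uv. Qed.

Lemma sub_esum A D (p : R -> \bar R) : A `<=` D -> (forall x, D x -> (0 <= p x)%E) ->
  (\esum_(x in A) p x <= \esum_(x in D) p x)%E.
Proof.
move=> AD p0; rewrite [leRHS](esumID A)//.
rewrite (_ : D `&` A = A); last by apply/setIidPr.
by rewrite leeDl// esum_ge0// => x [/p0].
Qed.

Lemma abs_summableS A D u : A `<=` D -> abs_summable D u -> abs_summable A u.
Proof.
by move=> AD; apply: le_lt_trans; apply: sub_esum => // x _; rewrite lee_fin.
Qed.

Lemma abs_summableD A u v : abs_summable A u -> abs_summable A v ->
  abs_summable A (fun x => u x + v x).
Proof.
move=> uA vA; apply: (@le_lt_trans _ _ (\esum_(x in A) (`|u x|%:E + `|v x|%:E))%E).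
  by apply: le_esum => x _; rewrite -EFinD lee_fin ler_normD.
by rewrite esumD ?lte_add_pinfty// => x _; rewrite lee_fin.
Qed.

Lemma esumZl A (r : R) (p : R -> R) : 0 <= r -> (forall x, A x -> 0 <= p x) ->
  (\esum_(x in A) (r * p x)%:E = r%:E * \esum_(x in A) (p x)%:E)%E.
Proof.
have le (s : R) (q : R -> R) : 0 <= s -> (forall x, A x -> 0 <= q x) ->
    (\esum_(x in A) (s * q x)%:E <= s%:E * \esum_(x in A) (q x)%:E)%E.
  move=> s0 q0; apply: ge_ereal_sup => _ [X [finX XA] <-].
  rewrite fsbig_finite//= sumEFin -mulr_sumr EFinM.
  rewrite lee_wpmul2l ?lee_fin// -sumEFin -fsbig_finite//.
  by apply: ereal_sup_ubound; exists X.
rewrite le_eqVlt => /predU1P[<-|r0] p0.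
  by rewrite mul0e esum1// => x _; rewrite mul0r.
apply/eqP; rewrite eq_le le ?(ltW r0)//=.
(* The reverse inequality is [le] applied to the factor r^-1. *)
have -> : (\esum_(x in A) (p x)%:E = \esum_(x in A) (r^-1 * (r * p x))%:E)%E.
  by apply: eq_esum => x _; rewrite mulKf// gt_eqF.
have rp0 x : A x -> 0 <= r * p x by move=> /p0; apply: mulr_ge0; exact: ltW.
have r10 : 0 <= r^-1 by rewrite invr_ge0 ltW.
have := lee_wpmul2l (_ : (0 <= r%:E)%E) (le _ _ r10 rp0).
rewrite lee_fin => /(_ (ltW r0)).
by rewrite muleA -EFinM divff ?gt_eqF// mul1e.
Qed.

Lemma abs_summableZ A r u : abs_summable A u -> abs_summable A (fun x => r * u x).
Proof.
move=> uA; rewrite /abs_summable.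
under eq_esum do rewrite normrM.
rewrite (@esumZl A `|r| (fun x => `|u x|))//.
by rewrite lte_mul_pinfty.
Qed.

(** Positive parts are not additive. With any decomposition into nonnegative summable families
    allowed, linearity reduces to that of sums of nonnegative terms. *)
Lemma rsumE A u (p q : R -> R) : (forall x, A x -> 0 <= p x) -> (forall x, A x -> 0 <= q x) ->
  (forall x, A x -> u x = p x - q x) -> abs_summable A p -> abs_summable A q ->
  rsum A u = fine (\esum_(x in A) (p x)%:E) - fine (\esum_(x in A) (q x)%:E).
Proof.
move=> p0 q0 upq pA qA.
have max0 (z : R) : 0 <= Num.max z 0 by rewrite le_max lexx orbT.
have uA : abs_summable A u.
  apply: (abs_summable_le _ (abs_summableD pA qA)) => x Ax.
  by rewrite upq// (le_trans (ler_normB _ _))// [leRHS]ger0_norm ?addr_ge0 ?p0 ?q0// !ger0_norm ?p0 ?q0.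
have mA : abs_summable A (fun x => Num.max (u x) 0).
  apply: (abs_summable_le _ uA) => x Ax; rewrite ger0_norm// ge_max normr_ge0 andbT.
  exact: ler_norm.
have nA : abs_summable A (fun x => Num.max (- u x) 0).
  apply: (abs_summable_le _ uA) => x Ax; rewrite ger0_norm// ge_max normr_ge0 andbT.
  by rewrite -normrN ler_norm.
rewrite /rsum.
suff : fine (\esum_(x in A) (Num.max (u x) 0)%:E) + fine (\esum_(x in A) (q x)%:E) =
       fine (\esum_(x in A) (Num.max (- u x) 0)%:E) + fine (\esum_(x in A) (p x)%:E).
  by move/eqP; rewrite -subr_eq => /eqP <-; ring.
rewrite -!fineD ?esum_ge0_fin//.
rewrite -!esumD; try by [move=> x Ax; rewrite lee_fin; auto|].
congr fine; apply: eq_esum => x Ax; rewrite -!EFinD upq//; congr (_%:E).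
by rewrite /Num.max; do ! case: ifPn; rewrite -?leNgt; lra.
Qed.

Lemma rsum_posneg A u : abs_summable A u ->
  exists p q : R -> R, [/\ forall x, 0 <= p x, forall x, 0 <= q x,
    (forall x, u x = p x - q x), (forall x, `|u x| = p x + q x) &
     abs_summable A p /\ abs_summable A q].
Proof.
move=> uA; exists (fun x => Num.max (u x) 0), (fun x => Num.max (- u x) 0); split.
- by move=> x; rewrite le_max lexx orbT.
- by move=> x; rewrite le_max lexx orbT.
- by move=> x; rewrite /Num.max; do ! case: ifPn; rewrite -?leNgt; lra.
- move=> x; have [u0|u0] := leP 0 (u x).
    by rewrite ger0_norm// /Num.max; do ! case: ifPn; rewrite -?leNgt; lra.
  by rewrite ltr0_norm// /Num.max; do ! case: ifPn; rewrite -?leNgt; lra.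
- split; apply: (abs_summable_le _ uA) => x Ax; (rewrite ger0_norm; last by rewrite le_max lexx orbT);
    rewrite ge_max normr_ge0 andbT.
    exact: ler_norm.
  by rewrite -normrN ler_norm.
Qed.

Lemma eq_rsum A u v : (forall x, A x -> u x = v x) -> rsum A u = rsum A v.
Proof.
by move=> uv; rewrite /rsum; congr (fine _ - fine _); apply: eq_esum => x Ax; rewrite uv.
Qed.

Lemma rsumD A u v : abs_summable A u -> abs_summable A v ->
  rsum A (fun x => u x + v x) = rsum A u + rsum A v.
Proof.
move=> /rsum_posneg[p [q [p0 q0 upq _ [pA qA]]]] /rsum_posneg[p' [q' [p'0 q'0 vpq _ [p'A q'A]]]].
rewrite (@rsumE A u p q)// (@rsumE A v p' q')//.
rewrite (@rsumE A _ (fun x => p x + p' x) (fun x => q x + q' x)); last 5 first.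
- by move=> x _; rewrite addr_ge0.
- by move=> x _; rewrite addr_ge0.
- by move=> x _; rewrite upq vpq; ring.
- exact: abs_summableD.
- exact: abs_summableD.
have esD (w z : R -> R) : (forall x, 0 <= w x) -> (forall x, 0 <= z x) ->
  abs_summable A w -> abs_summable A z ->
  fine (\esum_(x in A) (w x + z x)%:E)%E =
  fine (\esum_(x in A) (w x)%:E)%E + fine (\esum_(x in A) (z x)%:E)%E.
  move=> w0 z0 wA zA; rewrite -fineD ?esum_ge0_fin//.
  by rewrite -esumD//; move=> x _; rewrite lee_fin.
by rewrite (esD p p')// (esD q q')//; ring.
Qed.

Lemma rsumZ A r u : abs_summable A u -> rsum A (fun x => r * u x) = r * rsum A u.
Proof.
move=> /rsum_posneg[p [q [p0 q0 upq _ [pA qA]]]].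
rewrite (@rsumE A u p q)//.
have [r0|r0] := leP 0 r.
  rewrite (@rsumE A _ (fun x => r * p x) (fun x => r * q x)); last 5 first.
  - by move=> x _; rewrite mulr_ge0.
  - by move=> x _; rewrite mulr_ge0.
  - by move=> x _; rewrite upq; ring.
  - exact: abs_summableZ.
  - exact: abs_summableZ.
  by rewrite !esumZl// !fineM ?esum_ge0_fin// mulrBr.
have r0' : 0 <= - r by rewrite oppr_ge0 ltW.
rewrite (@rsumE A _ (fun x => - r * q x) (fun x => - r * p x)); last 5 first.
- by move=> x _; rewrite mulr_ge0.
- by move=> x _; rewrite mulr_ge0.
- by move=> x _; rewrite upq; ring.
- exact: abs_summableZ.
- exact: abs_summableZ.
by rewrite !esumZl// !fineM ?esum_ge0_fin//=; ring.
Qed.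

Lemma rsum_norm A u : abs_summable A u ->
  `|rsum A u| <= fine (\esum_(x in A) `|u x|%:E).
Proof.
move=> /rsum_posneg[p [q [p0 q0 upq apq [pA qA]]]].
rewrite (@rsumE A u p q)// (le_trans (ler_normB _ _))//.
rewrite !ger0_norm; try by apply: fine_ge0; apply: esum_ge0 => x _; rewrite lee_fin.
rewrite -fineD ?esum_ge0_fin//.
rewrite -esumD; try by move=> x _; rewrite lee_fin.
by under [in leRHS]eq_esum do rewrite apq.
Qed.

Lemma rsum_le A u B : abs_summable A u -> (\esum_(x in A) `|u x|%:E <= B%:E)%E ->
  `|rsum A u| <= B.
Proof.
move=> uA uB; apply: (le_trans (rsum_norm uA)).
rewrite -lee_fin fineK// ge0_fin_numE//.
by apply: esum_ge0 => x _; rewrite lee_fin.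
Qed.

Lemma rsum_restrict A D u : A `<=` D -> (forall x, D x -> ~ A x -> u x = 0) ->
  rsum A u = rsum D u.
Proof.
move=> AD u0; rewrite /rsum.
have E (F : R -> R) : (forall x, D x -> ~ A x -> F x = 0) ->
  (\esum_(x in A) (F x)%:E = \esum_(x in D) (F x)%:E)%E.
  move=> F0; rewrite [LHS](_ : _ = \esum_(x in D `&` A) (F x)%:E)%E; last first.
    by congr esum; apply/seteqP; split => x /=; [move=> Ax; split => //; exact: AD|case].
  rewrite esum_mkcondr; apply: eq_esum => x Dx.
  by have [//|] := boolP (x \in A); rewrite notin_setE => /F0 ->.
by congr (fine _ - fine _); apply: E => x Dx Ax; rewrite u0// ?oppr0 maxxx.
Qed.

Lemma rsum_setU A D u : A `<=` D -> abs_summable D u ->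
  rsum D u = rsum A u + rsum (D `\` A) u.
Proof.
move=> AD uD.
pose u1 x := if x \in A then u x else 0; pose u2 x := if x \in A then 0 else u x.
have -> : rsum D u = rsum D (fun x => u1 x + u2 x).
  by apply: eq_rsum => x _; rewrite /u1 /u2; case: ifP => _; rewrite ?addr0 ?add0r.
rewrite rsumD; last 2 first.
- by apply: (abs_summable_le _ uD) => x _; rewrite /u1; case: ifP => _; rewrite ?normr0.
- by apply: (abs_summable_le _ uD) => x _; rewrite /u2; case: ifP => _; rewrite ?normr0.
congr (_ + _).
  rewrite -(rsum_restrict (A := A))//; last first.
    by move=> x Dx Ax; rewrite /u1 memNset.
  by apply: eq_rsum => x Ax; rewrite /u1 mem_set.
rewrite -(rsum_restrict (A := D `\` A))//; last first.
  by move=> x Dx /not_andP[//|/contrapT Ax]; rewrite /u2 mem_set.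
by apply: eq_rsum => x [_ Ax]; rewrite /u2 memNset.
Qed.

(** F is a finite set whose sum comes within e of the total. It serves the continuity of the
    continuous part: close to a point, at most the point itself belongs to F. *)
Lemma abs_summable_tail D u (e : R) : abs_summable D u -> 0 < e ->
  exists2 F : set R, finite_set F & forall A, A `<=` D -> A `&` F = set0 ->
    (\esum_(x in A) `|u x|%:E <= e%:E)%E.
Proof.
move=> uD e0.
have fD : (\esum_(x in D) `|u x|%:E)%E \is a fin_num.
  by rewrite ge0_fin_numE// esum_ge0// => x _; rewrite lee_fin.
have [_ [F [finF FD] <-] Fe] := ub_ereal_sup_adherent e0 fD.
exists F => // A AD AF.
have u0 x : D x -> (0 <= `|u x|%:E)%E by rewrite lee_fin.
have : (\esum_(x in F) `|u x|%:E + \esum_(x in A) `|u x|%:E <= \esum_(x in D) `|u x|%:E)%E.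
  rewrite [leRHS](esumID F)// leeD//.
    by rewrite (_ : D `&` F = F)//; apply/setIidPr.
  apply: sub_esum => [x Ax|x [/u0]//]; split; [exact: AD|] => Fx.
  by suff : set0 x by []; rewrite -AF.
rewrite esum_fset//.
move: Fe; rewrite -/(esum D _).
have -> : (\sum_(x \in F) `|u x|%:E = (\sum_(x \in F) `|u x|)%:E)%E.
  by rewrite !fsbig_finite//= sumEFin.
move: fD; move/fineK => <-.
have fA : (\esum_(x in A) `|u x|%:E)%E \is a fin_num.
  rewrite ge0_fin_numE; last by apply: esum_ge0.
  exact: (abs_summableS AD uD).
rewrite -(fineK fA) -EFinB -EFinD !lte_fin !lee_fin; lra.
Qed.

End RealSums.

(** * Left-continuous functions of bounded variation *)

Lemma cvg_norm_le {R : realType} (F : set_system R) (PF : ProperFilter F)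
    (f : R -> R) (l c e : R) :
  f x @[x --> F] --> l -> (\forall x \near F, `|f x - c| <= e) -> `|l - c| <= e.
Proof.
move=> fl fc; rewrite leNgt; apply/negP => el.
have el0 : 0 < `|l - c| - e by rewrite subr_gt0.
move/cvgrPdist_lt : fl => /(_ _ el0) fl.
have [x [/= lx xc]] := filter_ex (filterI fl fc).
have : `|l - c| <= `|l - f x| + `|f x - c|.
  by rewrite (le_trans _ (ler_normD _ _))// subrKA.
lra.
Qed.

Section OpenInterval.
Context {R : realType}.
Variables (a b : \bar R).
Local Notation I := (oitv a b).

Lemma oitv_near t : I t -> \forall x \near t, I x.
Proof.
move=> [at_ tb]; near=> x; split; near: x.
- case: a at_ => [r||]; rewrite ?lte_fin => at_//.
  + by near=> x; rewrite lte_fin; near: x; exact: lt_nbhsr.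
  + by near=> x; rewrite ltNyr.
- case: b tb => [r||]; rewrite ?lte_fin => tb//.
  + by near=> x; rewrite lte_fin; near: x; exact: lt_nbhsl.
  + by near=> x; rewrite ltry.
Unshelve. all: by end_near. Qed.

Lemma oitv_near_left t : I t -> \forall x \near t^'-, I x.
Proof. by move=> /oitv_near; exact: cvg_within. Qed.

Lemma oitv_near_right t : I t -> \forall x \near t^'+, I x.
Proof. by move=> /oitv_near; exact: cvg_within. Qed.

Lemma oitv_convex x y z : I x -> I y -> x <= z <= y -> I z.
Proof.
move=> [ax _] [_ yb] /andP[xz zy]; split.
  by rewrite (lt_le_trans ax)// lee_fin.
by rewrite (le_lt_trans _ yb)// lee_fin.
Qed.

Lemma oitv_gt t : I t -> exists2 y, I y & t < y.
Proof.
move=> It; near t^'+ => y; exists y; near: y; last exact: nbhs_right_gt.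
exact: oitv_near_right.
Unshelve. all: by end_near. Qed.

End OpenInterval.

Section VariationFunction.
Context {R : realType}.
Implicit Types (h : R -> R) (t : seq R).

Fixpoint var_sum h t : R :=
  if t is x :: t1 then
    (if t1 is y :: _ then `|llim h y - rlim h x| else 0) + var_sum h t1
  else 0.

Lemma var_sumE h t :
  \sum_(i < (size t).-1) `|llim h (nth 0 t i.+1) - rlim h (nth 0 t i)| = var_sum h t.
Proof.
elim: t => [|x [|y t] ih]; first by rewrite big_ord0.
  by rewrite big_ord0/= addr0.
by rewrite big_ord_recl ih.
Qed.

Lemma varE (A : set R) h : var A h = ereal_sup [set (var_sum h t)%:E |
  t in [set t : seq R | sorted <%R t /\ {subset t <= A}]].
Proof. by rewrite /var; congr ereal_sup; apply: eq_imagel => t _; rewrite var_sumE. Qed.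

Lemma var_ge0 (A : set R) h : (0 <= var A h)%E.
Proof. by rewrite varE; apply: ereal_sup_ubound; exists [::]. Qed.

Lemma sub_var (A B : set R) h : A `<=` B -> (var A h <= var B h)%E.
Proof.
move=> AB; apply: le_ereal_sup => _ [t [st tA] <-]; exists t => //; split => //.
by move=> x /tA; rewrite !inE; exact: AB.
Qed.

Lemma var_sum_cat h t x y :
  var_sum h t + `|llim h y - rlim h x| <= var_sum h (t ++ [:: x; y]).
Proof.
elim: t => [|u [|v t] ih] /=; first by rewrite add0r !addr0.
  by have := normr_ge0 (llim h x - rlim h u); lra.
by rewrite -addrA lerD2l.
Qed.

Variables (a b : \bar R) (f : R -> R).
Local Notation I := (oitv a b).
Hypothesis fl : forall z, I z -> f x @[x --> z^'-] --> f z.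
Hypothesis fr : forall z, I z -> cvg (f x @[x --> z^'+]).

(** [var] compares f(t_i-) with f(t_{i-1}+), so |f y - f x| is no term of it. Points x' slightly
    before x and y' slightly before y are appended to a list in ]a, x[: by left-continuity, f(y'-) -
    f(x'+) is within e of f y - f x. *)
Lemma var_increase x y : I x -> I y -> x < y ->
  (var (oitv a x%:E) f + `|f y - f x|%:E <= var (oitv a y%:E) f)%E.
Proof.
move=> Ix Iy xy; rewrite -leeBrDr//.
apply/ge_ereal_sup => _ [t [st tA] <-]; rewrite var_sumE leeBrDr//.
apply/lee_addgt0Pr => e e0.
have e2 : 0 < e / 2 by rewrite divr_gt0.
have tx : {in t, forall z, z < x} by move=> z /tA; rewrite inE => -[_]; rewrite lte_fin.
have ntx : \forall z \near x^'-, all (< z) t.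
  elim: {st tA} t tx => [_|u t ih tx]; first exact: nearW.
  near=> z => /=; apply/andP; split; near: z.
    by apply: nbhs_left_gt; apply: tx; rewrite inE eqxx.
  by apply: ih => v vt; apply: tx; rewrite inE vt orbT.
have ha z : I z -> \forall x' \near z^'-, `|f z - f x'| <= e / 2.
  by move=> Iz; move/cvgrPdist_le : (fl Iz); apply.
have rf z l : f x @[x --> z^'+] --> l -> rlim f z = l by move=> fzl; exact/cvg_lim.
have lf z : I z -> llim f z = f z by move=> Iz; apply/cvg_lim => //; exact: fl.
have [x0 [x0x x0P]] : exists x0, x0 < x /\ forall z, x0 < z < x ->
    [/\ I z, all (< z) t & `|f x - f z| <= e / 2].
  have H : \forall z \near x^'-, [/\ I z, all (< z) t & `|f x - f z| <= e / 2].
    near=> z; split; near: z => //; last exact: ha.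
    exact: oitv_near_left.
  case: H => d /= d0 H; exists (x - d); split; first by lra.
  by move=> z /andP[z1 z2]; apply: H => //=; rewrite ger0_norm; lra.
pose x' := (x0 + x) / 2.
have x'P : x0 < x' < x by rewrite /x'; lra.
have [Ix' nx' _] := x0P x' x'P.
have /andP[x0x' x'x] := x'P.
have [y' [y'y [xy' Iy' fy']]] : exists y', y' < y /\ [/\ x < y', I y' & `|f y - f y'| <= e / 2].
  near y^'- => z; exists z; split; first by near: z; exact: nbhs_left_lt.
  split; near: z; [exact: nbhs_left_gt|exact: oitv_near_left|exact: ha].
have rx' : `|rlim f x' - f x| <= e / 2.
  apply: (@cvg_norm_le _ x'^'+ _ f); first exact: fr.
  near=> z; rewrite distrC.
  have xz : x' < z by near: z; exact: nbhs_right_gt.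
  have zx : z < x by near: z; exact: nbhs_right_lt.
  by have [] := x0P z; first by rewrite zx (lt_trans x0x').
have V : ((var_sum f (t ++ [:: x'; y']))%:E <= var (oitv a y%:E) f)%E.
  rewrite varE; apply: ereal_sup_ubound; exists (t ++ [:: x'; y']) => //; split.
    rewrite (sorted_pairwise lt_trans) pairwise_cat -(sorted_pairwise lt_trans) st/=.
    rewrite (lt_trans x'x xy')/= andbT allrel_consr allrel_consr allrel0r nx'/= andbT.
    by apply/allP => u ut; rewrite (lt_trans _ (lt_trans x'x xy'))//; exact: (allP nx').
  move=> u; rewrite mem_cat !inE => /orP[/tA|/orP[]/eqP ->]; rewrite ?inE.
  - by move=> [au ux]; split => //; rewrite (lt_trans ux)// lte_fin.
  - by split; [case: Ix'|rewrite lte_fin (lt_trans x'x)].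
  - by split; [case: Iy'|rewrite lte_fin].
apply: le_trans (leeD2r _ V).
rewrite -!EFinD lee_fin.
have := var_sum_cat f t x' y'; rewrite lf//.
have -> : f y - f x = (f y - f y') + (f y' - rlim f x') + (rlim f x' - f x) by ring.
have := ler_normD (f y - f y' + (f y' - rlim f x')) (rlim f x' - f x).
have := ler_normD (f y - f y') (f y' - rlim f x').
lra.
Unshelve. all: by end_near. Qed.

(** W z is the variation over ]a, z[. The uniform bound on its increments later makes the jumps
    summable over all of I. *)
Lemma variation_dominates : (var I f < +oo)%E -> exists W : R -> R,
  [/\ exists B, forall x y, I x -> I y -> W y - W x <= B &
      forall x y, I x -> I y -> x <= y -> `|f y - f x| <= W y - W x].
Proof.
move=> Vf; exists (fun z : R => fine (var (oitv a z%:E) f)).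
have fV : var I f \is a fin_num by rewrite ge0_fin_numE// var_ge0.
have leV x : I x -> (var (oitv a x%:E) f <= var I f)%E.
  by move=> [_ xb]; apply: sub_var => z [az zx]; split => //; exact: lt_trans xb.
have fVx x : I x -> var (oitv a x%:E) f \is a fin_num.
  by move=> Ix; rewrite ge0_fin_numE ?var_ge0// (le_lt_trans (leV x Ix)).
split.
  exists (fine (var I f)) => x y Ix Iy.
  have := fine_ge0 (var_ge0 (oitv a x%:E) f).
  have : fine (var (oitv a y%:E) f) <= fine (var I f) by apply: fine_le; rewrite ?fVx ?leV.
  by lra.
move=> x y Ix Iy; rewrite le_eqVlt => /predU1P[->|xy]; first by rewrite !subrr normr0.
have := var_increase Ix Iy xy.
rewrite -(fineK (fVx x Ix)) -(fineK (fVx y Iy)) -EFinD lee_fin/=; lra.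
Qed.

End VariationFunction.

Lemma finite_near_right {R : realType} (F : set R) (t : R) : finite_set F ->
  \forall y \near t^'+, forall z, t < z < y -> ~ F z.
Proof.
move=> /finite_seqP[s ->]; elim: s => [|u s ih]; first exact: nearW.
have H : \forall y \near t^'+, t < u -> y < u.
  have [ut|tu] := leP u t; first exact: nearW.
  by near=> y => _; near: y; exact: nbhs_right_lt.
apply: filterS2 H ih => y yu sy z /[dup] /sy zs /andP[tz zy] /=.
rewrite inE => /orP[/eqP zu|//].
by have := yu; rewrite -zu tz => /(_ isT); rewrite ltNge ltW.
Unshelve. all: by end_near. Qed.

Lemma finite_near_left {R : realType} (F : set R) (t : R) : finite_set F ->
  \forall y \near t^'-, forall z, y <= z < t -> ~ F z.
Proof.
move=> /finite_seqP[s ->]; elim: s => [|u s ih]; first exact: nearW.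
have H : \forall y \near t^'-, u < t -> u < y.
  have [ut|tu] := ltP u t; last exact: nearW.
  by near=> y => _; near: y; exact: nbhs_left_gt.
apply: filterS2 H ih => y yu sy z /[dup] /sy zs /andP[yz zt] /=.
rewrite inE => /orP[/eqP zu|//].
by have := yu; rewrite -zu zt => /(_ isT); rewrite ltNge yz.
Unshelve. all: by end_near. Qed.

(** * Jumps and the continuous part *)

Section Jumps.
Context {R : realType}.
Variables (a b : \bar R) (f W : R -> R).
Local Notation I := (oitv a b).
Local Notation J := (fun z => rlim f z - llim f z).
Hypothesis fl : forall z, I z -> f x @[x --> z^'-] --> f z.
Hypothesis fr : forall z, I z -> cvg (f x @[x --> z^'+]).
Hypothesis WB : exists B, forall x y, I x -> I y -> W y - W x <= B.
Hypothesis fW : forall x y, I x -> I y -> x <= y -> `|f y - f x| <= W y - W x.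

Lemma dominating_ge0 x y : I x -> I y -> x <= y -> 0 <= W y - W x.
Proof. by move=> Ix Iy xy; apply: le_trans (fW Ix Iy xy). Qed.

Lemma llim_left_continuous z : I z -> llim f z = f z.
Proof. by move=> Iz; apply/cvg_lim => //; exact: fl. Qed.

Lemma jump_le x y : I x -> I y -> x < y -> `|J x| <= W y - W x.
Proof.
move=> Ix Iy xy; rewrite /= llim_left_continuous//.
apply: (@cvg_norm_le _ x^'+ _ f); first exact: fr.
near=> z.
have xz : x < z by near: z; exact: nbhs_right_gt.
have zy : z <= y by near: z; exact: nbhs_right_le.
have Iz : I z by apply: (oitv_convex Ix Iy); rewrite (ltW xz).
have := fW Ix Iz (ltW xz); have := dominating_ge0 Iz Iy zy; lra.
Unshelve. all: by end_near. Qed.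

(** Each jump is charged to the interval up to the next point of the list, the last one to the
    interval ending at y. *)
Lemma jump_sum_seq x y (s : seq R) : I x -> I y -> x <= y -> sorted <%R s ->
  all (fun z => x <= z < y) s -> \sum_(z <- s) `|J z| <= W y - W x.
Proof.
move=> Ix Iy; elim: s x Ix => [|u s ih] x Ix xy.
  by rewrite big_nil => _ _; exact: dominating_ge0.
move=> us /= /andP[/andP[xu uy] sxy]; rewrite big_cons.
have Iu : I u by apply: (oitv_convex Ix Iy); rewrite xu ltW.
have xuW := dominating_ge0 Ix Iu xu.
case: s us sxy ih => [_ _ _|v s /= /andP[uv vs] sxy ih].
  by rewrite big_nil addr0; have := jump_le Iu Iy uy; lra.
have vy : v < y by move: sxy => /andP[/andP[]].
have Iv : I v by apply: (oitv_convex Iu Iy); rewrite !ltW.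
have := ih v Iv (ltW vy) vs; rewrite lexx vy/=.
have -> : all (fun z => v <= z < y) s.
  apply/allP => z zs; move: sxy => /andP[_ /allP /(_ z zs) /andP[_ ->]].
  by move: vs => /(order_path_min lt_trans)/allP/(_ z zs)/ltW ->.
by move=> /(_ isT); have := jump_le Iu Iv uv; lra.
Qed.

Lemma jump_sum_finite x y (X : set R) : I x -> I y -> x <= y -> finite_set X ->
  (forall z, X z -> x <= z < y) -> (\sum_(z \in X) `|J z|%:E <= (W y - W x)%:E)%E.
Proof.
move=> Ix Iy xy finX XA.
rewrite fsbig_finite//= sumEFin lee_fin.
set s := (S in \sum_(_ <- S) _).
have us : uniq s by exact: finmap.fset_uniq.
have sX z : z \in s -> X z by move=> zs; apply: set_mem; rewrite -(in_fset_set finX).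
rewrite (perm_big (sort <=%R s))/=; last by rewrite perm_sym perm_sort.
apply: jump_sum_seq => //; first by rewrite sort_lt_sorted.
apply/allP => z; by rewrite mem_sort => /sX/XA.
Qed.

Lemma jump_sum_le x y : I x -> I y -> x <= y ->
  (\esum_(z in [set z : R | (x <= z < y)%R]) `|J z|%:E <= (W y - W x)%:E)%E.
Proof.
by move=> Ix Iy xy; apply/ge_ereal_sup => _ [X [finX XA] <-]; apply: jump_sum_finite.
Qed.

Lemma jump_summable : abs_summable I J.
Proof.
(* The maximum with 0 takes care of the empty family. *)
have [B BP] := WB; apply: (@le_lt_trans _ _ (Num.max B 0)%:E); last exact: ltry.
apply/ge_ereal_sup => _ [X [finX XI] <-].
have [->|/set0P[t0 Xt0]] := eqVneq X set0.
  by rewrite fsbig_set0 lee_fin le_max lexx orbT.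
have [x [y [Ix Iy Xxy]]] : exists x y, [/\ I x, I y & forall z, X z -> x <= z < y].
  have It0 := XI _ Xt0.
  move: finX XI => /finite_seqP[s -> sI]; elim: s sI => [_|u s ih sI].
    by have [y Iy ty] := oitv_gt It0; exists t0, y; split.
  have [|x [y [Ix Iy sxy]]] := ih; first by move=> z zs; apply: sI => /=; rewrite inE zs orbT.
  have Iu : I u by apply: sI => /=; rewrite inE eqxx.
  have [v Iv uv] := oitv_gt Iu.
  exists (Num.min x u), (Num.max y v); split.
  - by rewrite /Num.min; case: ifP.
  - by rewrite /Num.max; case: ifP.
  - move=> z /=; rewrite inE ge_min lt_max => /orP[/eqP ->|/sxy/andP[-> ->]//].
    by rewrite lexx uv !orbT.
have xy : x <= y by have /andP[/le_trans xt0 /ltW /xt0] := Xxy _ Xt0.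
apply: le_trans (jump_sum_finite Ix Iy xy finX Xxy) _.
by rewrite lee_fin le_max BP.
Qed.

(** With left-continuous representatives, the increment from x to y contains the jump at x but not
    the one at y, hence the half-open range of the sum. *)
Lemma cont_partB x y : I x -> I y -> x <= y ->
  cont_part a b f y - cont_part a b f x =
  f y - f x - rsum [set z : R | (x <= z < y)%R] J.
Proof.
move=> Ix Iy xy; rewrite /cont_part !llim_left_continuous// /jump_part.
rewrite (@rsum_setU _ [set tau | I tau /\ tau < x] [set tau | I tau /\ tau < y]); last 2 first.
- by move=> z [Iz zx]; split => //; exact: lt_le_trans xy.
- by apply: abs_summableS jump_summable => z [].
rewrite (_ : _ `\` _ = [set z : R | (x <= z < y)%R]); first by ring.
apply/seteqP; split => z /=.
  by move=> [[Iz ->] /not_andP[//|/negP]]; rewrite -leNgt => ->.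
move=> /andP[xz zy]; split; first by split => //; apply: (oitv_convex Ix Iy); rewrite xz ltW.
by move=> []; rewrite ltNge xz.
Qed.

Lemma jump_rsum_le x y : I x -> I y -> x <= y ->
  `|rsum [set z : R | (x <= z < y)%R] J| <= W y - W x.
Proof.
move=> Ix Iy xy; apply: rsum_le; last exact: jump_sum_le.
apply: abs_summableS jump_summable => z /andP[xz zy].
by apply: (oitv_convex Ix Iy); rewrite xz ltW.
Qed.

Lemma cont_part_dominated x y : I x -> I y -> x <= y ->
  `|cont_part a b f y - cont_part a b f x| <= 2 * (W y - W x).
Proof.
move=> Ix Iy xy; rewrite cont_partB// (le_trans (ler_normB _ _))//.
have := jump_rsum_le Ix Iy xy; have := fW Ix Iy xy; lra.
Qed.

(** Close to t only a small tail of the jumps is left in the sum. On the right the jump at t is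
    split off first: it is exactly f(t+) - f(t), so f y - f t loses its discontinuity. *)
Lemma cont_part_continuous t : I t -> {for t, continuous (cont_part a b f)}.
Proof.
move=> It; apply/left_right_continuousP; split.
  apply/cvgrPdist_le => e e0; have e2 : 0 < e / 2 by rewrite divr_gt0.
  have [F finF FP] := abs_summable_tail jump_summable e2.
  near=> x.
  have xt : x < t by near: x; exact: nbhs_left_lt.
  have Ix : I x by near: x; exact: oitv_near_left.
  have xF : forall z, x <= z < t -> ~ F z by near: x; exact: finite_near_left.
  rewrite cont_partB ?(ltW xt)// (le_trans (ler_normB _ _))//.
  rewrite [leRHS](splitr e) lerD//.
    by near: x; move/cvgrPdist_le : (fl It); apply.
  have xI : [set z | x <= z < t] `<=` I.
    by move=> z /andP[xz zt]; apply: (oitv_convex Ix It); rewrite xz ltW.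
  apply: rsum_le; first exact: abs_summableS jump_summable.
  by apply: FP => //; apply/seteqP; split => // z [/xF].
apply/cvgrPdist_le => e e0; have e2 : 0 < e / 2 by rewrite divr_gt0.
have [F finF FP] := abs_summable_tail jump_summable e2.
near=> y.
have ty : t < y by near: y; exact: nbhs_right_gt.
have Iy : I y by near: y; exact: oitv_near_right.
have yF : forall z, t < z < y -> ~ F z by near: y; exact: finite_near_right.
rewrite distrC cont_partB ?(ltW ty)//.
have tI : [set z | t <= z < y] `<=` I.
  by move=> z /andP[tz zy]; apply: (oitv_convex It Iy); rewrite tz ltW.
rewrite (@rsum_setU _ [set t] [set z | t <= z < y]); last 2 first.
- by move=> _ ->; rewrite /= lexx.
- exact: abs_summableS jump_summable.
have -> : rsum [set t] J = rlim f t - f t.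
  rewrite /rsum !esum_set1 ?lee_fin ?le_max ?lexx ?orbT//= llim_left_continuous//.
  by rewrite /Num.max; do ! case: ifPn; rewrite -?leNgt; lra.
have -> : f y - f t - (rlim f t - f t + rsum ([set z | t <= z < y] `\` [set t]) J) =
  (f y - rlim f t) - rsum ([set z | t <= z < y] `\` [set t]) J by ring.
rewrite (le_trans (ler_normB _ _))// [leRHS](splitr e) lerD//.
  by rewrite distrC; near: y; move/cvgrPdist_le : (fr It); apply.
have tI' : [set z | t <= z < y] `\` [set t] `<=` I by move=> z [/tI].
apply: rsum_le; first exact: abs_summableS jump_summable.
apply: FP => //; apply/seteqP; split => // z [[/andP[]]].
rewrite le_eqVlt => /predU1P[<- _ /(_ erefl)//|tz zy _].
by apply: yF; rewrite tz.
Unshelve. all: by end_near. Qed.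

End Jumps.

(** * The continuous part of a product *)

Lemma cvg_right_osc {R : realType} (f : R -> R) (t e : R) : 0 < e ->
  cvg (f x @[x --> t^'+]) -> exists2 eta : R, 0 < eta &
    forall z w, t < z < t + eta -> t < w < t + eta -> `|f z - f w| <= e.
Proof.
move=> e0 /cvgrPdist_le/(_ (e / 2) (divr_gt0 e0 (ltr0Sn _ _))) [eta /= eta0 H].
exists eta => // z w /andP[tz ze] /andP[tw we].
have tz' : `|t - z| < eta by rewrite ltr0_norm ?subr_lt0//; lra.
have tw' : `|t - w| < eta by rewrite ltr0_norm ?subr_lt0//; lra.
have := H z tz' tz; have := H w tw' tw; set L := lim _ => Hw Hz.
rewrite (_ : f z - f w = (L - f w) - (L - f z)); last by ring.
by rewrite (le_trans (ler_normB _ _))//; lra.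
Qed.

Lemma cvg_left_osc {R : realType} (f : R -> R) (t e : R) : 0 < e ->
  cvg (f x @[x --> t^'-]) -> exists2 eta : R, 0 < eta &
    forall z w, t - eta < z < t -> t - eta < w < t -> `|f z - f w| <= e.
Proof.
move=> e0 /cvgrPdist_le/(_ (e / 2) (divr_gt0 e0 (ltr0Sn _ _))) [eta /= eta0 H].
exists eta => // z w /andP[tz ze] /andP[tw we].
have tz' : `|t - z| < eta by rewrite gtr0_norm ?subr_gt0//; lra.
have tw' : `|t - w| < eta by rewrite gtr0_norm ?subr_gt0//; lra.
have := H z tz' ze; have := H w tw' we; set L := lim _ => Hw Hz.
rewrite (_ : f z - f w = (L - f w) - (L - f z)); last by ring.
by rewrite (le_trans (ler_normB _ _))//; lra.
Qed.

Section ContPartMul.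
Context {R : realType}.
Variables (a b : \bar R) (f g k W : R -> R).
Local Notation I := (oitv a b).
Local Notation J h := (fun z => rlim h z - llim h z).
Hypothesis fl : forall z, I z -> f x @[x --> z^'-] --> f z.
Hypothesis fr : forall z, I z -> cvg (f x @[x --> z^'+]).
Hypothesis gl : forall z, I z -> g x @[x --> z^'-] --> g z.
Hypothesis gr : forall z, I z -> cvg (g x @[x --> z^'+]).
Hypothesis kE : forall z, I z -> k z = f z * g z.
Hypothesis WB : exists B, forall x y, I x -> I y -> W y - W x <= B.
Hypothesis fW : forall x y, I x -> I y -> x <= y -> `|f y - f x| <= W y - W x.
Hypothesis gW : forall x y, I x -> I y -> x <= y -> `|g y - g x| <= W y - W x.
Hypothesis kW : forall x y, I x -> I y -> x <= y -> `|k y - k x| <= W y - W x.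

Let kl z : I z -> k x @[x --> z^'-] --> k z.
Proof.
move=> Iz; rewrite kE//.
apply: (@cvg_trans _ ((fun x => f x * g x) @ z^'-)).
  apply: near_eq_cvg; near=> x; rewrite kE//; near: x; exact: oitv_near_left.
by apply: cvgM; [exact: fl|exact: gl].
Unshelve. all: by end_near. Qed.

Let krE z : I z -> k x @[x --> z^'+] --> rlim f z * rlim g z.
Proof.
move=> Iz; apply: (@cvg_trans _ ((fun x => f x * g x) @ z^'+)).
  apply: near_eq_cvg; near=> x; rewrite kE//; near: x; exact: oitv_near_right.
by apply: cvgM; [exact: fr|exact: gr].
Unshelve. all: by end_near. Qed.

Let kr z : I z -> cvg (k x @[x --> z^'+]).
Proof. by move=> /krE kz; apply/cvg_ex; eexists; exact: kz. Qed.

Local Notation kc := (cont_part a b k).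
Local Notation fc := (cont_part a b f).
Local Notation gc := (cont_part a b g).

(* On an interval where f and g oscillate little, both the increment and the
   jumps of f * g agree with those of g(m) f + f(m) g up to eps times the
   increments and jumps of f and g. *)
Lemma cont_part_mul_inner x y x' y' m e : I x -> I y -> x < x' -> x' < y' -> y' < y ->
  (forall z, x < z < y -> `|f z - f m| <= e) ->
  (forall z, x < z < y -> `|g z - g m| <= e) ->
  `|(kc y' - kc x') - g m * (fc y' - fc x') - f m * (gc y' - gc x')|
    <= 4 * e * (W y' - W x').
Proof.
move=> Ix Iy xx' x'y' y'y fm gm.
have Ixy z : x < z < y -> I z.
  by move=> /andP[xz zy]; apply: (oitv_convex Ix Iy); rewrite !ltW.
have x'P : x < x' < y by rewrite xx' (lt_trans x'y').
have y'P : x < y' < y by rewrite y'y (lt_trans xx').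
have [Ix' Iy'] := (Ixy _ x'P, Ixy _ y'P).
have e0 : 0 <= e by apply: le_trans (fm _ x'P).
rewrite (cont_partB kl kr WB kW Ix' Iy' (ltW x'y')).
rewrite (cont_partB fl fr WB fW Ix' Iy' (ltW x'y')).
rewrite (cont_partB gl gr WB gW Ix' Iy' (ltW x'y')).
set S := [set z : R | (x' <= z < y')%R].
have SI : S `<=` [set z | x < z < y].
  by move=> z /andP[x'z zy'] /=; rewrite (lt_le_trans xx' x'z) (lt_trans zy').
have SII : S `<=` I by move=> z /SI/Ixy.
have sk : abs_summable S (J k) := abs_summableS SII (jump_summable kl kr WB kW).
have sf : abs_summable S (J f) := abs_summableS SII (jump_summable fl fr WB fW).
have sg : abs_summable S (J g) := abs_summableS SII (jump_summable gl gr WB gW).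
(* The jump at z of f g - g(m) f - f(m) g. *)
pose u z := J k z + (- g m * J f z + - f m * J g z).
have su : abs_summable S u.
  by apply: abs_summableD => //; apply: abs_summableD; exact: abs_summableZ.
have uE : rsum S u = rsum S (J k) - g m * rsum S (J f) - f m * rsum S (J g).
  rewrite /u (@rsumD _ S (J k) (fun z => - g m * J f z + - f m * J g z))//; last first.
    by apply: abs_summableD; exact: abs_summableZ.
  rewrite (@rsumD _ S (fun z => - g m * J f z) (fun z => - f m * J g z)); [|exact: abs_summableZ..].
  by rewrite (@rsumZ _ S _ (J f))// (@rsumZ _ S _ (J g))//; ring.
have frm z : x < z < y -> `|rlim f z - f m| <= e.
  move=> xzy; have /andP[xz zy] := xzy; apply: (@cvg_norm_le _ z^'+ _ f); first exact/fr/Ixy.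
  near=> w; apply: fm; apply/andP; split.
    by apply: (lt_trans xz); near: w; exact: nbhs_right_gt.
  by near: w; exact: nbhs_right_lt.
have grm z : x < z < y -> `|rlim g z - g m| <= e.
  move=> xzy; have /andP[xz zy] := xzy; apply: (@cvg_norm_le _ z^'+ _ g); first exact/gr/Ixy.
  near=> w; apply: gm; apply/andP; split.
    by apply: (lt_trans xz); near: w; exact: nbhs_right_gt.
  by near: w; exact: nbhs_right_lt.
(* Only the later value p' of f and the earlier value q of g enter as coefficients. The estimate is
   used for the increment from x' to y' and, with one-sided limits at z, for each jump. *)
have prod p q p' q' : `|p' - f m| <= e -> `|q - g m| <= e ->
    `|p' * q' - p * q + (- g m * (p' - p) + - f m * (q' - q))| <= e * (`|p' - p| + `|q' - q|).
  move=> pm qm.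
  have -> : p' * q' - p * q + (- g m * (p' - p) + - f m * (q' - q)) =
    (q - g m) * (p' - p) + (p' - f m) * (q' - q) by ring.
  rewrite (le_trans (ler_normD _ _))// !normrM mulrDr lerD// ler_wpM2r//.
have uS : (\esum_(z in S) `|u z|%:E <= (2 * e * (W y' - W x'))%:E)%E.
  have esJ : (\esum_(z in S) (e * (`|J f z| + `|J g z|))%:E <= (2 * e * (W y' - W x'))%:E)%E.
    rewrite (@esumZl _ S e (fun z => `|J f z| + `|J g z|))//.
      under eq_esum do rewrite EFinD.
      rewrite esumD//; try by move=> z _; rewrite lee_fin.
      rewrite (mulrC 2) -mulrA EFinM lee_wpmul2l ?lee_fin//.
      rewrite (_ : 2 * _ = (W y' - W x') + (W y' - W x')); last by ring.
      by rewrite EFinD leeD// ?(jump_sum_le fl fr fW)// ?(jump_sum_le gl gr gW)// ltW.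
  apply: le_trans esJ; apply: le_esum => z Sz.
  have Iz := SII _ Sz; have xzy := SI _ Sz.
  rewrite lee_fin /u/= (llim_left_continuous kl Iz) (llim_left_continuous fl Iz) (llim_left_continuous gl Iz).
  have -> : rlim k z = rlim f z * rlim g z by apply/cvg_lim => //; exact: krE.
  by rewrite kE//; apply: prod; [exact: frm|exact: gm].
(* Jumps and increment each contribute 2 e times the increment of W, which makes the constant 4. *)
have := rsum_le su uS; rewrite uE => K.
have := prod (f x') (g x') (f y') (g y') (fm _ y'P) (gm _ x'P).
have Wf := fW Ix' Iy' (ltW x'y'); have Wg := gW Ix' Iy' (ltW x'y').
rewrite (kE Ix') (kE Iy') => K2.
have {}K2 := le_trans K2 (ler_wpM2l e0 (lerD Wf Wg)).
move: K K2; set r1 := rsum S (J k); set r2 := rsum S (J f); set r3 := rsum S (J g) => K K2.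
have -> : f y' * g y' - f x' * g x' - r1 - g m * (f y' - f x' - r2) - f m * (g y' - g x' - r3) =
  (f y' * g y' - f x' * g x' + (- g m * (f y' - f x') + - f m * (g y' - g x'))) -
  (r1 - g m * r2 - f m * r3) by ring.
by rewrite (le_trans (ler_normB _ _))//; lra.
Unshelve. all: by end_near. Qed.

(** Oscillation is controlled on the open cell only, so the inner estimate is passed to the limit at
    both ends. The continuous parts allow this; W may jump, and is therefore bounded beforehand by
    its increment over the whole cell. *)
Lemma cont_part_mul_local x y m e : I x -> I y -> x < y ->
  (forall z, x < z < y -> `|f z - f m| <= e) ->
  (forall z, x < z < y -> `|g z - g m| <= e) ->
  `|(kc y - kc x) - g m * (fc y - fc x) - f m * (gc y - gc x)| <= 4 * e * (W y - W x).
Proof.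
move=> Ix Iy xy fm gm.
pose G z := kc z - g m * fc z - f m * gc z.
have Gc z : I z -> {for z, continuous G}.
  move=> Iz; apply: cvgB; first apply: cvgB.
  - exact: (cont_part_continuous kl kr WB kW).
  - by apply: cvgMr; exact: (cont_part_continuous fl fr WB fW).
  - by apply: cvgMr; exact: (cont_part_continuous gl gr WB gW).
have -> : kc y - kc x - g m * (fc y - fc x) - f m * (gc y - gc x) = G y - G x.
  by rewrite /G; ring.
have e0 : 0 <= e by apply: (le_trans _ (fm ((x + y) / 2) _)) => //; lra.
have W_le u v : x <= u -> u <= v -> v <= y -> W v - W u <= W y - W x.
  move=> xu uv vy.
  have Iu : I u by apply: (oitv_convex Ix Iy); rewrite xu (le_trans uv).
  have Iv : I v by apply: (oitv_convex Ix Iy); rewrite vy (le_trans xu).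
  have := dominating_ge0 fW Ix Iu xu; have := dominating_ge0 fW Iv Iy vy; lra.
have inner x' y' : x < x' -> x' < y' -> y' < y -> `|G y' - G x'| <= 4 * e * (W y - W x).
  move=> xx' x'y' y'y.
  have := cont_part_mul_inner Ix Iy xx' x'y' y'y fm gm.
  have -> : kc y' - kc x' - g m * (fc y' - fc x') - f m * (gc y' - gc x') = G y' - G x'.
    by rewrite /G; ring.
  move=> /le_trans; apply; rewrite ler_wpM2l ?mulr_ge0//.
  by apply: W_le; exact: ltW.
have left x' : x < x' -> x' < y -> `|G y - G x'| <= 4 * e * (W y - W x).
  move=> xx' x'y; apply: (@cvg_norm_le _ y^'- _ G).
    by apply: cvg_within_filter; exact: Gc.
  have H : \forall z \near y^'-, x' < z by exact: nbhs_left_gt.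
  near=> z; apply: inner => //; near: z => //; exact: nbhs_left_lt.
rewrite distrC; apply: (@cvg_norm_le _ x^'+ _ G).
  by apply: cvg_within_filter; exact: Gc.
near=> z; rewrite distrC; apply: left; near: z; [exact: nbhs_right_gt|exact: nbhs_right_lt].
Unshelve. all: by end_near. Qed.

Lemma cont_part_mul_RS (phi : R -> R) c d M l l1 l2 : c <= d -> `[c, d] `<=` I ->
  (forall x, c <= x <= d -> `|phi x| <= M) ->
  is_RS phi kc c d l ->
  is_RS (fun x => g x * phi x) fc c d l1 ->
  is_RS (fun x => f x * phi x) gc c d l2 ->
  l = l1 + l2.
Proof.
move=> cd cdI phiM /is_RSP H /is_RSP H1 /is_RSP H2.
have cdI' x : c <= x <= d -> I x by move=> xcd; apply: cdI; rewrite /= in_itv.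
have [Ic Id] : I c /\ I d by split; apply: cdI'; rewrite lexx ?andbT.
pose V := W d - W c.
have V0 : 0 <= V by exact: (dominating_ge0 fW).
have M0 : 0 <= M by apply: (le_trans (normr_ge0 (phi c))); apply: phiM; rewrite lexx.
apply/eqP; rewrite -subr_eq0 -normr_le0; apply/ler_addgt0Pr => e e0; rewrite add0r.
have e4 : 0 < e / 4 by rewrite divr_gt0.
have [d0 d00 {}H] := H _ e4; have [d1 d10 {}H1] := H1 _ e4; have [d2 d20 {}H2] := H2 _ e4.
have [del [del0 dd0 dd1 dd2]] : exists del, [/\ 0 < del, del <= d0, del <= d1 & del <= d2].
  exists (Num.min d0 (Num.min d1 d2)); rewrite !lt_min d00 d10 d20.
  by rewrite !ge_min !lexx !orbT.
(* Chosen so that the accumulated error M (4 e' V) is at most e / 4. *)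
pose e' := e / 4 / (4 * (M * V + 1)).
have MV0 : 0 <= M * V by rewrite mulr_ge0.
have e'0 : 0 < e' by rewrite !divr_gt0// mulr_gt0// ltr_wpDl.
(* The midpoint lies in the open cell, where f and g oscillate little; with it as tag, one partition
   serves all three sums. *)
pose mid (x y : R) := (x + y) / 2.
pose Q x y := y - x < del /\ forall z, x < z < y ->
  `|f z - f (mid x y)| <= e' /\ `|g z - g (mid x y)| <= e'.
have [p pQ] : exists p, chain Q c p d.
  apply: chain_exists => // t tcd; have It := cdI' _ tcd.
  have [r1 r10 Hr1] := cvg_right_osc e'0 (fr It); have [r2 r20 Hr2] := cvg_right_osc e'0 (gr It).
  have fl' : cvg (f x @[x --> t^'-]) by apply/cvg_ex; eexists; exact: fl.
  have gl' : cvg (g x @[x --> t^'-]) by apply/cvg_ex; eexists; exact: gl.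
  have [s1 s10 Hs1] := cvg_left_osc e'0 fl'; have [s2 s20 Hs2] := cvg_left_osc e'0 gl'.
  exists (Num.min del (Num.min (Num.min r1 r2) (Num.min s1 s2))).
    by rewrite !lt_min del0 r10 r20 s10.
  split => [x cx tx xt|y yd ty yt].
    have : t - x < Num.min del (Num.min (Num.min r1 r2) (Num.min s1 s2)) by lra.
    rewrite !lt_min => /and3P[tdel _ /andP[ts1 ts2]]; split => // z xzt.
    have close r w : t - x < r -> x < w < t -> t - r < w < t.
      by move=> tr /andP[xw ->]; rewrite andbT (le_lt_trans _ xw)// lerBlDr -lerBlDl ltW.
    have midP : x < mid x t < t by rewrite !midf_lt.
    by split; [apply: Hs1|apply: Hs2]; exact: close.
  have : y - t < Num.min del (Num.min (Num.min r1 r2) (Num.min s1 s2)) by lra.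
  rewrite !lt_min => /and3P[tdel /andP[tr1 tr2] _]; split => // z tzy.
  have close r w : y - t < r -> t < w < y -> t < w < t + r.
    by move=> yr /andP[-> wy]; rewrite (lt_trans wy)// -ltrBlDl.
  have midP : t < mid t y < y by rewrite !midf_lt.
  by split; [apply: Hr1|apply: Hr2]; exact: close.
pose tp := tag_chain mid c p.
have tptag : tagged del c tp d.
  apply: tagged_chain; first by move=> x y xy; rewrite /mid; lra.
  by apply: sub_chain pQ => x y [].
have t0 : tagged d0 c tp d by exact: tagged_sub dd0 tptag.
have t1 : tagged d1 c tp d by exact: tagged_sub dd1 tptag.
have t2 : tagged d2 c tp d by exact: tagged_sub dd2 tptag.
have {}H := H _ t0; have {}H1 := H1 _ t1; have {}H2 := H2 _ t2.
(* On one cell the three terms combine to phi at the tag times the quantity bounded by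
   [cont_part_mul_local]. *)
have K c' q : c <= c' -> chain Q c' q d ->
    `|RS_sum phi kc c' (tag_chain mid c' q) -
      RS_sum (fun x => g x * phi x) fc c' (tag_chain mid c' q) -
      RS_sum (fun x => f x * phi x) gc c' (tag_chain mid c' q)| <= M * (4 * e' * (W d - W c')).
  elim: q c' => [c' cc' /= <-|x q ih c' cc' /= [c'x [_ Hosc] xp]].
    by rewrite !subrr normr0 !mulr0.
  have xd : x <= d.
    have : chain (fun x y => y - x < del) x q d by apply: sub_chain xp => ? ? [].
    by move=> /tagged_left/tagged_le.
  have Ic' : I c' by apply: cdI'; rewrite cc' (le_trans (ltW c'x)).
  have Ix : I x by apply: cdI'; rewrite xd (le_trans cc')// ltW.
  have {}ih := ih _ (le_trans cc' (ltW c'x)) xp.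
  have fmid z : c' < z < x -> `|f z - f (mid c' x)| <= e' by move=> /Hosc[].
  have gmid z : c' < z < x -> `|g z - g (mid c' x)| <= e' by move=> /Hosc[].
  have := cont_part_mul_local Ic' Ix c'x fmid gmid.
  set m := mid c' x; set D := _ - _ - _ => KD.
  have phim : `|phi m| <= M by apply: phiM; rewrite /m /mid; lra.
  set S0 := RS_sum _ _ _ _ in ih *; set S1 := RS_sum _ _ _ _ in ih *; set S2 := RS_sum _ _ _ _ in ih *.
  rewrite (_ : _ - _ - _ = phi m * D + (S0 - S1 - S2)); last by rewrite /D; ring.
  rewrite (le_trans (ler_normD _ _))// normrM.
  have := ler_pM (normr_ge0 _) (normr_ge0 _) phim KD; lra.
have e'E : M * (4 * e' * V) <= e / 4.
  have -> : M * (4 * e' * V) = e / 4 * (M * V / (M * V + 1)).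
    by rewrite /e'; field; rewrite gt_eqF// ltr_wpDl.
  by rewrite ler_piMr ?(ltW e4)// ler_pdivrMr ?ltr_wpDl// mul1r lerDl.
move: (K _ _ (lexx c) pQ) H H1 H2; rewrite -/tp -/V.
set S0 := RS_sum phi _ _ _; set S1 := RS_sum _ fc _ _; set S2 := RS_sum _ gc _ _ => {}K H H1 H2.
rewrite (_ : l - (l1 + l2) = (S0 - S1 - S2) - (S0 - l) + (S1 - l1) + (S2 - l2)); last by ring.
have := ler_normD ((S0 - S1 - S2) - (S0 - l) + (S1 - l1)) (S2 - l2).
have := ler_normD ((S0 - S1 - S2) - (S0 - l)) (S1 - l1).
have := ler_normB (S0 - S1 - S2) (S0 - l).
lra.
Qed.

End ContPartMul.

(** * Integrals over J *)

Section IntegralNull.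
Context {R : realType}.
Local Notation mu := (@lebesgue_measure R).
Import HBNNSimple.

(* No measurability of the integrands is required: the integral of a nonnegative
   function is the supremum of those of the simple functions below it. This
   matters for derive1, whose junk values at the points of non-differentiability
   need not be measurable a priori. *)
Lemma eq_integral_null (D N : set (measurableTypeR R)) (f g : measurableTypeR R -> \bar R) :
  measurable N -> mu N = 0%E -> (forall x, D x -> ~ N x -> f x = g x) ->
  (\int[mu]_(x in D) f x = \int[mu]_(x in D) g x)%E.
Proof.
move=> mN N0.
have le0 (u v : measurableTypeR R -> \bar R) :
    (forall x, 0 <= u x)%E -> (forall x, 0 <= v x)%E ->
    (forall x, ~ N x -> u x = v x) -> (\int[mu]_x u x <= \int[mu]_x v x)%E.
  move=> u0 v0 uv; rewrite !ge0_integralTE//.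
  apply: ge_ereal_sup => _ [h /= hu <-].
  (* Cut off on N, a simple function below u lies below v, and its integral is unchanged. *)
  have mCN : measurable (~` N) by exact: measurableC.
  apply: ereal_sup_ubound; exists (proj_nnsfun h mCN) => /=.
    move=> x; have [Nx|Nx] := pselect (N x).
      by rewrite mindicE memNset ?mulr0//= => /(_ Nx).
    by rewrite mindicE mem_set// mulr1 -uv.
  have sE (k : {nnsfun measurableTypeR R >-> R}) : sintegral mu k = (\int[mu]_x (k x)%:E)%E.
    by rewrite integral_nnsfun// patch_setT.
  rewrite !sE.
  apply: ge0_ae_eq_integral => //.
  - by apply/measurable_EFinP.
  - by apply/measurable_EFinP.
  - by move=> x _; rewrite lee_fin.
  - by move=> x _; rewrite lee_fin.
  exists N; split => // x /=; apply: contra_notP => Nx _ /=.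
  by rewrite mindicE mem_set// mulr1.
have le (u v : measurableTypeR R -> \bar R) :
    (forall x, D x -> 0 <= u x)%E -> (forall x, D x -> 0 <= v x)%E ->
    (forall x, D x -> ~ N x -> u x = v x) -> (\int[mu]_(x in D) u x <= \int[mu]_(x in D) v x)%E.
  move=> u0 v0 uv; rewrite integral_mkcond [leRHS]integral_mkcond; apply: le0.
  - by move=> x; apply: erestrict_ge0.
  - by move=> x; apply: erestrict_ge0.
  - by move=> x Nx; rewrite !patchE; case: ifP => //; rewrite inE => Dx; exact: uv.
move=> fg; rewrite integralE [RHS]integralE; congr (_ - _)%E; apply/eqP; rewrite eq_le; apply/andP;
  by split; apply: le => // x Dx Nx; rewrite ?funeposE ?funenegE fg.
Qed.

Lemma eq_Rintegral_ae (c d : R) (f g : R -> R) :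
  {ae mu, forall x, c < x < d -> f x = g x} ->
  \int[mu]_(x in `[c, d]) f x = \int[mu]_(x in `[c, d]) g x.
Proof.
move=> [N [mN N0 NP]].
have mE : measurable ([set c; d] : set (measurableTypeR R)).
  by apply: measurableU; exact: measurable_set1.
rewrite /Rintegral; congr fine.
apply: (@eq_integral_null _ (N `|` [set c; d])).
- exact: measurableU.
- apply/eqP; rewrite eq_le measure_ge0 andbT.
  apply: (@le_trans _ _ (mu N + mu [set c; d])%E); first exact: measureU2.
  rewrite N0 add0e (@countable_lebesgue_measure0 _ [set c; d])//.
  by apply: finite_set_countable; exact: finite_set2.
move=> x /=; rewrite in_itv/= => /andP[cx xd] /not_orP[Nx /not_orP[xc xnd]].
congr (_%:E); apply: contrapT => fgx; apply: Nx; apply: NP => /= H; apply: fgx; apply: H.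
by rewrite !lt_neqAle cx xd !andbT; apply/andP; split; apply/eqP => // /esym.
Qed.

End IntegralNull.

(** * Continuity points of regulated functions *)

Section RegulatedFunctions.
Context {R : realType}.
Variables (c d : R) (h : R -> R).
Hypothesis cd : c < d.
Hypothesis hr : forall t, c <= t < d -> cvg (h x @[x --> t^'+]).
Hypothesis hl : forall t, c < t <= d -> cvg (h x @[x --> t^'-]).

Lemma chain_cover (Q : R -> R -> Prop) c' p s : chain Q c' p d -> c' < s -> s < d ->
  s \notin p -> exists x y, [/\ x < s, s < y & Q x y].
Proof.
elim: p c' => [c' /= -> ds sd|x p ih c' /= [c'x Qx xd] c's sd].
  by have := lt_trans ds sd; rewrite ltxx.
rewrite inE negb_or => /andP[sx sp].
have [sltx|xs] := ltP s x; first by exists c', x.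
by apply: ih xd _ sd sp; rewrite lt_neqAle eq_sym sx.
Qed.

(** For each n there is a partition on whose open cells h oscillates by at most 1/(n+1); every
    discontinuity is a point of one of these partitions. *)
Lemma regulated_continuous : exists2 A : set R, countable A &
  forall s, c < s < d -> ~ A s -> {for s, continuous h}.
Proof.
have /choice[p pP] : forall n : nat, exists p,
    chain (fun x y => forall z w, x < z < y -> x < w < y -> `|h z - h w| <= n.+1%:R^-1) c p d.
  move=> n; have n0 : 0 < n.+1%:R^-1 :> R by rewrite invr_gt0.
  apply: chain_exists; [exact: ltW|] => t /andP[ct td].
  (* At an end point of [c, d] one side carries no information, and the guarding inequality makes
     the claim vacuous there. *)
  have [r1 r10 Hr] : exists2 r : R, 0 < r & t < d ->
      forall z w, t < z < t + r -> t < w < t + r -> `|h z - h w| <= n.+1%:R^-1.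
    have [ltd|] := ltP t d; last by move=> _; exists 1.
    by have [|r r0 H] := cvg_right_osc n0 (@hr t _); [rewrite ct|exists r].
  have [s1 s10 Hs] : exists2 r : R, 0 < r & c < t ->
      forall z w, t - r < z < t -> t - r < w < t -> `|h z - h w| <= n.+1%:R^-1.
    have [ltc|] := ltP c t; last by move=> _; exists 1.
    by have [|r r0 H] := cvg_left_osc n0 (@hl t _); [rewrite ltc|exists r].
  exists (Num.min r1 s1); first by rewrite lt_min r10.
  split => [x cx tx xt|y yd ty yt] z w.
    have : t - x < Num.min r1 s1 by lra.
    rewrite lt_min => /andP[_ ts] zP wP; apply: Hs; [exact: le_lt_trans xt|lra|lra].
  have : y - t < Num.min r1 s1 by lra.
  rewrite lt_min => /andP[tr _] zP wP; apply: Hr; [exact: lt_le_trans yd|lra|lra].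
exists (\bigcup_n [set` p n]).
  by apply: bigcup_countable => // n _; exact: finite_set_countable.
move=> s /andP[cs sd] As; apply/cvgrPdist_le => e e0.
have [n ne] : exists n : nat, n.+1%:R^-1 < e.
  by exists (Num.truncn e^-1); rewrite invf_plt ?posrE// truncnS_gt.
have sp : s \notin p n by apply/negP => sp; apply: As; exists n.
have [x [y [xs sy H]]] := chain_cover (pP n) cs sd sp.
near=> z; rewrite (le_trans _ (ltW ne))//; apply: H; first by rewrite xs.
by apply/andP; split; near: z; [exact: lt_nbhsr|exact: lt_nbhsl].
Unshelve. all: by end_near. Qed.

Lemma regulated_measurable : exists D : set R, [/\ measurable D,
  countable (`[c, d] `\` D), D `<=` `]c, d[,
  (forall s, D s -> {for s, continuous h}) & measurable_fun D h].
Proof.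
have [A cA AP] := regulated_continuous.
have mA : measurable A by exact: countable_measurable.
have mI : measurable (`]c, d[ : set R) by exact: measurable_itv.
exists (`]c, d[ `\` A); split.
- exact: measurableD.
- apply: (@sub_countable _ _ _ (A `|` [set c; d])); last first.
    rewrite -bigcup2inE; apply: bigcup_countable => // -[|[|i]] _ //=.
    by apply: finite_set_countable; exact: finite_set2.
  apply: subset_card_le => x /= [+ /not_andP[|/contrapT]]; last by left.
  rewrite !in_itv/= => /andP[cx xd] xcd; right.
  have [->|xc] := eqVneq x c; first by left.
  have [->|xd'] := eqVneq x d; first by right.
  by case: xcd; rewrite !lt_neqAle eq_sym xc cx xd' xd.
- by move=> x [].
- by move=> s [] /=; rewrite in_itv/= => /AP; apply.
- apply: subspace_continuous_measurable_fun; first exact: measurableD.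
  apply: continuous_in_subspaceT => x; rewrite inE => -[/=].
  by rewrite in_itv/= => /AP; apply.
Qed.

End RegulatedFunctions.

(** * Absolutely continuous functions on J *)

Section UnitInterval.
Context {R : realType}.
Local Notation mu := (@lebesgue_measure R).
Local Notation half := (@Defs.half R).
Local Notation J := (@Defs.J R).
Implicit Types (h phi psi : R -> R).

Lemma half_gt0 : 0 < half. Proof. by rewrite /Defs.half invr_gt0. Qed.

Lemma Nhalf_lt_half : - half < half.
Proof. by have := half_gt0; lra. Qed.

Lemma regulated_J h : regulated (- half)%:E half%:E h <->
  (forall t, - half <= t < half -> cvg (h x @[x --> t^'+])) /\
  (forall t, - half < t <= half -> cvg (h x @[x --> t^'-])).
Proof.
have H0 := Nhalf_lt_half.
split=> [[/= hl hr h1 h2]|[hr hl]].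
  split=> t /andP[].
    rewrite le_eqVlt => /predU1P[<- _|t1 t2]; first exact: h1.
    by apply: hr; split; rewrite lte_fin.
  move=> t1; rewrite le_eqVlt => /predU1P[->|t2]; first exact: h2.
  by apply: hl; split; rewrite lte_fin.
split=> /=.
- by move=> t [/=]; rewrite !lte_fin => t1 t2; apply: hl; rewrite t1 ltW.
- by move=> t [/=]; rewrite !lte_fin => t1 t2; apply: hr; rewrite t2 ltW.
- by apply: hr; rewrite lexx.
- by apply: hl; rewrite lexx andbT.
Qed.

Lemma abs_continuous_within c d h : abs_continuous c d h ->
  forall e, 0 < e -> exists2 eta, 0 < eta &
    forall s t, c <= s <= d -> c <= t <= d -> `|s - t| < eta -> `|h s - h t| < e.
Proof.
move=> ach e e0; have [eta eta0 H] := ach e e0; exists eta => //.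
have K s t : c <= s -> s <= t -> t <= d -> `|s - t| < eta -> `|h s - h t| < e.
  move=> cs st td std.
  have := H 1%N (fun=> s) (fun=> t); rewrite !big_ord1 distrC; apply => //.
    by move=> i j _ _ _; rewrite (ord1 i) (ord1 j).
  by apply: le_lt_trans std; rewrite distrC ler_norm.
move=> s t /andP[cs sd] /andP[ct td] std.
have [st|/ltW ts] := leP s t; first exact: K.
by rewrite distrC; apply: K => //; rewrite distrC.
Qed.

Lemma abs_continuous_right c d h t : abs_continuous c d h -> c <= t < d ->
  h x @[x --> t^'+] --> h t.
Proof.
move=> /abs_continuous_within ach /andP[ct td].
apply/cvgrPdist_lt => e e0; have [eta eta0 H] := ach e e0.
near=> x.
have tx : t < x by near: x; exact: nbhs_right_gt.
have xd : x <= d by near: x; exact: nbhs_right_le.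
have xe : x - t < eta by near: x; exact: nbhs_right_ltDr.
apply: H; rewrite ?ct ?xd ?(ltW td) ?(le_trans ct (ltW tx))//.
by rewrite distrC ger0_norm// subr_ge0 ltW.
Unshelve. all: by end_near. Qed.

Lemma abs_continuous_left c d h t : abs_continuous c d h -> c < t <= d ->
  h x @[x --> t^'-] --> h t.
Proof.
move=> /abs_continuous_within ach /andP[ct td].
apply/cvgrPdist_lt => e e0; have [eta eta0 H] := ach e e0.
near=> x.
have xt : x < t by near: x; exact: nbhs_left_lt.
have cx : c <= x by near: x; exact: nbhs_left_ge.
have xe : t - x < eta by near: x; exact: nbhs_left_ltBl.
apply: H; rewrite ?cx ?td ?(ltW ct) ?(le_trans (ltW xt) td)//.
by rewrite ger0_norm// subr_ge0 ltW.
Unshelve. all: by end_near. Qed.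

Lemma abs_continuous_regulated h : abs_continuous (- half) half h ->
  regulated (- half)%:E half%:E h.
Proof.
move=> ach; apply/regulated_J; split => t tP; apply/cvg_ex; exists (h t).
  exact: abs_continuous_right tP.
exact: abs_continuous_left tP.
Qed.

(** h agrees with its one-sided limits inside J, so every partition sum is one of the sums in [var].
    This carries the finiteness assumed in sBV over to [total_variation]. *)
Lemma total_variation_le_var h : abs_continuous (- half) half h ->
  (total_variation (- half) half h <= var J h)%E.
Proof.
move=> ach; apply: ge_ereal_sup => _ [_ [s [pth /eqP lst] <-] <-].
have sh := (conj pth (introT eqP lst) : itv_partition (- half) half s).
have srt : sorted <%R (- half :: s) by [].
apply: ereal_sup_ubound; exists (- half :: s) => /=.
  split => // x /(nthP half)[i isz <-]; apply: mem_set; rewrite /Defs.J/= in_itv/=.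
  rewrite itv_partition_nth_ge//= itv_partition_nth_le//.
congr (_%:E); rewrite /variation big_mkord; apply: eq_bigr => i _ /=.
have isz : (i < size s)%N by [].
have i1 : (i < (size s).+1)%N by rewrite ltnS ltnW.
have lt_i : nth half (- half :: s) i < nth half s i by move/(pathP half) : pth; apply.
have ge_i : - half <= nth half (- half :: s) i := itv_partition_nth_ge i1 sh.
have le_i : nth half s i <= half := @itv_partition_nth_le _ _ _ _ _ i.+1 isz sh.
rewrite (set_nth_default half)// [nth 0 (_ :: s) i](set_nth_default half)//.
have -> : llim h (nth half s i) = h (nth half s i).
  by apply/cvg_lim => //; apply: abs_continuous_left ach _; rewrite le_i (le_lt_trans ge_i).
have -> : rlim h (nth half (- half :: s) i) = h (nth half (- half :: s) i).
  by apply/cvg_lim => //; apply: abs_continuous_right ach _; rewrite ge_i (lt_le_trans lt_i).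
by [].
Qed.

Lemma abs_continuous_J_density h : abs_continuous (- half) half h -> (var J h < +oo)%E ->
  exists u : R -> R, [/\ mu.-integrable [set: R] (EFin \o u),
    \int[mu]_(x in J) `|u x| <= 3 * fine (var J h) &
    {ae mu, forall x, - half < x < half -> is_derive x 1 h (u x)}].
Proof.
move=> ach vh; have lt := Nhalf_lt_half.
have TVvar := total_variation_le_var ach.
have bv : bounded_variation (- half) half h.
  apply/bounded_variationP; first exact: ltW.
  by rewrite ge0_fin_numE ?total_variation_ge0 ?(ltW lt)// (le_lt_trans TVvar).
have [u [iu u3 du]] := abs_continuous_derivable lt ach bv.
exists u; split => //.
have mu_ : measurable_fun setT u by apply/measurable_EFinP; exact: measurable_int iu.
rewrite /Rintegral -lee_fin fineK; last first.
  rewrite ge0_fin_numE; last by apply: integral_ge0 => x _; rewrite lee_fin.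
  have /integrableP[_] : mu.-integrable J (EFin \o u).
    by apply: integrableS iu => //; exact: measurable_itv.
  by [].
rewrite /Defs.J -integral_itv_obnd_cbnd; last first.
  apply/measurable_EFinP; apply: measurableT_comp => //; exact: measurable_funTS.
apply: (le_trans u3); rewrite EFinM lee_wpmul2l ?lee_fin//.
by rewrite fineK// ge0_fin_numE// var_ge0.
Qed.

End UnitInterval.

Lemma regulated_bounded {R : realType} (c d : R) (h : R -> R) : c <= d ->
  (forall t, c <= t < d -> cvg (h x @[x --> t^'+])) ->
  (forall t, c < t <= d -> cvg (h x @[x --> t^'-])) ->
  exists M, forall t, c <= t <= d -> `|h t| <= M.
Proof.
move=> cd hr hl.
apply: (real_induction (P := fun x => exists M, forall t, c <= t <= x -> `|h t| <= M) cd).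
  exists `|h c| => t /andP[ct tc]; suff -> : t = c by [].
  by apply/eqP; rewrite eq_le ct tc.
move=> t /andP[ct td].
have [r r0 [M1 Hr]] : exists2 r : R, 0 < r & exists M, t < d ->
    forall z, t < z < t + r -> `|h z| <= M.
  have [ltd|] := ltP t d; last by move=> _; exists 1 => //; exists 0.
  have [|r r0 H] := cvg_right_osc ltr01 (hr t _); first by rewrite ct.
  exists r => //; exists (`|h (t + r / 2)| + 1) => _ z zP.
  rewrite -(subrK (h (t + r / 2)) (h z)) addrC (le_trans (ler_normD _ _))// lerD2l.
  by apply: H => //; lra.
have [s s0 [M2 Hs]] : exists2 r : R, 0 < r & exists M, c < t ->
    forall z, t - r < z < t -> `|h z| <= M.
  have [ltc|] := ltP c t; last by move=> _; exists 1 => //; exists 0.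
  have [|s s0 H] := cvg_left_osc ltr01 (hl t _); first by rewrite ltc.
  exists s => //; exists (`|h (t - s / 2)| + 1) => _ z zP.
  rewrite -(subrK (h (t - s / 2)) (h z)) addrC (le_trans (ler_normD _ _))// lerD2l.
  by apply: H => //; lra.
exists (Num.min r s); first by rewrite lt_min r0.
move=> x y /andP[cx xt] /andP[ty yd] tx yt [M HM].
exists (Num.max (Num.max M `|h t|) (Num.max M1 M2)) => z /andP[cz zy].
rewrite !le_max.
have [zt|tz|->] := ltgtP z t; last by rewrite lexx orbT.
  have [zx|xz] := leP z x; first by rewrite HM// cz.
  have : t - x < Num.min r s by lra.
  rewrite lt_min => /andP[_ ts]; rewrite Hs ?orbT//; first exact: le_lt_trans zt.
  by rewrite zt andbT; lra.
have : y - t < Num.min r s by lra.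
rewrite lt_min => /andP[tr _]; rewrite Hr ?orbT//; first exact: lt_le_trans (le_trans zy yd).
by rewrite tz/=; lra.
Qed.

(** * Integrals against the derivative of a dynamic value *)

Section IntegralsOnJ.
Context {R : realType}.
Local Notation mu := (@lebesgue_measure R).
Local Notation half := (@Defs.half R).
Local Notation J := (@Defs.J R).
Implicit Types (h phi psi u : R -> R).

Definition Jbounded phi (e : R) := forall v, Jvals phi v -> `|v| <= e.

Lemma Jvals_right phi s : regulated (- half)%:E half%:E phi -> - half <= s < half ->
  Jvals phi (rlim phi s).
Proof. by move=> /regulated_J[hr _] sP; left; exists s => //; exact: hr. Qed.

Lemma Jbounded_ge0 phi e : regulated (- half)%:E half%:E phi -> Jbounded phi e -> 0 <= e.
Proof.
move=> rphi phie; apply: le_trans (phie _ (Jvals_right rphi (_ : - half <= - half < half))).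
  exact: normr_ge0.
by rewrite lexx Nhalf_lt_half.
Qed.

Lemma regulated_Jbounded phi : regulated (- half)%:E half%:E phi -> exists e, Jbounded phi e.
Proof.
move=> /regulated_J[hr hl].
have [M HM] := regulated_bounded (ltW Nhalf_lt_half) hr hl.
exists M => v [] [s /andP[s1 s2] phiv].
  rewrite -[v]subr0; apply: (@cvg_norm_le _ s^'+ _ phi) => //; near=> x; rewrite subr0.
  apply: HM; apply/andP; split; first by apply: (le_trans s1); near: x; exact: nbhs_right_ge.
  by near: x; exact: nbhs_right_le.
rewrite -[v]subr0; apply: (@cvg_norm_le _ s^'- _ phi) => //; near=> x; rewrite subr0.
apply: HM; apply/andP; split; first by near: x; exact: nbhs_left_ge.
by apply: (le_trans _ s2); near: x; exact: nbhs_left_le.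
Unshelve. all: by end_near. Qed.

(** u is an integrable stand-in for [derive1 h], about which nothing is known where h is not
    differentiable. *)
Definition Jdensity h u := mu.-integrable [set: R] (EFin \o u) /\
  {ae mu, forall x, - half < x < half -> is_derive x 1 h (u x)}.

Definition Jintegral phi h := \int[mu]_(s in J) (phi s * derive1 h s).

Lemma Jdensity_derive1 h u : Jdensity h u ->
  {ae mu, forall x, - half < x < half -> derive1 h x = u x}.
Proof.
move=> [_]; apply: filterS; first exact: (ae_filter_ringOfSetsType mu).
by move=> x H xP; have ? := H xP; rewrite derive1E derive_val.
Qed.

(** w is the product with phi set to 0 off a co-countable set of continuity points. There phi is
    measurable, and its values are one-sided limits, hence bounded by e. *)
Lemma regulated_mul_integrable phi u e : regulated (- half)%:E half%:E phi ->
    Jbounded phi e -> mu.-integrable [set: R] (EFin \o u) ->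
  exists w : R -> R, [/\ mu.-integrable J (EFin \o w),
    {ae mu, forall x, - half < x < half -> w x = phi x * u x} &
    `|\int[mu]_(s in J) w s| <= e * \int[mu]_(s in J) `|u s|].
Proof.
move=> rphi phie iu; have e0 := Jbounded_ge0 rphi phie.
have /regulated_J[hr hl] := rphi.
have [D [mD cD DJ Dc mphi]] := regulated_measurable Nhalf_lt_half hr hl.
have mJ : measurable (J : set (measurableTypeR R)) by exact: measurable_itv.
have phiD x : D x -> `|phi x| <= e.
  move=> Dx; have := DJ _ Dx; rewrite /= in_itv/= => /andP[x1 x2].
  apply: phie; left; exists x; first by rewrite x2 ltW.
  by apply: cvg_within_filter; exact: Dc.
pose w s := (phi \_ D) s * u s.
have mphiD : measurable_fun setT (phi \_ D) by apply/(measurable_restrictT _ mD).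
have mu_ : measurable_fun setT u by apply/measurable_EFinP; exact: measurable_int iu.
have wu x : `|w x| <= e * `|u x|.
  rewrite normrM ler_wpM2r// patchE; case: ifPn => [|_]; last by rewrite normr0.
  by rewrite inE; exact: phiD.
have iJu : mu.-integrable J (EFin \o u) by apply: integrableS iu.
have iJau : mu.-integrable J (EFin \o (fun x => `|u x|)) by exact: (integrable_abse iJu).
have iJeu : mu.-integrable J (EFin \o (fun x => e * `|u x|)).
  by have := @integrableZl _ _ _ mu J mJ e _ iJau.
have iw : mu.-integrable J (EFin \o w).
  apply: (le_integrable mJ _ _ iJeu).
    by apply/measurable_EFinP; apply: measurable_funTS; exact: measurable_funM.
  move=> x _ /=; rewrite lee_fin (le_trans (wu x))// ler_norm//.
exists w; split => //.
- exists (J `\` D); split.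
  + exact: measurableD.
  + exact: countable_lebesgue_measure0.
  + move=> x /= /not_implyP[/andP[x1 x2] wx]; split.
      by rewrite /Defs.J/= in_itv/= !ltW.
    by move=> Dx; apply: wx; rewrite /w patchE mem_set.
- apply: (le_trans (le_normr_Rintegral mJ iw)).
  rewrite -RintegralZl//; apply: le_Rintegral => //.
  exact: (integrable_abse iw).
Qed.

Lemma JintegralE h u phi e : Jdensity h u -> regulated (- half)%:E half%:E phi ->
    Jbounded phi e ->
  exists w : R -> R, [/\ mu.-integrable J (EFin \o w),
    {ae mu, forall x, - half < x < half -> w x = phi x * u x},
    Jintegral phi h = \int[mu]_(s in J) w s &
    `|Jintegral phi h| <= e * \int[mu]_(s in J) `|u s|].
Proof.
move=> hu rphi phie; have [w [iw wE we]] := regulated_mul_integrable rphi phie hu.1.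
have E : Jintegral phi h = \int[mu]_(s in J) w s.
  apply: eq_Rintegral_ae; have := Jdensity_derive1 hu; apply: filterS2 wE.
    exact: (ae_filter_ringOfSetsType mu).
  by move=> x wx hx xP; rewrite hx// wx.
by exists w; rewrite E; split.
Qed.

Lemma regulated_lin (k : R) phi psi : regulated (- half)%:E half%:E phi ->
  regulated (- half)%:E half%:E psi ->
  regulated (- half)%:E half%:E (fun s => k * phi s + psi s).
Proof.
move=> /regulated_J[r1 l1] /regulated_J[r2 l2]; apply/regulated_J.
split => t tP; apply: is_cvgD; [apply: is_cvgMr; exact: r1|exact: r2|apply: is_cvgMr; exact: l1|exact: l2].
Qed.

Lemma regulated_mul phi psi : regulated (- half)%:E half%:E phi ->
  regulated (- half)%:E half%:E psi ->
  regulated (- half)%:E half%:E (fun s => phi s * psi s).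
Proof.
move=> /regulated_J[r1 l1] /regulated_J[r2 l2]; apply/regulated_J.
by split => t tP; apply: is_cvgM; [exact: r1|exact: r2|exact: l1|exact: l2].
Qed.

Lemma Jintegral_lin h u (k : R) phi psi : Jdensity h u ->
  regulated (- half)%:E half%:E phi -> regulated (- half)%:E half%:E psi ->
  Jintegral (fun s => k * phi s + psi s) h = k * Jintegral phi h + Jintegral psi h.
Proof.
move=> hu r1 r2.
have [e1 b1] := regulated_Jbounded r1; have [e2 b2] := regulated_Jbounded r2.
have [w1 [i1 E1 -> _]] := JintegralE hu r1 b1.
have [w2 [i2 E2 -> _]] := JintegralE hu r2 b2.
have mJ : measurable (J : set (measurableTypeR R)) by exact: measurable_itv.
have ik1 : mu.-integrable J (EFin \o (fun x => k * w1 x)).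
  by have := @integrableZl _ _ _ mu J mJ k _ i1.
rewrite -RintegralZl// -RintegralD//.
apply: eq_Rintegral_ae; have := Jdensity_derive1 hu.
apply: filterS3 E1 E2; first exact: (ae_filter_ringOfSetsType mu).
by move=> x w1x w2x hx xP; rewrite hx// w1x// w2x//; ring.
Qed.

Lemma Jintegral_mul h1 h2 u1 u2 phi : Jdensity h1 u1 -> Jdensity h2 u2 ->
  regulated (- half)%:E half%:E h1 -> regulated (- half)%:E half%:E h2 ->
  regulated (- half)%:E half%:E phi ->
  Jintegral phi (fun s => h1 s * h2 s) =
  Jintegral (fun s => h2 s * phi s) h1 + Jintegral (fun s => h1 s * phi s) h2.
Proof.
move=> hu1 hu2 r1 r2 r3.
have r13 := regulated_mul r1 r3; have r23 := regulated_mul r2 r3.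
have [e1 b1] := regulated_Jbounded r13; have [e2 b2] := regulated_Jbounded r23.
have [w1 [i1 E1 -> _]] := JintegralE hu1 r23 b2.
have [w2 [i2 E2 -> _]] := JintegralE hu2 r13 b1.
have mJ : measurable (J : set (measurableTypeR R)) by exact: measurable_itv.
rewrite -RintegralD//.
apply: eq_Rintegral_ae.
have D12 : {ae mu, forall x, - half < x < half ->
    derive1 (fun s => h1 s * h2 s) x = h1 x * u2 x + h2 x * u1 x}.
  have [[_ d1] [_ d2]] := (hu1, hu2).
  apply: filterS2 d1 d2; first exact: (ae_filter_ringOfSetsType mu).
  move=> x d1 d2 xP; have ? := d1 xP; have ? := d2 xP.
  rewrite derive1E; have := is_deriveM (d1 xP) (d2 xP) => /(@derive_val _ _ _) ->//.
apply: filterS3 E1 E2 D12; first exact: (ae_filter_ringOfSetsType mu).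
by move=> x w1x w2x hx xP; rewrite hx// w1x// w2x//; ring.
Qed.

End IntegralsOnJ.

(** * Dynamic functions *)

Section DynamicValues.
Context {R : realType}.
Local Notation half := (@Defs.half R).
Local Notation Jreg := (regulated (- half)%:E half%:E).
Implicit Types (h phi psi : R -> R) (f g : dyn R).

Lemma Jvals_op (op : R -> R -> R) h1 h2 v :
  (forall F : set_system R, ProperFilter F -> forall p q, h1 x @[x --> F] --> p ->
     h2 x @[x --> F] --> q -> op (h1 x) (h2 x) @[x --> F] --> op p q) ->
  Jreg h1 -> Jreg h2 -> Jvals (fun s => op (h1 s) (h2 s)) v ->
  exists p q, [/\ v = op p q, Jvals h1 p & Jvals h2 q].
Proof.
move=> opC /regulated_J[r1 l1] /regulated_J[r2 l2] [] [s sP hv].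
  have c1 := r1 _ sP; have c2 := r2 _ sP.
  exists (rlim h1 s), (rlim h2 s); split; [|by left; exists s|by left; exists s].
  by apply: (cvg_unique _ hv); [exact: Rhausdorff|exact: opC].
have c1 := l1 _ sP; have c2 := l2 _ sP.
exists (llim h1 s), (llim h2 s); split; [|by right; exists s|by right; exists s].
by apply: (cvg_unique _ hv); [exact: Rhausdorff|exact: opC].
Qed.

Lemma Jvals_lin (k : R) h1 h2 v : Jreg h1 -> Jreg h2 ->
  Jvals (fun s => k * h1 s + h2 s) v ->
  exists p q, [/\ v = k * p + q, Jvals h1 p & Jvals h2 q].
Proof.
move=> r1 r2; apply: (@Jvals_op (fun x y => k * x + y)) => // F PF p q c1 c2.
by apply: cvgD => //; exact: cvgMr.
Qed.

Lemma Jvals_mul h1 h2 v : Jreg h1 -> Jreg h2 ->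
  Jvals (fun s => h1 s * h2 s) v ->
  exists p q, [/\ v = p * q, Jvals h1 p & Jvals h2 q].
Proof. by move=> r1 r2; apply: (@Jvals_op (fun x y => x * y)) => // F PF p q; exact: cvgM. Qed.

Lemma JvalsB h c v : Jvals (fun s => h s - c) v <-> Jvals h (v + c).
Proof.
split=> -[] [s sP hv]; [left|right|left|right]; exists s => //.
- by rewrite (_ : h = fun x => (h x - c) + c); [apply: cvgD => //; exact: cvg_cst|apply/funext => x; ring].
- by rewrite (_ : h = fun x => (h x - c) + c); [apply: cvgD => //; exact: cvg_cst|apply/funext => x; ring].
- by rewrite -[v](addrK c); apply: cvgB => //; exact: cvg_cst.
- by rewrite -[v](addrK c); apply: cvgB => //; exact: cvg_cst.
Qed.

Lemma dsupP (M : set R) f (e : R) :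
  (dsup M f <= e%:E)%E <-> forall t, M t -> Jbounded (f t) e.
Proof.
split=> [H t Mt v fv|H].
  rewrite -lee_fin; apply: le_trans H.
  apply: (@le_trans _ _ (ereal_sup [set `|w|%:E | w in Jvals (f t)])%E).
    by apply: ereal_sup_ubound; exists v.
  by apply: ereal_sup_ubound; exists t.
by apply/ge_ereal_sup => _ [t Mt <-]; apply/ge_ereal_sup => _ [v fv <-]; rewrite lee_fin; apply: (H t).
Qed.

(** [dyn_cvg] rephrased without the extended supremum and with a large inequality, so that filter
    reasoning applies. *)
Definition dyn_near (F : set_system R) f c := forall e : R, 0 < e ->
  \forall t \near F, forall p, Jvals (f t) p -> `|p - c| <= e.

Lemma dyn_cvgP (F : set_system R) f c : Filter F -> dyn_cvg F f c <-> dyn_near F f c.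
Proof.
move=> FF; split=> H e e0.
  have [M FM /ltW /dsupP HM] := H e e0; apply: filterS FM => t Mt p fp.
  by apply: (HM t Mt); apply/JvalsB; rewrite subrK.
have e2 : 0 < e / 2 by rewrite divr_gt0.
exists [set t | forall p, Jvals (f t) p -> `|p - c| <= e / 2]; first exact: H.
apply: (@le_lt_trans _ _ (e / 2)%:E); last by rewrite lte_fin; lra.
by apply/dsupP => t /= Ht v /JvalsB/Ht; rewrite addrK.
Qed.

Variables (a b : \bar R).
Hypothesis ab : (a < b)%E.
Local Notation I := (oitv a b).

(** Gathers the four kinds of limits in the definition of dG, so that each fact about limits is
    proved once. *)
Definition end_filter (F : set_system R) :=
  [\/ exists2 t, I t & F = t^'-, exists2 t, I t & F = t^'+, F = left_end a | F = right_end b].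

Lemma left_end_proper : ProperFilter (left_end a).
Proof. by case: a; typeclasses eauto. Qed.

Lemma right_end_proper : ProperFilter (right_end b).
Proof. by case: b; typeclasses eauto. Qed.

Lemma left_end_oitv : left_end a I.
Proof.
case: a ab => [r||] rb; last 2 first.
- by case: b rb.
- rewrite -[left_end _ _]/(\forall t \near ninfty_nbhs R, (-oo < t%:E)%E /\ (t%:E < b)%E).
  case: b rb => [s||]// _; near=> t; rewrite ltNyr ?ltry ?lte_fin; split => //.
  by near: t; apply: nbhs_ninfty_lt; rewrite num_real.
- rewrite -[left_end _ _]/(\forall t \near r^'+, (r%:E < t%:E)%E /\ (t%:E < b)%E).
  case: b rb => [s||]//; rewrite ?lte_fin => rs; near=> t; rewrite ?ltry !lte_fin; split => //.
Unshelve. all: by end_near. Qed.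

Lemma right_end_oitv : right_end b I.
Proof.
case: b ab => [r||] rb; last 2 first.
- rewrite -[right_end _ _]/(\forall t \near pinfty_nbhs R, (a < t%:E)%E /\ (t%:E < +oo)%E).
  case: a rb => [s||]// _; near=> t; rewrite ltry ?ltNyr ?lte_fin; split => //.
  by near: t; apply: nbhs_pinfty_gt; rewrite num_real.
- by case: a rb.
- rewrite -[right_end _ _]/(\forall t \near r^'-, (a < t%:E)%E /\ (t%:E < r%:E)%E).
  case: a rb => [s||]//; rewrite ?lte_fin => rs; near=> t; rewrite ?ltNyr !lte_fin; split => //.
Unshelve. all: by end_near. Qed.

Lemma end_filter_proper F : end_filter F -> ProperFilter F.
Proof.
by case=> [[t _ ->]|[t _ ->]|->|->]; [typeclasses eauto|typeclasses eauto|exact: left_end_proper|exact: right_end_proper].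
Qed.

Lemma end_filter_oitv F : end_filter F -> F I.
Proof.
case=> [[t It ->]|[t It ->]|->|->]; [exact: oitv_near_left|exact: oitv_near_right|exact: left_end_oitv|exact: right_end_oitv].
Qed.

Lemma dGP f : dG a b f <-> (forall t, I t -> Jreg (f t)) /\
  forall F, end_filter F -> exists c, dyn_near F f c.
Proof.
have P F c : end_filter F -> dyn_cvg F f c <-> dyn_near F f c.
  by move=> /end_filter_proper PF; exact: dyn_cvgP.
split=> [[H1 H2 H3 H4 H5]|[H1 H2]].
  split => // F EF; suff [c Hc] : exists c, dyn_cvg F f c by exists c; apply/P.
  by case: EF => [[t It ->]|[t It ->]|->|->]; [exact: H2|exact: H3|exact: H4|exact: H5].
have H F : end_filter F -> exists c, dyn_cvg F f c.
  by move=> EF; have [c Hc] := H2 F EF; exists c; apply/P.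
split => //; [move=> t It; apply: H|move=> t It; apply: H|apply: H|apply: H].
- by constructor 1; exists t.
- by constructor 2; exists t.
- by constructor 3.
- by constructor 4.
Qed.

Lemma dyn_near_lin F (k : R) f g c c' : end_filter F ->
  (forall t, I t -> Jreg (f t)) -> (forall t, I t -> Jreg (g t)) ->
  dyn_near F f c -> dyn_near F g c' -> dyn_near F (Defs.dadd (Defs.dscale k f) g) (k * c + c').
Proof.
move=> EF rf rg Hf Hg e e0; have PF := end_filter_proper EF.
have e1 : 0 < e / 2 / (`|k| + 1) by rewrite !divr_gt0// ltr_wpDl.
have e2 : 0 < e / 2 by rewrite divr_gt0.
have := end_filter_oitv EF.
apply: filterS3 (Hf _ e1) (Hg _ e2) => t Ht1 Ht2 It v.
move=> /(Jvals_lin (rf _ It) (rg _ It))[p [q [-> /Ht1 fp /Ht2 gq]]].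
rewrite opprD addrACA -mulrBr (le_trans (ler_normD _ _))//.
rewrite [leRHS](splitr e) lerD// normrM (le_trans (ler_wpM2l _ fp))//.
rewrite mulrCA ler_piMr ?(ltW e2)// ler_pdivrMr ?ltr_wpDl// mul1r.
by rewrite lerDl.
Qed.

Lemma dyn_near_mul F f g c c' : end_filter F ->
  (forall t, I t -> Jreg (f t)) -> (forall t, I t -> Jreg (g t)) ->
  dyn_near F f c -> dyn_near F g c' -> dyn_near F (dmul f g) (c * c').
Proof.
move=> EF rf rg Hf Hg e e0; have PF := end_filter_proper EF.
pose K := `|c| + `|c'| + 1.
have K0 : 0 < K by rewrite /K ltr_wpDl// addr_ge0.
(* The bound by 1 turns the quadratic error (p - c) (q - c') into a linear one; it accounts for the
   summand 1 in K. *)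
pose e1 := Num.min 1 (e / K).
have e10 : 0 < e1 by rewrite lt_min ltr01 divr_gt0.
have := end_filter_oitv EF.
apply: filterS3 (Hf _ e10) (Hg _ e10) => t Ht1 Ht2 It v.
move=> /(Jvals_mul (rf _ It) (rg _ It))[p [q [-> /Ht1 fp /Ht2 gq]]].
have -> : p * q - c * c' = (p - c) * (q - c') + (c * (q - c') + c' * (p - c)) by ring.
have e11 : e1 <= 1 by rewrite ge_min lexx.
have e1K : e1 * K <= e by rewrite -ler_pdivlMr// ge_min lexx orbT.
have : `|(p - c) * (q - c')| <= e1.
  by rewrite normrM -[e1]mulr1 ler_pM// (le_trans gq).
have : `|c * (q - c')| <= `|c| * e1 by rewrite normrM ler_wpM2l.
have : `|c' * (p - c)| <= `|c'| * e1 by rewrite normrM ler_wpM2l.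
have := ler_normD ((p - c) * (q - c')) (c * (q - c') + c' * (p - c)).
have := ler_normD (c * (q - c')) (c' * (p - c)).
by move: e1K; rewrite /K !mulrDr mulr1 (mulrC e1) (mulrC e1 `|c'|); lra.
Qed.

Lemma dG_lin (k : R) f g : dG a b f -> dG a b g -> dG a b (Defs.dadd (Defs.dscale k f) g).
Proof.
move=> /dGP[rf Hf] /dGP[rg Hg]; apply/dGP; split.
  by move=> t It; apply: regulated_lin; [exact: rf|exact: rg].
move=> F EF; have [c Hc] := Hf F EF; have [c' Hc'] := Hg F EF.
by exists (k * c + c'); exact: dyn_near_lin.
Qed.

Lemma dG_mul f g : dG a b f -> dG a b g -> dG a b (dmul f g).
Proof.
move=> /dGP[rf Hf] /dGP[rg Hg]; apply/dGP; split.
  by move=> t It; apply: regulated_mul; [exact: rf|exact: rg].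
move=> F EF; have [c Hc] := Hf F EF; have [c' Hc'] := Hg F EF.
by exists (c * c'); exact: dyn_near_mul.
Qed.

Lemma ordJ f t : Jreg (f t) -> Jvals (f t) (ord f t).
Proof. by move=> rf; apply: Jvals_right => //; rewrite lexx Nhalf_lt_half. Qed.

Lemma dyn_near_ord F f c : end_filter F -> (forall t, I t -> Jreg (f t)) ->
  dyn_near F f c -> ord f x @[x --> F] --> c.
Proof.
move=> EF rf Hf; have PF := end_filter_proper EF; apply/cvgrPdist_le => e e0.
have := end_filter_oitv EF; apply: filterS2 (Hf e e0) => t Ht It.
by rewrite distrC; apply: Ht; apply: ordJ; exact: rf.
Qed.

Lemma dG_ord f : dG a b f -> regulated a b (ord f).
Proof.
move=> /dGP[rf Hf].
have H F : end_filter F -> cvg (ord f x @[x --> F]).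
  by move=> EF; have [c Hc] := Hf F EF; apply/cvg_ex; exists c; exact: dyn_near_ord.
split; [move=> t It; apply: H|move=> t It; apply: H|apply: H|apply: H].
- by constructor 1; exists t.
- by constructor 2; exists t.
- by constructor 3.
- by constructor 4.
Qed.

Lemma ord_lin (k : R) f g t : Jreg (f t) -> Jreg (g t) ->
  ord (Defs.dadd (Defs.dscale k f) g) t = k * ord f t + ord g t.
Proof.
move=> /regulated_J[rf _] /regulated_J[rg _].
have H : - half <= - half < half by rewrite lexx Nhalf_lt_half.
apply/cvg_lim => //; apply: cvgD; last exact: rg.
by apply: cvgMr; exact: rf.
Qed.

Lemma ord_mul f g t : Jreg (f t) -> Jreg (g t) ->
  ord (dmul f g) t = ord f t * ord g t.
Proof.
move=> /regulated_J[rf _] /regulated_J[rg _].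
have H : - half <= - half < half by rewrite lexx Nhalf_lt_half.
by apply/cvg_lim => //; apply: cvgM; [exact: rf|exact: rg].
Qed.

End DynamicValues.

(** One comparison for three uses: ordinary parts on I, dynamic values on J and, with M1 = M2 = 0,
    constant dynamic values. *)
Lemma var_sum_comb {R : realType} (A : set R) (h f g : R -> R) (M1 M2 : R) :
  0 <= M1 -> 0 <= M2 ->
  (forall x y, A x -> A y -> x < y ->
     `|llim h y - rlim h x| <= M1 * `|llim f y - rlim f x| + M2 * `|llim g y - rlim g x|) ->
  (var A h <= M1%:E * var A f + M2%:E * var A g)%E.
Proof.
move=> M10 M20 H; rewrite [leLHS]varE; apply/ge_ereal_sup => _ [t [st tA] <-].
have ft : ((var_sum f t)%:E <= var A f)%E by rewrite varE; apply: ereal_sup_ubound; exists t.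
have gt : ((var_sum g t)%:E <= var A g)%E by rewrite varE; apply: ereal_sup_ubound; exists t.
apply: (@le_trans _ _ (M1 * var_sum f t + M2 * var_sum g t)%:E); last first.
  by rewrite EFinD !EFinM leeD// lee_wpmul2l// lee_fin.
rewrite lee_fin; elim: t st tA {ft gt} => [_ _|x [|y t] ih] /=.
- by rewrite !mulr0 addr0.
- by rewrite !addr0 !mulr0 addr0.
move=> /andP[xy yt] tA.
have Ax : A x by apply: set_mem; apply: tA; rewrite inE eqxx.
have Ay : A y by apply: set_mem; apply: tA; rewrite !inE eqxx orbT.
have {}ih : var_sum h (y :: t) <= M1 * var_sum f (y :: t) + M2 * var_sum g (y :: t).
  by apply: ih => // z zt; apply: tA; rewrite inE zt orbT.
move: ih => /=; have := H x y Ax Ay xy; rewrite !mulrDr; lra.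
Qed.

Lemma abs_continuous_mul {R : realType} (c d : R) (h1 h2 : R -> R) (M : R) :
  (forall x, c <= x <= d -> `|h1 x| <= M) -> (forall x, c <= x <= d -> `|h2 x| <= M) ->
  abs_continuous c d h1 -> abs_continuous c d h2 ->
  abs_continuous c d (fun x => h1 x * h2 x).
Proof.
move=> M1 M2 ac1 ac2 e e0.
pose K := `|M| + 1; have K0 : 0 < K by rewrite ltr_wpDl.
have MK : M <= K by rewrite /K; have := ler_norm M; lra.
have e1 : 0 < e / 2 / K by rewrite !divr_gt0.
have [d1 d10 H1] := ac1 _ e1; have [d2 d20 H2] := ac2 _ e1.
exists (Num.min d1 d2); first by rewrite lt_min d10.
move=> n x y xy txy; rewrite lt_min => /andP[xd1 xd2].
have {}H1 := H1 n x y xy txy xd1; have {}H2 := H2 n x y xy txy xd2.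
apply: (@le_lt_trans _ _ (\sum_(i < n) K * (`|h2 (y i) - h2 (x i)| + `|h1 (y i) - h1 (x i)|))).
  apply: ler_sum => i _; have [cx xyi yd] := xy i.
  have -> : h1 (y i) * h2 (y i) - h1 (x i) * h2 (x i) =
    h1 (y i) * (h2 (y i) - h2 (x i)) + h2 (x i) * (h1 (y i) - h1 (x i)) by ring.
  rewrite (le_trans (ler_normD _ _))// !normrM mulrDr lerD// ler_wpM2r// (le_trans _ MK)//.
    by apply: M1; rewrite yd (le_trans cx).
  by apply: M2; rewrite cx (le_trans xyi).
rewrite -mulr_sumr big_split/=.
have -> : e = K * (e / 2 / K + e / 2 / K) by field; rewrite gt_eqF.
by rewrite ltr_pM2l// ltrD.
Qed.

(** * Boundedness in dG and one-sided limits in sG *)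

Section Slow.
Context {R : realType}.
Local Notation half := (@Defs.half R).
Local Notation J := (@Defs.J R).
Local Notation Jreg := (regulated (- half)%:E half%:E).
Implicit Types (f g phi : dyn R).
Variables (a b : \bar R).
Hypothesis ab : (a < b)%E.
Local Notation I := (oitv a b).

Lemma left_end_ex (A : set R) : left_end a A -> exists2 r, I r & forall t, I t -> t <= r -> A t.
Proof.
move=> FA; have PF := left_end_proper a; have FI := left_end_oitv ab.
have H : exists s : R, (\forall r \near left_end a, r < s) /\ forall t, I t -> t < s -> A t.
  case: a ab FA {PF FI} => [r0||] rb; [|by case: b rb|].
    move=> [e /= e0 He]; exists (r0 + e); split.
      by apply: nbhs_right_lt; rewrite ltrDl.
    move=> t [+ _] te; rewrite lte_fin => r0t; apply: He => //=.
    by rewrite ltr0_norm ?subr_lt0//; lra.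
  move=> [M [Mr HM]]; exists M; split; first exact: nbhs_ninfty_lt.
  by move=> t _; exact: HM.
have [s [sF sA]] := H.
have [r [Ir rs]] : exists r, I r /\ r < s.
  by near (left_end a) => r; exists r; split; near: r.
by exists r => // t It tr; apply: sA => //; exact: le_lt_trans rs.
Unshelve. all: by end_near. Qed.

Lemma right_end_ex (A : set R) : right_end b A -> exists2 r, I r & forall t, I t -> r <= t -> A t.
Proof.
move=> FA; have PF := right_end_proper b; have FI := right_end_oitv ab.
have H : exists s : R, (\forall r \near right_end b, s < r) /\ forall t, I t -> s < t -> A t.
  case: b ab FA {PF FI} => [r0||]; last 2 first.
  - move=> rb [M [Mr HM]]; exists M; split; first exact: nbhs_pinfty_gt.
    by move=> t _; exact: HM.
  - by case: a.
  move=> rb [e /= e0 He]; exists (r0 - e); split.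
    by apply: nbhs_left_gt; rewrite ltrBlDr ltrDl.
  move=> t [_ +] te; rewrite lte_fin => r0t; apply: He => //=.
  by rewrite gtr0_norm ?subr_gt0//; lra.
have [s [sF sA]] := H.
have [r [Ir rs]] : exists r, I r /\ s < r.
  by near (right_end b) => r; exists r; split; near: r.
by exists r => // t It tr; apply: sA => //; exact: lt_le_trans tr.
Unshelve. all: by end_near. Qed.

Lemma dyn_near_Jbounded F f c : end_filter a b F -> dyn_near F f c ->
  \forall t \near F, Jbounded (f t) (`|c| + 1).
Proof.
move=> /end_filter_proper PF /(_ 1 ltr01); apply: filterS => t H v /H vc.
by rewrite -(subrK c v) addrC (le_trans (ler_normD _ _))// lerD2l.
Qed.

Lemma Jbounded_le (h : R -> R) e e' : e <= e' -> Jbounded h e -> Jbounded h e'.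
Proof. by move=> ee' he v /he /le_trans; apply. Qed.

(** The limits at the two ends bound f outside some [r1, r2]; on [r1, r2] real induction combines
    the one-sided limits at t with the bound for f(t) itself. *)
Lemma dG_bounded f : dG a b f -> exists M, forall t, I t -> Jbounded (f t) M.
Proof.
move=> /dGP[rf Hf].
have EL : end_filter a b (left_end a) by constructor 3.
have ER : end_filter a b (right_end b) by constructor 4.
have [c1 /(dyn_near_Jbounded EL)/left_end_ex[r1 Ir1 H1]] := Hf _ EL.
have [c2 /(dyn_near_Jbounded ER)/right_end_ex[r2 Ir2 H2]] := Hf _ ER.
have [M0 HM0] : exists M, forall t, r1 <= t <= r2 -> Jbounded (f t) M.
  have [r12|r21] := leP r1 r2; last first.
    by exists 0 => t /andP[r1t tr2]; have := le_trans r1t tr2; rewrite leNgt r21.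
  apply: (real_induction (P := fun x => exists M, forall t, r1 <= t <= x -> Jbounded (f t) M) r12).
    have [e He] := regulated_Jbounded (rf _ Ir1); exists e => t /andP[t1 t2].
    by have -> : t = r1 by apply/eqP; rewrite eq_le t1 t2.
  move=> t tr; have It : I t by exact: (oitv_convex Ir1 Ir2).
  have E1 : end_filter a b t^'- by constructor 1; exists t.
  have E2 : end_filter a b t^'+ by constructor 2; exists t.
  have [c3 /(dyn_near_Jbounded E1)[s1 /= s10 K1]] := Hf _ E1.
  have [c4 /(dyn_near_Jbounded E2)[s2 /= s20 K2]] := Hf _ E2.
  have [e He] := regulated_Jbounded (rf _ It).
  exists (Num.min s1 s2); first by rewrite lt_min s10.
  move=> x y /andP[r1x xt] /andP[ty yr2] tx yt [M HM].
  exists (Num.max (Num.max M e) (Num.max (`|c3| + 1) (`|c4| + 1))) => z /andP[r1z zy].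
  have [zt|tz|->] := ltgtP z t; last by apply: Jbounded_le He; rewrite !le_max lexx orbT.
    have [zx|xz] := leP z x.
      by apply: (@Jbounded_le _ M); [rewrite !le_max lexx|apply: HM; rewrite r1z].
    apply: (@Jbounded_le _ (`|c3| + 1)); first by rewrite !le_max lexx !orbT.
    apply: K1 => //=; rewrite gtr0_norm ?subr_gt0//.
    by have : t - x < Num.min s1 s2; [lra|rewrite lt_min => /andP[]; lra].
  apply: (@Jbounded_le _ (`|c4| + 1)); first by rewrite !le_max lexx !orbT.
  apply: K2 => //=; rewrite ltr0_norm ?subr_lt0//.
  by have : y - t < Num.min s1 s2; [lra|rewrite lt_min => /andP[]; lra].
exists (Num.max M0 (Num.max (`|c1| + 1) (`|c2| + 1))) => t It.
have [tr1|r1t] := leP t r1.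
  by apply: (@Jbounded_le _ (`|c1| + 1)); [rewrite !le_max lexx !orbT|exact: H1].
have [tr2|r2t] := leP t r2.
  by apply: (@Jbounded_le _ M0); [rewrite !le_max lexx|apply: HM0; rewrite (ltW r1t)].
by apply: (@Jbounded_le _ (`|c2| + 1)); [rewrite !le_max lexx !orbT|apply: H2 => //; exact: ltW].
Qed.

Section SlowFunction.
Variable f : dyn R.
Hypothesis sf : sG a b f.

Lemma sG_dG : dG a b f. Proof. exact: sf.1. Qed.

Lemma sG_abs_continuous t : I t -> abs_continuous (- half) half (f t).
Proof. by move=> /sf.2[]. Qed.

Lemma sG_regulated t : I t -> Jreg (f t).
Proof. by move=> /sG_abs_continuous; exact: abs_continuous_regulated. Qed.

Lemma sG_near_left t : I t -> dyn_near t^'- f (f t (- half)).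
Proof. by move=> /sf.2[_ + _] => /dyn_cvgP; apply. Qed.

Lemma sG_near_right t : I t -> dyn_near t^'+ f (f t half).
Proof. by move=> /sf.2[_ _] => /dyn_cvgP; apply. Qed.

Lemma sG_ord t : I t -> ord f t = f t (- half).
Proof.
move=> /sG_abs_continuous ac; apply/cvg_lim => //; apply: abs_continuous_right ac _.
by rewrite lexx Nhalf_lt_half.
Qed.

(** In sG the dynamic value at t starts at f(t-), which is just the limit that [ord] reads off. *)
Lemma sG_ord_left t : I t -> ord f x @[x --> t^'-] --> ord f t.
Proof.
move=> It; rewrite sG_ord//; apply: (dyn_near_ord ab).
- by constructor 1; exists t.
- exact: sG_regulated.
- exact: sG_near_left.
Qed.

Lemma sG_ord_right t : I t -> cvg (ord f x @[x --> t^'+]).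
Proof.
move=> It; apply/cvg_ex; exists (f t half); apply: (dyn_near_ord ab).
- by constructor 2; exists t.
- exact: sG_regulated.
- exact: sG_near_right.
Qed.

Lemma sG_Jvals t s : I t -> - half <= s <= half -> Jvals (f t) (f t s).
Proof.
move=> /sG_abs_continuous ac /andP[s1 s2]; have lt : - half < half := Nhalf_lt_half.
have [sh|hs] := ltP s half.
  by left; exists s; [rewrite s1|apply: abs_continuous_right ac _; rewrite s1].
right; exists s; first by rewrite s2 (lt_le_trans lt).
by apply: abs_continuous_left ac _; rewrite s2 (lt_le_trans lt).
Qed.

Lemma sG_ord_value t c : I t -> has_ord_value f t c ->
  forall s, - half <= s <= half -> f t s = c.
Proof. by move=> It fc s /(sG_Jvals It); rewrite fc. Qed.

End SlowFunction.
End Slow.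

(** * The algebra sBV *)

Section SlowBV.
Context {R : realType}.
Local Notation mu := (@lebesgue_measure R).
Local Notation half := (@Defs.half R).
Local Notation J := (@Defs.J R).
Local Notation Jreg := (regulated (- half)%:E half%:E).
Implicit Types (f g phi : dyn R).
Variables (a b : \bar R).
Hypothesis ab : (a < b)%E.
Local Notation I := (oitv a b).

Lemma sG_lim_left f t x : sG a b f -> I t -> - half < x <= half -> llim (f t) x = f t x.
Proof.
by move=> sf It xP; apply/cvg_lim => //; apply: abs_continuous_left xP; exact: (sG_abs_continuous sf).
Qed.

Lemma sG_lim_right f t x : sG a b f -> I t -> - half <= x < half -> rlim (f t) x = f t x.
Proof.
by move=> sf It xP; apply/cvg_lim => //; apply: abs_continuous_right xP; exact: (sG_abs_continuous sf).
Qed.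

Lemma sG_var_ord f t : sG a b f -> I t -> U a b f t -> var J (f t) = 0%E.
Proof.
move=> sf It [_ [c fc]]; have ftc := sG_ord_value sf It fc.
(* A constant has no increments, so the comparison holds with both coefficients 0; finiteness of the
   variation is not presupposed. *)
have : (var J (f t) <= 0%:E * var J (f t) + 0%:E * var J (f t))%E.
  apply: var_sum_comb => // x y; rewrite /Defs.J/= !in_itv/= => /andP[x1 x2] /andP[y1 y2] xy.
  rewrite sG_lim_left ?y2 ?(le_lt_trans x1)// sG_lim_right ?x1 ?(lt_le_trans xy)//.
  by rewrite !ftc ?x1 ?y1// subrr normr0 !mul0r addr0.
by rewrite !mul0e adde0 => v0; apply/eqP; rewrite eq_le v0 var_ge0.
Qed.

Lemma sG_U_T f t : sG a b f -> I t -> ~ T a b f t -> U a b f t.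
Proof.
move=> sf It nT; split => //; have [c [fc _ _]] : dyn_continuous_at f t.
  by apply: contrapT => H; apply: nT; split.
by exists c.
Qed.

Section OneFunction.
Variable f : dyn R.
Hypothesis hf : sBV a b f.

Lemma sBV_sG : sG a b f. Proof. by case: hf. Qed.

Lemma sBV_var_lty t : I t -> (var J (f t) < +oo)%E.
Proof.
move=> It; have [sf _ sD] := hf.
have [Ut|nU] := pselect (U a b f t); first by rewrite sG_var_ord// ltry.
apply: le_lt_trans sD; apply: (@le_trans _ _ (\esum_(s in [set t]) var J (f s))%E).
  by rewrite esum_set1// var_ge0.
by apply: sub_esum => [_ ->|x _]; [split|exact: var_ge0].
Qed.

Definition jump_var t := fine (var J (f t)).

Lemma jump_var_ge0 t : 0 <= jump_var t.
Proof. by rewrite fine_ge0// var_ge0. Qed.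

Lemma jump_varE t : I t -> (jump_var t)%:E = var J (f t).
Proof. by move=> It; rewrite fineK// ge0_fin_numE ?var_ge0// sBV_var_lty. Qed.

(** The sum over D(f) in the definition of [sBV] extends to I, since the variation vanishes on
    U(f). *)
Lemma jump_var_summable : abs_summable I jump_var.
Proof.
have [sf _ sD] := hf.
apply: le_lt_trans sD; rewrite [leLHS](_ : _ = \esum_(t in I) var J (f t))%E; last first.
  by apply: eq_esum => t It; rewrite ger0_norm ?jump_var_ge0// jump_varE.
rewrite [leLHS](_ : _ = \esum_(t in I `&` D a b f) var J (f t))%E.
  by apply: sub_esum => [x []//|x _]; exact: var_ge0.
rewrite [RHS]esum_mkcondr; apply: eq_esum => t It.
have [//|] := boolP (t \in D a b f).
rewrite notin_setE => nD; apply: sG_var_ord => //.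
by apply: contrapT => nU; apply: nD; split.
Qed.

Lemma sBV_density t : I t -> exists2 u : R -> R, Jdensity (f t) u &
  \int[mu]_(s in J) `|u s| <= 3 * jump_var t.
Proof.
move=> It; have ac := sG_abs_continuous sBV_sG It.
by have [u [iu u3 du]] := abs_continuous_J_density ac (sBV_var_lty It); exists u.
Qed.

Lemma Jintegral_le phi t e : I t -> Jreg (phi t) -> Jbounded (phi t) e ->
  `|Jintegral (phi t) (f t)| <= 3 * e * jump_var t.
Proof.
move=> It rphi phie; have [u fu u3] := sBV_density It.
have [w [_ _ _ H]] := JintegralE fu rphi phie.
have e0 := Jbounded_ge0 rphi phie.
rewrite (le_trans H)// (le_trans (ler_wpM2l e0 u3))//.
by rewrite mulrCA mulrA.
Qed.

Lemma Jintegral_summable phi e : 0 <= e -> (forall t, I t -> Jreg (phi t)) ->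
  (forall t, I t -> Jbounded (phi t) e) ->
  abs_summable I (fun t => Jintegral (phi t) (f t)).
Proof.
move=> e0 rphi phie; apply: (abs_summable_le _ (abs_summableZ (3 * e) jump_var_summable)).
move=> t It; rewrite [leRHS]ger0_norm ?mulr_ge0 ?jump_var_ge0//.
exact: Jintegral_le (rphi _ It) (phie _ It).
Qed.

Lemma Jintegral_rsum_T phi : dG a b phi ->
  rsum (T a b f) (fun t => Jintegral (phi t) (f t)) =
  rsum I (fun t => Jintegral (phi t) (f t)).
Proof.
move=> dphi; have [M phiM] := dG_bounded ab dphi; have [rphi _ _ _ _] := dphi.
apply: rsum_restrict => [t []//|t It nT].
have U_t := sG_U_T sBV_sG It nT.
apply/eqP; rewrite -normr_le0 (le_trans (Jintegral_le It (rphi _ It) (phiM _ It)))//.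
by rewrite /jump_var (sG_var_ord sBV_sG It U_t)/= mulr0.
Qed.

Lemma Jintegral_rsum_le phi e : 0 <= e -> (forall t, I t -> Jreg (phi t)) ->
  (forall t, I t -> Jbounded (phi t) e) ->
  `|rsum I (fun t => Jintegral (phi t) (f t))| <=
    e * (3 * fine (\esum_(t in I) (jump_var t)%:E)).
Proof.
move=> e0 rphi phie; have sJ := Jintegral_summable e0 rphi phie.
have vfin : (\esum_(t in I) (jump_var t)%:E)%E \is a fin_num.
  by apply: esum_ge0_fin jump_var_summable => t _; exact: jump_var_ge0.
apply: (rsum_le sJ).
rewrite mulrA (mulrC e) EFinM fineK//.
rewrite -(@esumZl _ I (3 * e) jump_var) ?mulr_ge0//; last by move=> t _; exact: jump_var_ge0.
apply: le_esum => t It; rewrite lee_fin.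
exact: Jintegral_le (rphi _ It) (phie _ It).
Qed.

Lemma sBV_dominated : exists W : R -> R,
  [/\ exists B, forall x y, I x -> I y -> W y - W x <= B &
      forall x y, I x -> I y -> x <= y -> `|ord f y - ord f x| <= W y - W x].
Proof.
have [sf [_ vf] _] := hf; apply: variation_dominates vf => t It.
  exact: (sG_ord_left ab sf).
exact: (sG_ord_right ab sf).
Qed.

End OneFunction.

Lemma sBV_mul f g : sBV a b f -> sBV a b g -> sBV a b (dmul f g).
Proof.
move=> hf hg; have sf := sBV_sG hf; have sg := sBV_sG hg.
have [M1 fM1] := dG_bounded ab (sG_dG sf).
have [M2 gM2] := dG_bounded ab (sG_dG sg).
pose M := Num.max 0 (Num.max M1 M2).
have M0 : 0 <= M by rewrite le_max lexx.
have fM t : I t -> Jbounded (f t) M by move=> /fM1; apply: Jbounded_le; rewrite !le_max lexx !orbT.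
have gM t : I t -> Jbounded (g t) M by move=> /gM2; apply: Jbounded_le; rewrite !le_max lexx !orbT.
have fJM t s : I t -> - half <= s <= half -> `|f t s| <= M.
  by move=> It sP; apply: (fM t It); exact: (sG_Jvals sf).
have gJM t s : I t -> - half <= s <= half -> `|g t s| <= M.
  by move=> It sP; apply: (gM t It); exact: (sG_Jvals sg).
have rf := sG_regulated sf; have rg := sG_regulated sg.
have Eleft t : I t -> end_filter a b t^'- by constructor 1; exists t.
have Eright t : I t -> end_filter a b t^'+ by constructor 2; exists t.
have sfg : sG a b (dmul f g).
  split; first exact: (dG_mul ab (sG_dG sf) (sG_dG sg)).
  move=> t It; split.
  - apply: (@abs_continuous_mul _ _ _ _ _ M).
    + by move=> x; exact: fJM.
    + by move=> x; exact: gJM.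
    + exact: (sG_abs_continuous sf).
    + exact: (sG_abs_continuous sg).
  - apply/dyn_cvgP; apply: (dyn_near_mul ab (Eleft t It) rf rg).
      exact: (sG_near_left sf).
    exact: (sG_near_left sg).
  - apply/dyn_cvgP; apply: (dyn_near_mul ab (Eright t It) rf rg).
      exact: (sG_near_right sf).
    exact: (sG_near_right sg).
have [_ [_ vf] _] := hf; have [_ [_ vg] _] := hg.
(* Bounds the variation of the ordinary part on I and of each dynamic value on J alike. *)
have prod (p q p' q' : R) : `|p'| <= M -> `|q| <= M ->
    `|p' * q' - p * q| <= M * `|p' - p| + M * `|q' - q|.
  move=> p'M qM; have -> : p' * q' - p * q = q * (p' - p) + p' * (q' - q) by ring.
  by rewrite (le_trans (ler_normD _ _))// !normrM lerD// ler_wpM2r.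
split; first exact: sfg.
- split; first exact: (dG_ord ab (sG_dG sfg)).
  have ordE : {in I, ord (dmul f g) =1 (fun t => ord f t * ord g t)}.
    by move=> t /set_mem It; rewrite ord_mul//; [exact: rf|exact: rg].
  apply: (@le_lt_trans _ _ (M%:E * var I (ord f) + M%:E * var I (ord g))%E); last first.
    by apply: lte_add_pinfty; apply: lte_mul_pinfty; rewrite ?lee_fin.
  apply: var_sum_comb => // x y Ix Iy xy.
  have ol h t : sBV a b h -> I t -> ord h z @[z --> t^'-] --> ord h t.
    by move=> /sBV_sG sh It; exact: (sG_ord_left ab sh).
  have oR h t : sBV a b h -> I t -> cvg (ord h z @[z --> t^'+]).
    by move=> /sBV_sG sh It; exact: (sG_ord_right ab sh).
  have -> : llim (ord (dmul f g)) y = ord f y * ord g y.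
    rewrite -ordE; last exact: mem_set.
    by apply/cvg_lim => //; exact: (sG_ord_left ab sfg).
  have -> : llim (ord f) y = ord f y by apply/cvg_lim => //; exact: ol.
  have -> : llim (ord g) y = ord g y by apply/cvg_lim => //; exact: ol.
  have -> : rlim (ord (dmul f g)) x = rlim (ord f) x * rlim (ord g) x.
    apply/cvg_lim => //; apply: (@cvg_trans _ ((fun t => ord f t * ord g t) @ x^'+)).
      apply: near_eq_cvg; near=> z; rewrite ordE//; apply: mem_set.
      by near: z; exact: oitv_near_right.
    by apply: cvgM; exact: oR.
  have ordM h t : (forall t, I t -> Jreg (h t)) -> (forall t, I t -> Jbounded (h t) M) ->
      I t -> `|ord h t| <= M.
    by move=> rh hM It; apply: (hM t It); apply: ordJ; exact: rh.
  apply: prod; first exact: ordM.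
  rewrite -[rlim _ _]subr0; apply: (@cvg_norm_le _ x^'+ _ (ord g)); first exact: oR.
  near=> z; rewrite subr0; apply: ordM => //.
  by near: z; exact: oitv_near_right.
- have sD : abs_summable I (fun t => M * (jump_var f t + jump_var g t)).
    by apply: abs_summableZ; apply: abs_summableD; exact: jump_var_summable.
  apply: le_lt_trans sD.
  apply: (@le_trans _ _ (\esum_(t in I) var J (dmul f g t))%E).
    by apply: sub_esum => [t []//|t _]; exact: var_ge0.
  apply: le_esum => t It.
  rewrite ger0_norm ?mulr_ge0 ?addr_ge0 ?jump_var_ge0//.
  rewrite mulrDr EFinD !EFinM jump_varE// jump_varE//.
  apply: var_sum_comb => // x y; rewrite /Defs.J/= !in_itv/= => /andP[x1 x2] /andP[y1 y2] xy.
  have xP : - half <= x < half by rewrite x1 (lt_le_trans xy).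
  have yP : - half < y <= half by rewrite y2 (le_lt_trans x1).
  rewrite (sG_lim_left sfg It yP) (sG_lim_right sfg It xP).
  rewrite (sG_lim_left sf It yP) (sG_lim_right sf It xP).
  rewrite (sG_lim_left sg It yP) (sG_lim_right sg It xP).
  by apply: prod; [apply: fJM => //; rewrite y1|apply: gJM => //; rewrite x1].
Unshelve. all: by end_near. Qed.

End SlowBV.

(** * Derivatives as bounded functionals *)

Section Distributions.
Context {R : realType}.
Local Notation half := (@Defs.half R).
Local Notation Jreg := (regulated (- half)%:E half%:E).
Implicit Types (f g phi psi : dyn R).
Variables (a b : \bar R).
Hypothesis ab : (a < b)%E.
Local Notation I := (oitv a b).
Local Notation lin k phi psi := (Defs.dadd (Defs.dscale k phi) psi).

(** Bounding all one-sided limits by 0 expresses the ordinary value 0. *)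
Definition vanishes_off phi c d := forall t, I t -> ~~ (c <= t <= d) -> Jbounded (phi t) 0.

Definition bounded_support phi :=
  exists c d, [/\ c <= d, `[c, d] `<=` I & vanishes_off phi c d].

Lemma oitv_nonempty : exists t, I t.
Proof.
have PF := left_end_proper a; near (left_end a) => t; exists t; near: t.
exact: left_end_oitv.
Unshelve. all: by end_near. Qed.

(** The infimum and the supremum of a non-empty compact support belong to it, hence to I, so its
    hull is a closed interval inside I, as the Stieltjes integral needs. *)
Lemma test_bounded_support phi : test a b phi -> dG a b phi /\ bounded_support phi.
Proof.
move=> [dphi cK]; split => //; set K := supp a b phi in cK.
have off t : I t -> ~ K t -> Jbounded (phi t) 0.
  move=> It nK v phiv.
  have : has_ord_value phi t 0.
    apply: contrapT => H; apply: nK; split => //; apply: subset_closure; by split.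
  by move=> H; move: phiv; rewrite H => ->; rewrite normr0.
have [K0|/set0P K0] := eqVneq K set0.
  (* An empty support is given a one-point interval. *)
  have [t It] := oitv_nonempty; exists t, t; split => //.
    move=> s /=; rewrite in_itv/= => /andP[ts st]; suff <- : t = s by [].
    by apply/eqP; rewrite eq_le ts st.
  by move=> s Is _; apply: off => //; rewrite K0.
have clK : closed K by apply: compact_closed => //; exact: Rhausdorff.
have [M [_ HM]] := compact_bounded cK.
have KM x : K x -> `|x| <= M + 1 by move=> Kx; apply: HM => //; rewrite ltrDl.
have ubK : has_ubound K by exists (M + 1) => x /KM; rewrite ler_norml => /andP[].
have lbK : has_lbound K by exists (- (M + 1)) => x /KM; rewrite ler_norml => /andP[].
have clKE : closure K = K by apply/esym/closure_id.
have Ks : K (sup K) by have := closure_sup K0 ubK; rewrite clKE.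
have Ki : K (inf K).
  have : closure K (inf K).
    move=> B [e /= e0 HB]; have [x Kx xe] := inf_adherent e0 (conj K0 lbK).
    exists x; split => //; apply: HB => /=.
    by rewrite ler0_norm ?subr_le0 ?ge_inf//; lra.
  by rewrite clKE.
have KI x : K x -> I x by case.
exists (inf K), (sup K); split.
- exact: ub_le_sup.
- by move=> x /=; rewrite in_itv/= => xK; apply: oitv_convex xK; exact: KI.
- move=> t It tK; apply: off => // Kt; move/negP : tK; apply.
  by apply/andP; split; [exact: ge_inf|exact: ub_le_sup].
Qed.

Lemma vanishes_off_sub phi c d c' d' : c' <= c -> d <= d' -> vanishes_off phi c d ->
  vanishes_off phi c' d'.
Proof.
move=> c'c dd' H t It nt; apply: H => //; apply: contra nt => /andP[ct td].
by rewrite (le_trans c'c)// (le_trans td).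
Qed.

Lemma vanishes_off_ord phi c d t : dG a b phi -> vanishes_off phi c d -> I t ->
  ~~ (c <= t <= d) -> ord phi t = 0.
Proof.
move=> /dGP[rphi _] H It nt; apply/eqP; rewrite -normr_le0.
by apply: (H t It nt); apply: ordJ; exact: rphi.
Qed.

Lemma hull_sub c d c' d' : `[c, d] `<=` I -> `[c', d'] `<=` I -> c <= d -> c' <= d' ->
  `[Num.min c c', Num.max d d'] `<=` I.
Proof.
move=> cdI cdI' cd cd' t; rewrite /= in_itv/= ge_min le_max => /andP[ct td].
have [Ic Id] : I c /\ I d by split; apply: cdI; rewrite /= in_itv/= lexx ?andbT.
have [Ic' Id'] : I c' /\ I d' by split; apply: cdI'; rewrite /= in_itv/= lexx ?andbT.
have Im : I (Num.min c c') by rewrite /Num.min; case: ifP.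
have IM : I (Num.max d d') by rewrite /Num.max; case: ifP.
by apply: (oitv_convex Im IM); rewrite ge_min le_max ct td.
Qed.

Lemma common_support phi psi : bounded_support phi -> bounded_support psi ->
  exists c d, [/\ c <= d, `[c, d] `<=` I, vanishes_off phi c d & vanishes_off psi c d].
Proof.
move=> [c [d [cd cdI H]]] [c' [d' [cd' cdI' H']]].
exists (Num.min c c'), (Num.max d d'); split.
- by rewrite le_max ge_min cd.
- exact: hull_sub.
- by apply: vanishes_off_sub H; rewrite ?ge_min ?le_max lexx.
- by apply: vanishes_off_sub H'; rewrite ?ge_min ?le_max lexx ?orbT.
Qed.

Lemma vanishes_off_lin (k : R) phi psi c d : dG a b phi -> dG a b psi ->
  vanishes_off phi c d -> vanishes_off psi c d -> vanishes_off (lin k phi psi) c d.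
Proof.
move=> /dGP[rphi _] /dGP[rpsi _] H H' t It nt v.
move=> /(Jvals_lin (rphi _ It) (rpsi _ It))[p [q [-> /(H t It nt) + /(H' t It nt)]]].
by rewrite !normr_le0 => /eqP -> /eqP ->; rewrite mulr0 addr0.
Qed.

Lemma vanishes_off_mul f phi c d : dG a b f -> dG a b phi ->
  vanishes_off phi c d -> vanishes_off (dmul f phi) c d.
Proof.
move=> /dGP[rf _] /dGP[rphi _] H t It nt v.
move=> /(Jvals_mul (rf _ It) (rphi _ It))[p [q [-> _ /(H t It nt)]]].
by rewrite normr_le0 => /eqP ->; rewrite mulr0 normr0.
Qed.

Lemma regulated_at h t : regulated a b h -> I t ->
  cvg (h x @[x --> t^'-]) /\ cvg (h x @[x --> t^'+]).
Proof. by move=> [hl hr _ _] It; split; [exact: hl|exact: hr]. Qed.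

Section Derivative.
Variable g : dyn R.
Hypothesis hg : sBV a b g.
Local Notation gc := (cont_part a b (ord g)).

Let gl t : I t -> ord g x @[x --> t^'-] --> ord g t.
Proof. exact: (sG_ord_left ab (sBV_sG hg)). Qed.

Let gr t : I t -> cvg (ord g x @[x --> t^'+]).
Proof. exact: (sG_ord_right ab (sBV_sG hg)). Qed.

Lemma cont_part_ord_dominated : exists W : R -> R,
  [/\ exists2 B, 0 <= B & forall x y, I x -> I y -> W y - W x <= B &
      forall x y, I x -> I y -> x <= y -> `|gc y - gc x| <= W y - W x].
Proof.
have [W [[B WB] gW]] := sBV_dominated ab hg.
exists (fun x => 2 * W x); split.
  exists (Num.max 0 (2 * B)) => [|x y Ix Iy]; first by rewrite le_max lexx.
  by rewrite -mulrBr le_max ler_wpM2l ?orbT// WB.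
move=> x y Ix Iy xy; rewrite -mulrBr.
by apply: (cont_part_dominated gl gr _ gW) => //; exists B.
Qed.

(** The value chosen by [xget] is pinned down by uniqueness across all admissible intervals: the
    integral over the hull of two of them restricts to each. *)
Lemma stieltjes_is_RS phi c d : dG a b phi -> c <= d -> `[c, d] `<=` I ->
  vanishes_off phi c d -> is_RS (ord phi) gc c d (stieltjes a b (ord phi) gc).
Proof.
move=> dphi cd cdI Hphi.
have [W [_ gW]] := cont_part_ord_dominated.
have [W0 [WB0 gW0]] := sBV_dominated ab hg.
have ex c' d' : c' <= d' -> `[c', d'] `<=` I -> exists l, is_RS (ord phi) gc c' d' l.
  move=> cd' cdI'.
  have I' t : c' <= t <= d' -> I t by move=> tP; apply: cdI'; rewrite /= in_itv.
  apply: (regulated_is_RS (W := W) cd').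
  - move=> x y c'x xy yd'; apply: gW => //; apply: I'.
      by rewrite c'x (le_trans xy).
    by rewrite yd' (le_trans c'x).
  - by move=> t /I' It; exact: (cont_part_continuous gl gr WB0 gW0).
  - by move=> t /I' It; apply: regulated_at It; exact: dG_ord.
have uniq c' d' l l' : c' <= d' -> `[c', d'] `<=` I ->
    is_RS (ord phi) gc c' d' l -> is_RS (ord phi) gc c' d' l' -> l = l'.
  move=> cd' cdI'; apply: (is_RS_unique (W := W) cd').
  have I' t : c' <= t <= d' -> I t by move=> tP; apply: cdI'; rewrite /= in_itv.
  move=> x y c'x xy yd'; apply: gW => //; apply: I'.
    by rewrite c'x (le_trans xy).
  by rewrite yd' (le_trans c'x).
have [l Hl] := ex c d cd cdI.
suff -> : stieltjes a b (ord phi) gc = l by [].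
apply: xget_unique.
  exists c, d; split => // t It; apply: contraNT => nt.
  by apply/eqP; exact: (vanishes_off_ord dphi Hphi).
move=> l' [c' [d' [cd' cdI' zero Hl']]].
have hI := hull_sub cdI cdI' cd cd'.
have [|L HL] := ex (Num.min c c') (Num.max d d') _ hI; first by rewrite le_max ge_min cd.
have I' t : Num.min c c' <= t <= Num.max d d' -> I t by move=> tP; apply: hI; rewrite /= in_itv.
have H1 : is_RS (ord phi) gc c d L.
  apply: is_RS_restrict HL; rewrite ?ge_min ?le_max ?lexx//.
  by move=> t /I' It nt; exact: (vanishes_off_ord dphi Hphi).
have H2 : is_RS (ord phi) gc c' d' L.
  apply: is_RS_restrict HL; rewrite ?ge_min ?le_max ?lexx ?orbT//.
  by move=> t /I' It nt; apply/eqP; apply: contraNT nt; exact: zero.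
by rewrite (uniq _ _ _ _ cd' cdI' Hl' H2) (uniq _ _ _ _ cd cdI Hl H1).
Qed.

Lemma stieltjes_eq phi c d l : dG a b phi -> c <= d -> `[c, d] `<=` I ->
  vanishes_off phi c d -> is_RS (ord phi) gc c d l -> stieltjes a b (ord phi) gc = l.
Proof.
move=> dphi cd cdI Hphi Hl; have [W [_ gW]] := cont_part_ord_dominated.
have I' t : c <= t <= d -> I t by move=> tP; apply: cdI; rewrite /= in_itv.
apply: (is_RS_unique (W := W) cd _ (stieltjes_is_RS dphi cd cdI Hphi) Hl).
move=> x y cx xy yd; apply: gW => //; apply: I'.
  by rewrite cx (le_trans xy).
by rewrite yd (le_trans cx).
Qed.

Lemma dyn_derivE phi : dG a b phi -> dyn_deriv a b g phi =
  stieltjes a b (ord phi) gc + rsum I (fun t => Jintegral (phi t) (g t)).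
Proof. by move=> dphi; rewrite -(Jintegral_rsum_T ab hg dphi). Qed.

End Derivative.

(** Continuity in the sup norm with one constant for all supports. Multiplication by an element of
    dG preserves it, because such an element is bounded. *)
Definition bounded_functional (F : dyn R -> R) :=
  (forall (k : R) phi psi, dG a b phi -> dG a b psi ->
     bounded_support phi -> bounded_support psi ->
     F (lin k phi psi) = k * F phi + F psi) /\
  exists C, forall e phi, dG a b phi -> bounded_support phi ->
    (forall t, I t -> Jbounded (phi t) e) -> `|F phi| <= e * C.

Lemma bounded_functional_distribution F : bounded_functional F -> Defs.distribution a b F.
Proof.
move=> [Flin [C FC]]; split.
  move=> k phi psi /test_bounded_support[d1 b1] /test_bounded_support[d2 b2].
  exact: Flin.
move=> phi_ phi tphi_ /test_bounded_support[d1 b1] [cvgphi _].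
apply/cvgrPdist_lt => e e0.
pose e1 := e / (`|C| + 1).
have C1 : 0 < `|C| + 1 by rewrite ltr_wpDl.
have e10 : 0 < e1 by rewrite divr_gt0.
have nb : nbhs (0%E : \bar R) [set x : \bar R | (x < e1%:E)%E].
  by apply: open_ereal_lt'; rewrite lte_fin.
have : \forall n \near \oo, (dsup I (Defs.dsub (phi_ n) phi) < e1%:E)%E by exact: (cvgphi _ nb).
apply: filterS => n /ltW/dsupP Hn.
have [d2 b2] := test_bounded_support (tphi_ n).
(* Linearity is stated for k phi + psi, so the difference is formed with k = -1. *)
have Hlin : F (lin (-1) phi (phi_ n)) = - F phi + F (phi_ n).
  by rewrite Flin// mulN1r.
have linE : lin (-1) phi (phi_ n) = Defs.dsub (phi_ n) phi.
  by apply/funext => t; apply/funext => s; rewrite /Defs.dadd /Defs.dscale /Defs.dsub; ring.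
have [c [d [cd cdI H1 H2]]] := common_support b1 b2.
have bl : bounded_support (lin (-1) phi (phi_ n)).
  by exists c, d; split => //; exact: vanishes_off_lin.
have := FC e1 _ (dG_lin ab (-1) d1 d2) bl.
rewrite Hlin {1}linE addrC distrC => /(_ Hn) K.
have CC : e1 * C <= e1 * `|C| by rewrite ler_wpM2l ?(ltW e10)// ler_norm.
have : e1 * `|C| < e by rewrite /e1 mulrAC ltr_pdivrMr// ltr_pM2l// ltrDl.
by move: (le_trans K CC); lra.
Qed.

Lemma bounded_functional_add F G : bounded_functional F -> bounded_functional G ->
  bounded_functional (distr_add F G).
Proof.
move=> [Flin [C FC]] [Glin [C' GC]]; split.
  by move=> k phi psi d1 d2 b1 b2; rewrite /distr_add Flin// Glin//; ring.
exists (C + C') => e phi d1 b1 He; rewrite /distr_add mulrDr (le_trans (ler_normD _ _))//.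
by rewrite lerD// ?FC// GC.
Qed.

Lemma bounded_support_mul g phi : dG a b g -> dG a b phi -> bounded_support phi ->
  bounded_support (dmul g phi).
Proof.
by move=> dg dphi [c [d [cd cdI H]]]; exists c, d; split => //; exact: vanishes_off_mul.
Qed.

Lemma bounded_functional_mul g F : dG a b g -> bounded_functional F ->
  bounded_functional (distr_mul g F).
Proof.
move=> dg [Flin [C FC]].
have [M0 gM0] := dG_bounded ab dg.
split.
  move=> k phi psi d1 d2 b1 b2; rewrite /distr_mul.
  have -> : dmul g (lin k phi psi) = lin k (dmul g phi) (dmul g psi).
    by apply/funext => t; apply/funext => s; rewrite /dmul /Defs.dadd /Defs.dscale; ring.
  by apply: Flin; [exact: dG_mul|exact: dG_mul|exact: bounded_support_mul|exact: bounded_support_mul].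
exists (`|M0| * C) => e phi d1 b1 He.
rewrite mulrCA mulrA; apply: FC; [exact: dG_mul|exact: bounded_support_mul|].
move=> t It v; have /dGP[rg _] := dg; have /dGP[rphi _] := d1.
move=> /(Jvals_mul (rg _ It) (rphi _ It))[p [q [-> /(gM0 t It) + /(He t It)]]] => pM qe.
by rewrite normrM ler_pM// (le_trans pM)// ler_norm.
Qed.

(** The Stieltjes part is at most e times an increment of a function dominating the continuous part,
    and B bounds these increments on every [c, d]. Each integral over J is at most 3 e times the
    variation of g(t). *)
Lemma bounded_functional_deriv g : sBV a b g -> bounded_functional (dyn_deriv a b g).
Proof.
move=> hg; split.
  move=> k phi psi d1 d2 b1 b2.
  have [c [d [cd cdI H1 H2]]] := common_support b1 b2.
  have d3 := dG_lin ab k d1 d2; have H3 := vanishes_off_lin (k := k) d1 d2 H1 H2.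
  have /dGP[r1 _] := d1; have /dGP[r2 _] := d2.
  rewrite !dyn_derivE//.
  have I' t : c <= t <= d -> I t by move=> tP; apply: cdI; rewrite /= in_itv.
  rewrite (stieltjes_eq hg (l := k * stieltjes a b (ord phi) (cont_part a b (ord g)) +
      stieltjes a b (ord psi) (cont_part a b (ord g))) d3 cd cdI H3); last first.
    have := is_RS_lin k (stieltjes_is_RS hg d1 cd cdI H1) (stieltjes_is_RS hg d2 cd cdI H2).
    apply: eq_is_RS => // x /I' Ix; rewrite ord_lin//; [exact: r1|exact: r2].
  have [M1 B1] := dG_bounded ab d1; have [M2 B2] := dG_bounded ab d2.
  have [t0 It0] := oitv_nonempty.
  have M10 := Jbounded_ge0 (r1 _ It0) (B1 _ It0).
  have M20 := Jbounded_ge0 (r2 _ It0) (B2 _ It0).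
  have s1 := Jintegral_summable hg M10 r1 B1.
  have s2 := Jintegral_summable hg M20 r2 B2.
  rewrite (@eq_rsum _ _ _ (fun t => k * Jintegral (phi t) (g t) + Jintegral (psi t) (g t))).
    rewrite (rsumD (abs_summableZ k s1) s2) rsumZ//; ring.
  move=> t It; have [u gu _] := sBV_density hg It.
  exact: (Jintegral_lin k gu (r1 _ It) (r2 _ It)).
have [W [[B B0 WB] gW]] := cont_part_ord_dominated hg.
exists (B + 3 * fine (\esum_(t in I) (jump_var g t)%:E)) => e phi dphi [c [d [cd cdI H]]] He.
have /dGP[rphi _] := dphi.
have [t0 It0] := oitv_nonempty.
have e0 := Jbounded_ge0 (rphi _ It0) (He _ It0).
have I' t : c <= t <= d -> I t by move=> tP; apply: cdI; rewrite /= in_itv.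
rewrite dyn_derivE// (le_trans (ler_normD _ _))// mulrDr lerD//; last first.
  exact: (Jintegral_rsum_le hg e0 rphi He).
have := stieltjes_is_RS hg dphi cd cdI H.
move=> /(is_RS_le (W := W) cd) K.
apply: (@le_trans _ _ (e * (W d - W c))).
  apply: K.
    move=> x y cx xy yd; apply: gW => //; apply: I'.
      by rewrite cx (le_trans xy).
    by rewrite yd (le_trans cx).
  by move=> x /I' Ix; apply: (He x Ix); apply: ordJ; exact: rphi.
by rewrite ler_wpM2l// WB//; apply: I'; rewrite lexx ?andbT.
Qed.

Lemma dyn_deriv_mul f g phi : sBV a b f -> sBV a b g -> dG a b phi -> bounded_support phi ->
  dyn_deriv a b (dmul f g) phi =
  dyn_deriv a b f (dmul g phi) + dyn_deriv a b g (dmul f phi).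
Proof.
move=> hf hg dphi [c [d [cd cdI H]]].
have hfg := sBV_mul ab hf hg.
have [sf sg] := (sBV_sG hf, sBV_sG hg).
have [df dg] := (sG_dG sf, sG_dG sg).
have /dGP[rphi _] := dphi.
have [rf rg] := (sG_regulated sf, sG_regulated sg).
have dgphi := dG_mul ab dg dphi; have dfphi := dG_mul ab df dphi.
have Hg := vanishes_off_mul dg dphi H; have Hf := vanishes_off_mul df dphi H.
have I' t : c <= t <= d -> I t by move=> tP; apply: cdI; rewrite /= in_itv.
rewrite !dyn_derivE//.
have [W1 [[B1 WB1] fW1]] := sBV_dominated ab hf.
have [W2 [[B2 WB2] gW2]] := sBV_dominated ab hg.
have [W3 [[B3 WB3] kW3]] := sBV_dominated ab hfg.
(* A single W has to dominate the increments of f, g and f g at once. *)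
pose W x := W1 x + W2 x + W3 x.
have W_D x y : W y - W x = (W1 y - W1 x) + (W2 y - W2 x) + (W3 y - W3 x) by rewrite /W; ring.
have WB : exists B, forall x y, I x -> I y -> W y - W x <= B.
  exists (B1 + B2 + B3) => x y Ix Iy; rewrite W_D.
  by have := WB1 x y Ix Iy; have := WB2 x y Ix Iy; have := WB3 x y Ix Iy; lra.
have ge0 V h x y : (forall x y, I x -> I y -> x <= y -> `|ord h y - ord h x| <= V y - V x) ->
    I x -> I y -> x <= y -> 0 <= V y - V x :> R.
  by move=> hV Ix Iy xy; apply: le_trans (hV x y Ix Iy xy).
have fW x y : I x -> I y -> x <= y -> `|ord f y - ord f x| <= W y - W x.
  move=> Ix Iy xy; have := fW1 x y Ix Iy xy; rewrite W_D.
  by have := ge0 _ _ _ _ gW2 Ix Iy xy; have := ge0 _ _ _ _ kW3 Ix Iy xy; lra.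
have gW x y : I x -> I y -> x <= y -> `|ord g y - ord g x| <= W y - W x.
  move=> Ix Iy xy; have := gW2 x y Ix Iy xy; rewrite W_D.
  by have := ge0 _ _ _ _ fW1 Ix Iy xy; have := ge0 _ _ _ _ kW3 Ix Iy xy; lra.
have kW x y : I x -> I y -> x <= y -> `|ord (dmul f g) y - ord (dmul f g) x| <= W y - W x.
  move=> Ix Iy xy; have := kW3 x y Ix Iy xy; rewrite W_D.
  by have := ge0 _ _ _ _ fW1 Ix Iy xy; have := ge0 _ _ _ _ gW2 Ix Iy xy; lra.
have kE z : I z -> ord (dmul f g) z = ord f z * ord g z.
  by move=> Iz; apply: ord_mul; [exact: rf|exact: rg].
have [M phiM] := dG_bounded ab dphi.
have RS1 := stieltjes_is_RS hfg dphi cd cdI H.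
have RS2 : is_RS (fun x => ord g x * ord phi x) (cont_part a b (ord f)) c d
    (stieltjes a b (ord (dmul g phi)) (cont_part a b (ord f))).
  apply: eq_is_RS (stieltjes_is_RS hf dgphi cd cdI Hg) => // x /I' Ix.
  by rewrite ord_mul//; [exact: rg|exact: rphi].
have RS3 : is_RS (fun x => ord f x * ord phi x) (cont_part a b (ord g)) c d
    (stieltjes a b (ord (dmul f phi)) (cont_part a b (ord g))).
  apply: eq_is_RS (stieltjes_is_RS hg dfphi cd cdI Hf) => // x /I' Ix.
  by rewrite ord_mul//; [exact: rf|exact: rphi].
rewrite (cont_part_mul_RS (sG_ord_left ab sf) (sG_ord_right ab sf) (sG_ord_left ab sg)
  (sG_ord_right ab sg) kE WB fW gW kW cd cdI (M := M) _ RS1 RS2 RS3); last first.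
  by move=> x /I' Ix; apply: (phiM x Ix); apply: ordJ; exact: rphi.
(* The Stieltjes integrals are matched; the sums over I are then compared term by term. *)
rewrite [RHS]addrACA; congr (_ + _).
have /dGP[rgphi _] := dgphi; have /dGP[rfphi _] := dfphi.
have [N1 Nb1] := dG_bounded ab dgphi; have [N2 Nb2] := dG_bounded ab dfphi.
have [t0 It0] := oitv_nonempty.
have N10 := Jbounded_ge0 (rgphi _ It0) (Nb1 _ It0).
have N20 := Jbounded_ge0 (rfphi _ It0) (Nb2 _ It0).
rewrite -(rsumD (Jintegral_summable hf N10 rgphi Nb1) (Jintegral_summable hg N20 rfphi Nb2)).
apply: eq_rsum => t It.
have [u1 fu1 _] := sBV_density hf It; have [u2 gu2 _] := sBV_density hg It.
exact: (Jintegral_mul fu1 gu2 (rf _ It) (rg _ It) (rphi _ It)).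
Qed.

End Distributions.

Theorem theorem6 (R : realType) (a b : \bar R) (ab : (a < b)%E)
    (f g : dyn R) (hf : sBV a b f) (hg : sBV a b g) :
  sBV a b (dmul f g) /\
  distr_eq a b (dyn_deriv a b (dmul f g))
    (distr_add (distr_mul g (dyn_deriv a b f)) (distr_mul f (dyn_deriv a b g))).
Proof.
have hfg := sBV_mul ab hf hg; split => //; split.
- by apply: bounded_functional_distribution => //; exact: bounded_functional_deriv.
- apply: bounded_functional_distribution => //; apply: bounded_functional_add;
    apply: bounded_functional_mul => //; try exact: bounded_functional_deriv.
  + exact: sG_dG (sBV_sG hg).
  + exact: sG_dG (sBV_sG hf).
- move=> phi /(test_bounded_support ab)[dphi bphi].
  exact: dyn_deriv_mul.
Qed.
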